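(* Let $F$ be a biconnected chordal graph that is not complete. Then the following problem is NP-complete: given a chordal graph $G$ and a positive integer $k$, decide whether there exists $V_-\subseteq V(G)$ with $|V_-|\le k$ such that $G - V_-$ contains no induced subgraph isomorphic to $F$. Moreover, if $F$ is a complete split graph with a split partition $C\uplus I$ satisfying $|C| = 2$ and $|I|\ge 2$, then the same problem restricted to input graphs $G$ that are split graphs is NP-complete.
   Context: All graphs are finite, simple and undirected. A graph is chordal if every cycle of length greater than three has a chord. A graph is biconnected if it is connected, has at least two vertices... (i.e., has no cut vertex). A graph is a split graph if its vertex set can be partitioned into a clique $C$ and an independent set $I$ (a split partition $C\uplus I$); it is a complete split graph if, in addition, every vertex of $C$ is adjacent to every vertex of $I$. *)

(* Defs.v *)
From Corelib Require Import BinNums.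
From mathcomp Require Import all_boot.

Set Implicit Arguments.
Unset Strict Implicit.
Unset Printing Implicit Defensive.

(** * Finite simple graphs *)

Record sgraph := SGraph {
  vertex :> finType;
  edge : rel vertex;
  edge_sym : symmetric edge;
  edge_irrefl : irreflexive edge }.

Section Induced.
Variables (G : sgraph) (S : {set G}).

Definition induced_edge : rel {x : G | x \in S} :=
  fun x y => edge (val x) (val y).

Lemma induced_edge_sym : symmetric induced_edge.
Proof. by move=> x y; apply: edge_sym. Qed.

Lemma induced_edge_irrefl : irreflexive induced_edge.
Proof. by move=> x; apply: edge_irrefl. Qed.

Definition induced : sgraph := SGraph induced_edge_sym induced_edge_irrefl.

End Induced.

Definition delete (G : sgraph) (V : {set G}) : sgraph := induced (~: V).

Definition isomorphic (G H : sgraph) : Prop :=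
  exists f : G -> H, bijective f /\ forall x y, edge (f x) (f y) = edge x y.

Definition contains_induced (F G : sgraph) : Prop :=
  exists S : {set G}, isomorphic (induced S) F.

Definition complete (G : sgraph) : Prop :=
  forall x y : G, x != y -> edge x y.

Definition connected (G : sgraph) : Prop :=
  forall x y : G, connect (@edge G) x y.

(** For connected [G]; this is the only case in which it is used. *)
Definition cut_vertex (G : sgraph) (v : G) : Prop :=
  ~ connected (delete [set v]).

Definition biconnected (G : sgraph) : Prop :=
  [/\ connected G, 2 <= #|G| & forall v : G, ~ cut_vertex v].

(** [x] and [y] are two vertices of the cycle [c] that are adjacent in the
    graph but not consecutive on [c]. *)
Definition chord (G : sgraph) (c : seq G) (x y : G) : Prop :=
  [/\ x \in c, y \in c, edge x y, y != next c x & x != next c y].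

Definition chordal (G : sgraph) : Prop :=
  forall c : seq G, ucycle (@edge G) c -> 3 < size c ->
    exists x y : G, chord c x y.

Definition clique (G : sgraph) (C : {set G}) : Prop :=
  {in C &, forall x y, x != y -> edge x y}.

Definition independent (G : sgraph) (I : {set G}) : Prop :=
  {in I &, forall x y, ~~ edge x y}.

Definition split_partition (G : sgraph) (C I : {set G}) : Prop :=
  [/\ C :|: I = setT, C :&: I = set0, clique C & independent I].

Definition split_graph (G : sgraph) : Prop :=
  exists C I : {set G}, split_partition C I.

Definition complete_split_partition (G : sgraph) (C I : {set G}) : Prop :=
  split_partition C I /\ {in C & I, forall x y, edge x y}.

(** * Deterministic multi-tape Turing machines *)

(** A two-way infinite tape.  [tleft] lists the cells to the left of the head
    from right to left; all cells beyond the two lists are blank. *)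
Record tape (S : Type) := Tape { tleft : seq S; thead : S; tright : seq S }.

Inductive move := MoveL | MoveR | Stay.

(** Tape [ord0] is used both for the input and for the output; the other
    [work] tapes are initially blank.  The symbols [bit false] and [bit true]
    represent the input alphabet. *)
Record machine := Machine {
  work : nat;
  state : finType;
  symb : finType;
  blank : symb;
  bit : bool -> symb;
  bit_inj : injective bit;
  bit_blank : forall b, bit b != blank;
  start : state;
  halt : pred state;
  accept : pred state;
  trans : state -> {ffun 'I_work.+1 -> symb} ->
          state * {ffun 'I_work.+1 -> symb * move} }.

Section Semantics.
Variable M : machine.

Definition tape_of (s : seq (symb M)) : tape (symb M) :=
  if s is a :: s' then Tape [::] a s' else Tape [::] (blank M) [::].

Definition tape_act (am : symb M * move) (t : tape (symb M)) : tape (symb M) :=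
  let: (a, m) := am in
  match m with
  | Stay => Tape (tleft t) a (tright t)
  | MoveL => if tleft t is b :: l then Tape l b (a :: tright t)
             else Tape [::] (blank M) (a :: tright t)
  | MoveR => if tright t is b :: r then Tape (a :: tleft t) b r
             else Tape (a :: tleft t) (blank M) [::]
  end.

Record config := Config {
  cstate : state M;
  ctapes : {ffun 'I_(work M).+1 -> tape (symb M)} }.

Definition init (w : seq bool) : config :=
  Config (start M)
    [ffun i => if i == ord0 then tape_of (map (@bit M) w) else tape_of [::]].

(** Halted configurations are fixed points, so that halting within [t] steps
    means being in a halting state after exactly [t] iterations. *)
Definition step (c : config) : config :=
  if halt (cstate c) then c else
  let: (q, act) := trans (cstate c) [ffun i => thead (ctapes c i)] in
  Config q [ffun i => tape_act (act i) (ctapes c i)].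

Definition run (t : nat) (w : seq bool) : config := iter t step (init w).

(** The output starts under the head and extends to the right, followed only
    by blanks. *)
Definition has_output (c : config) (w : seq bool) : Prop :=
  let t := ctapes c ord0 in
  exists m, thead t :: rcons (tright t) (blank M) =
            map (@bit M) w ++ nseq m.+1 (blank M).

End Semantics.

(** * Polynomial time and NP-completeness *)

(** Every polynomial is bounded by one of this form. *)
Definition poly_bound (c d n : nat) : nat := c * n ^ d + c.

Definition language := seq bool -> Prop.

Definition polytime_function (f : seq bool -> seq bool) : Prop :=
  exists (M : machine) (c d : nat), forall w : seq bool,
    let fin := run M (poly_bound c d (size w)) w in
    halt (cstate fin) /\ has_output fin (f w).

Definition in_P (L : language) : Prop :=
  exists (M : machine) (c d : nat), forall w : seq bool,
    let fin := run M (poly_bound c d (size w)) w in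
    halt (cstate fin) /\ (accept (cstate fin) <-> L w).

(** Pairing of bit strings: the bits of [x] are doubled and followed by the
    separator 01. *)
Definition pair_enc (x y : seq bool) : seq bool :=
  flatten [seq [:: b; b] | b <- x] ++ [:: false, true & y].

Definition in_NP (L : language) : Prop :=
  exists (V : language) (c d : nat), in_P V /\
    forall x, L x <->
      exists y, size y <= poly_bound c d (size x) /\ V (pair_enc x y).

Definition reduces (L L' : language) : Prop :=
  exists f, polytime_function f /\ forall x, L x <-> L' (f x).

Definition NP_hard (L : language) : Prop := forall L', in_NP L' -> reduces L' L.

Definition NP_complete (L : language) : Prop := in_NP L /\ NP_hard L.

(** * The vertex deletion problem *)

(** Least significant bit first; the last bit is 1. *)
Fixpoint pos_bits (p : positive) : seq bool :=
  match p with
  | xH => [:: true]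
  | xO q => false :: pos_bits q
  | xI q => true :: pos_bits q
  end.

Definition nat_bits (k : nat) : seq bool :=
  if bin_of_nat k is Npos p then pos_bits p else [::].

(** [n] in unary, the adjacency matrix in row-major order, [k] in binary. *)
Definition encode (n : nat) (e : rel 'I_n) (k : nat) : seq bool :=
  nseq n true ++ false ::
  [seq e i j | i <- enum 'I_n, j <- enum 'I_n] ++ nat_bits k.

(** The yes-instances of the problem of deleting at most [k] vertices from a
    graph in the class [cls] so as to destroy all induced copies of [F].
    Strings that do not encode a pair of a graph in [cls] and a positive
    integer are not in the language. *)
Definition vertex_deletion (F : sgraph) (cls : sgraph -> Prop) : language :=
  fun w => exists (n : nat) (e : rel 'I_n)
                  (esym : symmetric e) (eirr : irreflexive e) (k : nat),
    let G := SGraph esym eirr in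
    [/\ w = encode e k, cls G, 0 < k &
        exists V : {set G}, #|V| <= k /\ ~ contains_induced F (delete V)].

(* Main.v *)
(* Hardness.  Fix an edge ab of F.  Given a graph H, make V(H) a clique and
   glue along every edge ij of H a private copy of F, identifying ab with ij.
   The result is chordal because it is a clique sum of chordal graphs, and it is
   split when F is complete split and ab is its clique.  A deletion set may be
   pushed into the clique, where it has to be a vertex cover of H; conversely,
   once a vertex cover is deleted, every gadget hangs on at most one clique
   vertex, so a copy of F, having no cut vertex, would lie inside the clique (but
   F is not complete) or inside a proper part of a gadget (which is too small).
   H comes from a CNF: its vertices are the literal occurrences, and conflicting
   occurrences are joined.  The CNF describes the computation of an NP verifier by
   Horn clauses on the columns (state and all tape symbols at a given offset from
   the heads); as the tapes rather than the heads move, the rules are local.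

   Membership.  The certificate consists of the deleted vertices and a first-order
   checkable proof that the graph is in the class: a bipartition for split graphs;
   for chordal graphs and every induced path u, v, w a set of vertices that
   separates u from w in the graph without the other neighbours of v.

   Polynomial time.  A predicate [computable] on functions of the input word and
   of a natural-number environment is closed under composition and bounded
   iteration, since the values live on counter tapes. *)

From Stdlib Require Import FunctionalExtensionality.
Require Import Defs.
From mathcomp Require Import all_boot zify.

Set Implicit Arguments.
Unset Strict Implicit.
Unset Printing Implicit Defensive.

(** * Structured programs for multi-tape machines *)

(** Three obstacles shape the details. Counters are unary, so a value has to stay polynomial for its
    loops to be affordable; but the bound [k] is written in binary and may be exponential in the
    input length. As at most [n] vertices can be deleted, the verifier only ever computes the
    minimum of [k] and [n]. Next, no clause of the CNF says that a cell carries only one column. The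
    implications force the true variables to include a genuine run of the verifier; further true
    variables do no harm. Finally, [F] is fixed: its adjacency becomes a constant table, and the
    search for a copy of [F] a nest of [#|F|] loops. A graph class enters only through closure under
    isomorphism, a checkable certificate of membership and the fact that it contains the glued
    graphs, so both statements share one argument. *)

Definition sym : finType := option (option bool).
Definition blk : sym := None.
Definition mrk : sym := Some None.
Definition bt (b : bool) : sym := Some (Some b).

(** With infinitely many tapes, programs can be combined without fixing the number of tapes in
    advance; [below] recovers the finite number in use. *)
Definition tapes := nat -> tape sym.

Definition act (am : sym * move) (t : tape sym) : tape sym :=
  let: (a, m) := am in
  match m with
  | Stay => Tape (tleft t) a (tright t)
  | MoveL => if tleft t is b :: l then Tape l b (a :: tright t)
             else Tape [::] blk (a :: tright t)
  | MoveR => if tright t is b :: r then Tape (a :: tleft t) b r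
             else Tape (a :: tleft t) blk [::]
  end.

Inductive cmd :=
| Act (j i : nat) (f : sym -> sym -> sym * move)
| Seq (a b : cmd)
| While (j : nat) (P : pred sym) (c : cmd).

Fixpoint pstate (c : cmd) : finType :=
  match c with
  | Act _ _ _ => unit
  | Seq a b => (pstate a + pstate b)%type
  | While _ _ c => option (pstate c)
  end.

Fixpoint entry (c : cmd) : pstate c :=
  match c with
  | Act _ _ _ => tt
  | Seq a b => inl (entry a)
  | While _ _ c => None
  end.

(** [None] means that the program ends with the current action. Leaving takes no step of its own, so
    sequencing costs no time. *)
Fixpoint next_st (c : cmd) (h : nat -> sym) : pstate c -> option (pstate c) :=
  match c with
  | Act _ _ _ => fun _ => None
  | Seq a b => fun q =>
      match q with
      | inl q => if next_st h q is Some q' then Some (inl q') else Some (inr (entry b))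
      | inr q => omap inr (next_st h q)
      end
  | While j P c => fun q =>
      match q with
      | None => if P (h j) then Some (Some (entry c)) else None
      | Some q => Some (next_st h q)
      end
  end.

Fixpoint action (c : cmd) (h : nat -> sym) : pstate c -> nat -> sym * move :=
  match c with
  | Act j i f => fun _ k => if k == i then f (h j) (h i) else (h k, Stay)
  | Seq a b => fun q => match q with inl q => action h q | inr q => action h q end
  | While j P c => fun q =>
      match q with None => fun k => (h k, Stay) | Some q => action h q end
  end.

Definition heads (v : tapes) (k : nat) : sym := Defs.thead (v k).
Definition app (v : tapes) (a : nat -> sym * move) : tapes :=
  fun k => act (a k) (v k).

Lemma app_stay v : app v (fun k => (heads v k, Stay)) = v.
Proof.
by apply: functional_extensionality => k; rewrite /app /heads /=; case: (v k).
Qed.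

Inductive reach (c : cmd) : pstate c -> tapes -> nat -> tapes -> Prop :=
| reach_exit q v : next_st (heads v) q = None -> reach q v 1 (app v (action (heads v) q))
| reach_step q v q' n v' : next_st (heads v) q = Some q' ->
    reach q' (app v (action (heads v) q)) n v' -> reach q v n.+1 v'.

Definition exec (c : cmd) := reach (entry c).

Definition set_at (T : Type) (v : nat -> T) (i : nat) (t : T) : nat -> T :=
  fun k => if k == i then t else v k.

Lemma exec_act j i f v :
  exec (Act j i f) v 1 (set_at v i (act (f (heads v j) (heads v i)) (v i))).
Proof.
have := @reach_exit (Act j i f) tt v erefl.
congr (reach _ _ _ _); apply: functional_extensionality => k.
rewrite /app /set_at /=; case: eqP => [->//|_].
by rewrite -[RHS](congr1 (fun u => u k) (app_stay v)).
Qed.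

Lemma reach_seq_r a b (q : pstate b) v n v' :
  reach q v n v' -> @reach (Seq a b) (inr q) v n v'.
Proof.
elim=> {q v n v'} [q v E | q v q' n v' E _ IH].
  by apply: (@reach_exit (Seq a b) (inr q)) => /=; rewrite E.
by apply: (@reach_step (Seq a b) (inr q) v (inr q')) => //=; rewrite E.
Qed.

Lemma reach_seq_l a b (q : pstate a) v n v' m v'' :
  reach q v n v' -> exec b v' m v'' -> @reach (Seq a b) (inl q) v (n + m) v''.
Proof.
elim=> {q v n v'} [q v E | q v q' n v' E _ IH] H.
  apply: (@reach_step (Seq a b) (inl q) v (inr (entry b))); first by rewrite /= E.
  exact: reach_seq_r.
apply: (@reach_step (Seq a b) (inl q) v (inl q')); first by rewrite /= E.
exact: IH.
Qed.

Lemma exec_seq a b v n v' m v'' :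
  exec a v n v' -> exec b v' m v'' -> exec (Seq a b) v (n + m) v''.
Proof. exact: reach_seq_l. Qed.

Lemma exec_while0 j P c v : ~~ P (heads v j) -> exec (While j P c) v 1 v.
Proof.
move=> /negbTE E; have := @reach_exit (While j P c) None v.
by rewrite /= E app_stay; apply.
Qed.

Lemma reach_while j P c (q : pstate c) v n v' m v'' :
  reach q v n v' -> exec (While j P c) v' m v'' ->
  @reach (While j P c) (Some q) v (n + m) v''.
Proof.
elim=> {q v n v'} [q v E | q v q' n v' E _ IH] H.
  by apply: (@reach_step (While j P c) (Some q) v None); rewrite /= ?E.
by apply: (@reach_step (While j P c) (Some q) v (Some q')); rewrite /= ?E //; apply: IH.
Qed.

Lemma exec_whileS j (P : pred sym) c v n v' m v'' : P (heads v j) ->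
  exec c v n v' -> exec (While j P c) v' m v'' ->
  exec (While j P c) v (n + m).+1 v''.
Proof.
move=> E H1 H2.
apply: (@reach_step (While j P c) None v (Some (entry c))); first by rewrite /= E.
by rewrite /= app_stay; apply: reach_while H1 H2.
Qed.

Fixpoint below (K : nat) (c : cmd) : bool :=
  match c with
  | Act j i _ => (j < K) && (i < K)
  | Seq a b => below K a && below K b
  | While j _ c => (j < K) && below K c
  end.

Lemma below_leq K K' c : K <= K' -> below K c -> below K' c.
Proof.
move=> le; elim: c => [j i f|a IHa b IHb|j P c IH] /=.
- by case/andP=> *; apply/andP; split; apply: leq_trans le.
- by case/andP=> *; rewrite IHa ?IHb.
- by case/andP=> *; rewrite IH // andbT; apply: leq_trans le.
Qed.

Lemma belowP c : exists K, below K c.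
Proof.
elim: c => [j i f|a [Ka Ha] b [Kb Hb]|j P c [K H]].
- by exists (maxn j i).+1; rewrite /= !ltnS leq_maxl leq_maxr.
- exists (maxn Ka Kb); rewrite /= (below_leq _ Ha) ?leq_maxl //.
  by rewrite (below_leq _ Hb) ?leq_maxr.
- exists (maxn j.+1 K); rewrite /= (leq_maxl j.+1 K).
  by rewrite (below_leq _ H) ?leq_maxr.
Qed.

(** Only tapes below [K] are inspected; this is what lets a program over infinitely many tapes run
    on a machine with finitely many. *)
Lemma next_st_local K c h h' (q : pstate c) :
  below K c -> (forall k, k < K -> h k = h' k) -> next_st h q = next_st h' q.
Proof.
move=> + E; elim: c q => [j i f|a IHa b IHb|j P c IH] q //=.
- by case/andP=> Ha Hb; case: q => q; rewrite ?IHa ?IHb.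
- by case/andP=> Hj Hc; case: q => [q|]; rewrite ?IH ?E.
Qed.

Lemma action_local K c h h' (q : pstate c) k :
  below K c -> (forall k, k < K -> h k = h' k) -> k < K -> action h q k = action h' q k.
Proof.
move=> + E Hk; elim: c q => [j i f|a IHa b IHb|j P c IH] q /=.
- by case/andP=> Hj Hi; rewrite !E.
- by case/andP=> Ha Hb; case: q => q; rewrite ?IHa ?IHb.
- by case/andP=> Hj Hc; case: q => [q|]; rewrite ?IH ?E.
Qed.

(** * Compilation to the machine model *)

Section Compile.
Variables (c : cmd) (K : nat).
Hypothesis cK : below K.+1 c.

Lemma bt_inj : injective bt. Proof. by move=> a b []. Qed.
Lemma bt_blk b : bt b != blk. Proof. by []. Qed.

Definition mstate : finType := (option (pstate c) + bool)%type.
Definition hd (h : {ffun 'I_K.+1 -> sym}) (j : nat) : sym := h (inord j).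

(* Once the program has stopped, one more step reads off the verdict: the
   machine accepts iff tape 2 does not scan the mark. *)
Definition mtrans (q : mstate) (h : {ffun 'I_K.+1 -> sym}) :
  mstate * {ffun 'I_K.+1 -> sym * move} :=
  match q with
  | inl (Some q) => (inl (next_st (hd h) q), [ffun i : 'I_K.+1 => action (hd h) q i])
  | inl None => (inr (hd h 2 != mrk), [ffun i => (h i, Stay)])
  | inr b => (inr b, [ffun i => (h i, Stay)])
  end.

Definition mach : machine :=
  @Machine K mstate sym blk bt bt_inj bt_blk (inl (Some (entry c)))
    [pred q : mstate | if q is inr _ then true else false]
    [pred q : mstate | if q is inr b then b else false] mtrans.

Lemma tape_actE am t : @tape_act mach am t = act am t.
Proof. by case: am => a []. Qed.

Definition cfg (q : mstate) (tp : {ffun 'I_K.+1 -> tape sym}) : config mach :=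
  @Config mach q tp.

Definition agree (v : tapes) (tp : {ffun 'I_K.+1 -> tape sym}) :=
  forall i : 'I_K.+1, tp i = v i.

Lemma agree_hd v tp k : agree v tp -> k < K.+1 ->
  hd [ffun i => Defs.thead (tp i)] k = heads v k.
Proof. by move=> E Hk; rewrite /hd ffunE E inordK. Qed.

Lemma step_agree v tp (q : pstate c) : agree v tp ->
  exists tp', step (cfg (inl (Some q)) tp) = cfg (inl (next_st (heads v) q)) tp' /\
    agree (app v (action (heads v) q)) tp'.
Proof.
move=> E; rewrite -(next_st_local (h:=hd [ffun i => Defs.thead (tp i)]) q cK); last first.
  by move=> k; apply: agree_hd.
eexists; split; first by [].
move=> i; rewrite /= !ffunE tape_actE /app E; congr act.
by apply: action_local cK _ _ => // k; apply: agree_hd.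
Qed.

Lemma reach_mach (q : pstate c) v n v' tp : reach q v n v' -> agree v tp ->
  exists tp', agree v' tp' /\
    iter n (@step mach) (cfg (inl (Some q)) tp) = cfg (inl None) tp'.
Proof.
move=> R; elim: R tp => {q v n v'} [q v E | q v q' n v' E _ IH] tp A.
  have [tp' []] := step_agree q A; rewrite E => E1 A'.
  by exists tp'; split=> //; apply: E1.
have [tp' []] := step_agree q A; rewrite E => E1 A'.
by have [tp''] := IH _ A'; exists tp''; rewrite iterSr E1.
Qed.

Definition start_tapes (w : seq bool) : tapes :=
  fun k => if k == 0 then if map bt w is a :: s then Tape [::] a s
                          else Tape [::] blk [::]
           else Tape [::] blk [::].

(** The strict inequality [n < N] pays for the step that reads off the verdict. Agreement with the
    start is needed only on tapes that the machine has, so the other tapes of [v] can be chosen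
    freely. *)
Lemma run_mach w v n v' N :
  (forall k, k < K.+1 -> v k = start_tapes w k) -> 1 < K -> exec c v n v' ->
  n < N ->
  let fin := run mach N w in
  [/\ halt (cstate fin), accept (cstate fin) = (heads v' 2 != mrk) &
      forall k (Hk : k < K.+1), ctapes fin (Ordinal Hk) = v' k].
Proof.
move=> E K1 X nN; rewrite -(subnK nN).
set M := N - n.+1; rewrite /run iterD.
have A : agree v (ctapes (init mach w)).
  move=> i; rewrite ffunE E // /start_tapes -val_eqE /=.
have [tp' [A' R]] := reach_mach X A; rewrite iterS [iter n _ _]R {R}.
have [tp'' A'' ->] : exists2 tp'', agree v' tp'' &
    step (cfg (inl None) tp') = cfg (inr (heads v' 2 != mrk)) tp''.
  rewrite -(agree_hd (k:=2) A') //; eexists; last by [].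
  by move=> i; rewrite !ffunE A' /=; case: (v' i).
have -> : iter M (@step mach) (cfg (inr (heads v' 2 != mrk)) tp'') =
    cfg (inr (heads v' 2 != mrk)) tp'' by elim: M => //= m ->.
by split => // k Hk; rewrite /= A''.
Qed.

End Compile.

(** * Counter programs *)

(* Register [r] lives on tape [r.+2]: cell 0 carries the mark and the value
   is the distance of the head from it. *)
Definition cnt (n : nat) (t : tape sym) : Prop :=
  exists j, t = if n is n'.+1 then Tape (rcons (nseq n' blk) mrk) blk (nseq j blk)
                else Tape [::] mrk (nseq j blk).

(** Positions count from the mark, so bit [i] of [w] is scanned at position [i.+1]; [j] is the
    number of blanks recorded so far behind the input. *)
Definition itape (w : seq bool) (p : nat) (t : tape sym) : Prop :=
  exists j, let c := mrk :: map bt w ++ nseq j blk in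
    p < size c /\ t = Tape (rev (take p c)) (nth blk c p) (drop p.+1 c).

(* The output is produced from right to left. *)
Definition otape (o : seq bool) (t : tape sym) : Prop :=
  exists k, let c := rcons (map bt o) blk in
    t = Tape (nseq k blk) (head blk c) (behead c).

Definition store := nat -> nat.
Definition hstate : Type := nat * store * seq bool.

Definition rep (w : seq bool) (x : hstate) (v : tapes) : Prop :=
  let: (p, s, o) := x in
  [/\ otape o (v 0), itape w p (v 1) & forall r, cnt (s r) (v r.+2)].

(** The effect on the abstract state is deterministic, so a triple relates two states instead of two
    predicates; it includes termination within [n] steps. *)
Definition hoare (w : seq bool) (c : cmd) (x y : hstate) (n : nat) : Prop :=
  forall v, rep w x v ->
    exists v' k, [/\ exec c v k v', rep w y v' & k <= n].

Lemma hoare_le w c x y n n' : n <= n' -> hoare w c x y n -> hoare w c x y n'.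
Proof.
move=> le H v /H [v' [k [X R L]]]; exists v', k; split=> //.
exact: leq_trans L le.
Qed.

Lemma hoare_seq w a b x y z n m :
  hoare w a x y n -> hoare w b y z m -> hoare w (Seq a b) x z (n + m).
Proof.
move=> H1 H2 v /H1 [v1 [k1 [X1 R1 L1]]].
have [v2 [k2 [X2 R2 L2]]] := H2 _ R1.
by exists v2, (k1 + k2); split=> //; [apply: exec_seq X1 X2 | apply: leq_add].
Qed.

(** [S k] is the state with [k] rounds to go. Each round pays one step for its test, and the failing
    test gives the final [+ 1]. *)
Lemma hoare_while w j P c n N (S : nat -> hstate) :
  (forall k v, k <= N -> rep w (S k) v -> P (heads v j) = (0 < k)) ->
  (forall k, k < N -> hoare w c (S k.+1) (S k) n) ->
  hoare w (While j P c) (S N) (S 0) (N * n.+1 + 1).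
Proof.
elim: N => [|N IH] HP Hc v R.
  by exists v, 1; split=> //; apply: exec_while0; rewrite (HP 0 v).
have [v1 [k1 [X1 R1 L1]]] := Hc N (leqnn _) v R.
have [||v2 [k2 [X2 R2 L2]]] := IH _ _ v1 R1.
- by move=> k u Hk; apply: HP; apply: leqW.
- by move=> k Hk; apply: Hc; apply: leqW.
exists v2, (k1 + k2).+1; split=> //; last by lia.
by apply: exec_whileS X1 X2; rewrite (HP N.+1 v).
Qed.

Lemma cnt_head n t : cnt n t -> (Defs.thead t != mrk) = (0 < n).
Proof. by case: n => [|n] [j ->]. Qed.

Definition Inc r := Act r.+2 r.+2 (fun _ h => (h, MoveR)).
Definition Dec r := Act r.+2 r.+2 (fun _ h => (h, if h == mrk then Stay else MoveL)).
Definition Wh r c := While r.+2 (fun h => h != mrk) c.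

Lemma cnt_inc n t : cnt n t -> cnt n.+1 (act (Defs.thead t, MoveR) t).
Proof.
case: n => [|n] [[|j] ->] /=; first [by exists 0 | by exists j].
Qed.

Lemma cnt_dec n t : cnt n t ->
  cnt n.-1 (act (Defs.thead t, if Defs.thead t == mrk then Stay else MoveL) t).
Proof.
case: n => [|[|n]] [j ->] /=; first by exists j.
  by exists j.+1.
by exists j.+1.
Qed.

Lemma rep_reg w p s o v r n t : rep w (p, s, o) v -> cnt n t ->
  rep w (p, set_at s r n, o) (set_at v r.+2 t).
Proof.
by case=> H0 H1 H C; split=> // r'; rewrite /set_at eqSS eqSS; case: eqP.
Qed.

Lemma hoare_inc w p s o r :
  hoare w (Inc r) (p, s, o) (p, set_at s r (s r).+1, o) 1.
Proof.
move=> v R; do 2!eexists; split; [exact: exec_act| |by []].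
by apply: rep_reg (R) _; case: R => _ _ R; apply: cnt_inc.
Qed.

Lemma hoare_dec w p s o r :
  hoare w (Dec r) (p, s, o) (p, set_at s r (s r).-1, o) 1.
Proof.
move=> v R; do 2!eexists; split; [exact: exec_act| |by []].
by apply: rep_reg (R) _; case: R => _ _ R; apply: cnt_dec.
Qed.

Lemma hoare_wh w r c n N (S : nat -> hstate) :
  (forall k, k <= N -> (S k).1.2 r = k) ->
  (forall k, k < N -> hoare w c (S k.+1) (S k) n) ->
  hoare w (Wh r c) (S N) (S 0) (N * n.+1 + 1).
Proof.
move=> HS; apply: hoare_while => k v /HS; case: (S k) => [[p s] o] /= E [_ _ R].
by rewrite (cnt_head (R r)) E.
Qed.

(** ** The input tape *)

Definition InR := Act 1 1 (fun _ h => (h, MoveR)).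
Definition InL := Act 1 1 (fun _ h => (h, MoveL)).

Lemma rep_in w p s o v p' t : rep w (p, s, o) v -> itape w p' t ->
  rep w (p', s, o) (set_at v 1 t).
Proof. by case=> H0 H1 H C; split=> // r'. Qed.

Lemma hoare_inr w p s o : hoare w InR (p, s, o) (p.+1, s, o) 1.
Proof.
move=> v R; do 2!eexists; split; [exact: exec_act| |by []].
apply: rep_in (R) _; case: R => _ [j] [] + + _.
rewrite /heads; set c := (mrk :: _) => Hp ->.
have Dc : mrk :: map bt w ++ nseq j blk = c by [].
have Dc' : mrk :: map bt w ++ nseq j.+1 blk = rcons c blk.
  by rewrite /c -addn1 nseqD catA -cats1.
move: c Hp Dc Dc' => c Hp Dc Dc'; rewrite /act /=.
have E : rev (take p.+1 c) = nth blk c p :: rev (take p c).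
  by rewrite (take_nth blk) // rev_rcons.
(* When the head runs past the recorded cells, one more blank is recorded: [j] becomes [j.+1]. *)
case: (ltnP p.+1 (size c)) => Hp'.
  by exists j; lazy zeta; rewrite Dc E (drop_nth blk Hp'); split.
exists j.+1; lazy zeta; rewrite Dc' size_rcons ltnS; split=> //.
rewrite drop_oversize // -cats1 takel_cat // E nth_cat ltnNge Hp' /=.
rewrite drop_oversize ?size_cat /= ?addn1 //.
have -> : p.+1 = size c by apply/eqP; rewrite eqn_leq Hp' Hp.
by rewrite subnn.
Qed.

Lemma hoare_inl w p s o : hoare w InL (p.+1, s, o) (p, s, o) 1.
Proof.
move=> v R; do 2!eexists; split; [exact: exec_act| |by []].
apply: rep_in (R) _; case: R => _ [j] [] + + _.
rewrite /heads /=; set c := (_ ++ _) => Hp -> /=; exists j.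
split; first by rewrite -/c /=; lia.
have Hp' : p < size (mrk :: c) by rewrite /= ltnS ltnW.
have -> : rev (mrk :: take p c) = rev (take p.+1 (mrk :: c)) by [].
rewrite (take_nth blk) // rev_rcons /= -/c -drop_nth //.
Qed.

Lemma itape_mrk w p t : itape w p t -> (Defs.thead t != mrk) = (0 < p).
Proof.
case: p => [|p] [j [Hp ->]] //=; rewrite nth_cat size_map.
case: ltnP => H; first by rewrite (nth_map false).
by rewrite nth_nseq; case: ifP.
Qed.

Lemma itape_read w p t : itape w p.+1 t ->
  Defs.thead t = nth blk (map bt w) p.
Proof.
move=> [j [_ ->]] /=; rewrite nth_cat size_map; case: ltnP => H //.
by rewrite nth_nseq if_same nth_default ?size_map.
Qed.

Definition Home := While 1 (fun h => h != mrk) InL.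

Lemma hoare_home w p s o : hoare w Home (p, s, o) (0, s, o) (p * 2 + 1).
Proof.
apply: (hoare_while (S := fun p => (p, s, o))) => [k v _ [_ R _]|k _].
  by rewrite (itape_mrk R).
exact: hoare_inl.
Qed.

(* 0 stands for the positions beyond the end of the input. *)
Definition inp (w : seq bool) (p : nat) : nat :=
  if nth blk (map bt w) p is Some (Some b) then b.+1 else 0.

Definition bump (P : pred sym) r :=
  Act 1 r.+2 (fun g h => (h, if P g then MoveR else Stay)).

Lemma hoare_bump w p s o P r : hoare w (bump P r) (p.+1, s, o)
  (p.+1, set_at s r (s r + P (nth blk (map bt w) p)), o) 1.
Proof.
move=> v R; do 2!eexists; split; [exact: exec_act| |by []].
apply: rep_reg (R) _; case: R => _ /itape_read R /(_ r) C.
rewrite -[heads v 1]/(Defs.thead (v 1)) R; case: (P _); rewrite ?addn1 ?addn0; first exact: cnt_inc.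
by move: C; rewrite /act /heads; case: (v _).
Qed.

Definition isbit (h : sym) := if h is Some (Some _) then true else false.

Lemma set_at_id (T : Type) (s : nat -> T) r : set_at s r (s r) = s.
Proof. by apply: functional_extensionality => i; rewrite /set_at; case: eqP => [->|]. Qed.

Lemma set_at_set_at (T : Type) (s : nat -> T) r a b :
  set_at (set_at s r a) r b = set_at s r b.
Proof. by apply: functional_extensionality => i; rewrite /set_at; case: eqP. Qed.

Lemma set_at_same (T : Type) (s : nat -> T) r a : set_at s r a r = a.
Proof. by rewrite /set_at eqxx. Qed.

(** The register is counted down while the head walks right, and one further move skips the mark.
    The two increments together yield 0 behind the input, 1 for [false] and 2 for [true]. *)
Definition Read r :=
  Seq (Wh r (Seq (Dec r) InR))
  (Seq InR (Seq (bump isbit r) (Seq (bump (pred1 (bt true)) r) Home))).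

Lemma hoare_read w s o r :
  hoare w (Read r) (0, s, o) (0, set_at s r (inp w (s r)), o) (5 * s r + 7).
Proof.
set N := s r; pose S k : hstate := (N - k, set_at s r k, o).
have H1 : hoare w (Wh r (Seq (Dec r) InR)) (0, s, o) (N, set_at s r 0, o) (N * 3 + 1).
  have := @hoare_wh w r (Seq (Dec r) InR) 2 N S.
  rewrite /S subnn subn0 set_at_id; apply=> [k _|k Hk]; first by rewrite /= set_at_same.
  rewrite -[2]/(1 + 1).
  rewrite (_ : N - k = (N - k.+1).+1); last by lia.
  apply: (hoare_seq _ (@hoare_inr _ _ _ _)).
  by have := @hoare_dec w (N - k.+1) (set_at s r k.+1) o r; rewrite set_at_set_at set_at_same.
apply: (hoare_le (n := (N * 3 + 1) + (1 + (1 + (1 + (N.+1 * 2 + 1)))))); first lia.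
apply: hoare_seq H1 _; apply: hoare_seq (@hoare_inr _ _ _ _) _.
apply: hoare_seq (@hoare_bump _ _ _ _ _ _) _.
apply: hoare_seq (@hoare_bump _ _ _ _ _ _) _.
rewrite !set_at_set_at !set_at_same.
have -> : 0 + isbit (nth blk (map bt w) N) + pred1 (bt true) (nth blk (map bt w) N)
   = inp w N by rewrite /inp; case: (nth _ _ _) => [[[]|]|].
exact: hoare_home.
Qed.

Definition Size r :=
  Seq InR (Seq (While 1 isbit (Seq (bump isbit r) InR)) Home).

Lemma hoare_size w s o r : s r = 0 ->
  hoare w (Size r) (0, s, o) (0, set_at s r (size w), o) (5 * size w + 5).
Proof.
move=> E; set N := size w; pose S k : hstate := ((N - k).+1, set_at s r (N - k), o).
have H : hoare w (While 1 isbit (Seq (bump isbit r) InR)) (1, s, o)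
   (N.+1, set_at s r N, o) (N * 3 + 1).
  have := @hoare_while w 1 isbit (Seq (bump isbit r) InR) 2 N S.
  rewrite /S subnn subn0 -E set_at_id E; apply=> [k v Hk [_ R _]|k Hk].
    rewrite /heads (itape_read R); case: k Hk {R} => [|k] Hk.
      by rewrite subn0 nth_default ?size_map.
    by rewrite (nth_map false) //; rewrite /N in Hk *; lia.
  rewrite -[2]/(1 + 1).
  rewrite (_ : (N - k).+1 = (N - k.+1).+2); last by lia.
  apply: (hoare_seq _ (@hoare_inr _ _ _ _)).
  have := @hoare_bump w (N - k.+1) (set_at s r (N - k.+1)) o isbit r.
  rewrite set_at_set_at set_at_same (nth_map false); last by rewrite /N in Hk *; lia.
  by have -> : N - k.+1 + isbit (bt (nth false w (N - k.+1))) = N - k by rewrite /=; lia.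
apply: (hoare_le (n := 1 + ((N * 3 + 1) + (N.+1 * 2 + 1)))); first lia.
apply: hoare_seq (@hoare_inr _ _ _ _) _; apply: hoare_seq H _; exact: hoare_home.
Qed.

(** ** Initialisation and output *)

Definition Emit r :=
  Seq (Act 0 0 (fun _ h => (h, MoveL)))
      (Act r.+2 0 (fun g _ => (bt (g != mrk), Stay))).

Lemma hoare_emit w p s o r :
  hoare w (Emit r) (p, s, o) (p, s, (0 < s r) :: o) 2.
Proof.
move=> v R; do 2!eexists; split; [apply: exec_seq; exact: exec_act| |by []].
case: R => [[k E]] H1 H2; split=> //.
rewrite /set_at /heads /= (cnt_head (H2 r)) E /=.
case: k {E} => [|k] /=; [exists 0|exists k]; by case: (o).
Qed.

(** The input arrives on tape 0, which must also hold the output; it is moved to tape 1 behind a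
    mark. *)
Fixpoint Init (R : nat) : cmd :=
  match R with
  | 0 => Seq (Act 1 1 (fun _ _ => (mrk, MoveR)))
        (Seq (While 0 isbit
               (Seq (Act 0 1 (fun g _ => (g, MoveR)))
                    (Act 0 0 (fun _ _ => (blk, MoveR)))))
             Home)
  | R.+1 => Seq (Act R.+2 R.+2 (fun _ _ => (mrk, Stay))) (Init R)
  end.

(** [rep] speaks of every register, also of those whose tapes the machine does not have; these are
    taken to be marked from the beginning. *)
Definition init_tapes (R : nat) (w : seq bool) : tapes := fun k =>
  if k < R.+2 then start_tapes w k else Tape [::] mrk [::].

(** [u] is the part copied so far, and [k] counts the cells already erased on tape 0. *)
Lemma copy_loop k u w v :
  v 0 = (if map bt w is a :: s then Tape (nseq k blk) a s
         else Tape (nseq k blk) blk [::]) ->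
  v 1 = Tape (rev (mrk :: map bt u)) blk [::] ->
  exists v', let c := mrk :: map bt (u ++ w) in
  [/\ exec (While 0 isbit
       (Seq (Act 0 1 (fun g _ => (g, MoveR)))
            (Act 0 0 (fun _ _ => (blk, MoveR))))) v (3 * size w + 1) v',
    otape [::] (v' 0), v' 1 = Tape (rev c) blk [::] &
    forall r, v' r.+2 = v r.+2].
Proof.
elim: w k u v => [|a w IH] k u v E0 E1.
  exists v; rewrite cats0; split=> //.
    by apply: exec_while0; rewrite /heads E0.
  by rewrite E0; exists k.
set v1 := set_at v 1 (act (bt a, MoveR) (v 1)).
set v2 := set_at v1 0 (act (blk, MoveR) (v1 0)).
have [||v' [X O I Rg]] := IH k.+1 (rcons u a) v2.
- by rewrite /v2 set_at_same /v1 /set_at /= E0 /=; case: (w).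
- by rewrite /v2 /v1 {1}/set_at /= set_at_same E1 /= map_rcons -rcons_cons rev_rcons.
exists v'; split=> //.
- have -> : 3 * size (a :: w) + 1 = ((1 + 1) + (3 * size w + 1)).+1 by rewrite /=; lia.
  apply: exec_whileS X; first by rewrite /heads E0.
  apply: exec_seq; last exact: exec_act.
  have := @exec_act 0 1 (fun g _ => (g, MoveR)) v.
  by rewrite {1}/heads E0.
- by rewrite I cat_rcons.
Qed.

Lemma hoare_init0 w v :
  (forall k, k < 2 -> v k = start_tapes w k) ->
  (forall r, cnt 0 (v r.+2)) ->
  exists v' k, [/\ exec (Init 0) v k v', rep w (0, fun=> 0, [::]) v' &
     k <= 5 * size w + 6].
Proof.
move=> E C; set v1 := set_at v 1 (act (mrk, MoveR) (v 1)).
have [||v2 [X O I Rg]] := @copy_loop 0 [::] w v1.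
- by rewrite /v1 /set_at /= E.
- by rewrite /v1 set_at_same E.
have R2 : rep w (size (mrk :: map bt w), fun=> 0, [::]) v2.
  split=> //; last by move=> r; rewrite Rg; apply: C.
  exists 1; rewrite I /= size_cat /= addn1; split=> //.
  rewrite takel_cat // take_size nth_cat ltnn subnn /=.
  by rewrite -addn1 drop_oversize // size_cat.
have [v3 [k [X3 R3 L3]]] := hoare_home R2.
exists v3, (1 + (3 * size w + 1 + k)); split=> //.
  apply: exec_seq; first exact: exec_act.
  exact: exec_seq X X3.
by move: L3; rewrite /= size_map; lia.
Qed.

Lemma hoare_init R w : exists v' k,
  [/\ exec (Init R) (init_tapes R w) k v', rep w (0, fun=> 0, [::]) v' &
      k <= 5 * size w + 6 + R].
Proof.
elim: R => [|R [v' [k [X I L]]]].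
  have [|r|v' [k H]] := @hoare_init0 w (init_tapes 0 w).
  - by move=> k Hk; rewrite /init_tapes Hk.
  - by exists 0; rewrite /init_tapes.
  by exists v', k; rewrite addn0.
exists v', (1 + k); split=> //; last by lia.
apply: exec_seq; first exact: exec_act.
congr (exec _ _ _ _): X; apply: functional_extensionality => i.
rewrite /set_at /init_tapes; case: eqP => [->|]; first by rewrite ltnn ltnS leqnn.
by move=> ne; have -> : (i < R.+3) = (i < R.+2) by lia.
Qed.

(** * Functions computable in polynomial time *)

(** The base is at least 2, so a larger exponent absorbs constants and sums. *)
Definition pol (T : nat -> nat) := exists d, forall B, T B <= (B + 2) ^ d.

Lemma pol_le T U : (forall B, T B <= U B) -> pol U -> pol T.
Proof. by move=> le [d H]; exists d => B; apply: leq_trans (H B). Qed.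

Lemma pol_const c : pol (fun=> c).
Proof.
exists c => B; apply: leq_trans (ltnW (ltn_expl c (isT : 1 < 2))) _.
by case: c => // c; rewrite leq_exp2r //; lia.
Qed.

Lemma pol_id : pol id.
Proof. by exists 1 => B; rewrite expn1; lia. Qed.

Lemma pol_mul T U : pol T -> pol U -> pol (fun B => T B * U B).
Proof. by move=> [a Ha] [b Hb]; exists (a + b) => B; rewrite expnD leq_mul. Qed.

Lemma pol_add T U : pol T -> pol U -> pol (fun B => T B + U B).
Proof.
move=> [a Ha] [b Hb]; exists (a + b).+1 => B; rewrite expnS expnD.
have Pa : 0 < (B + 2) ^ a by rewrite expn_gt0; lia.
have Pb : 0 < (B + 2) ^ b by rewrite expn_gt0; lia.
(* For positive [x] and [y] one has [x + y <= 2 * x * y]; the additional factor [B + 2] supplies the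
   2. *)
have := Ha B; have := Hb B; move: Pa Pb.
move: (_ ^ a) (_ ^ b) => x y; nia.
Qed.

Lemma pol_exp T k : pol T -> pol (fun B => T B ^ k).
Proof. by move=> [a Ha]; exists (a * k) => B; rewrite expnM; case: k => // k; rewrite leq_exp2r. Qed.

Lemma pol_comp T U : pol T -> pol U -> pol (fun B => T (U B)).
Proof.
move=> [a Ha] HU; apply: pol_le (pol_exp a (pol_add HU (pol_const 2))) => B.
exact: Ha.
Qed.

(** De Bruijn convention: variable 0 is the innermost binder. *)
Definition push (x : nat) (e : store) : store :=
  fun i => if i is j.+1 then e j else x.

(** Clearing or moving a unary counter takes time proportional to its value, so composing running
    times requires bounds on values too. *)
Definition valbound (f : seq bool -> store -> nat) : Prop :=
  exists V, pol V /\
    forall w e B, size w <= B -> (forall i, e i <= B) -> f w e <= V B.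

(* Register [rho i] holds variable [i]; the registers from [m] on are free and
   the result is put in register [m]. *)
Definition runs (f : seq bool -> store -> nat) : Prop :=
  forall rho m, (forall i, rho i < m) -> exists c T, pol T /\
    forall w s o B, size w <= B -> (forall i, s i <= B) ->
      (forall i, m <= i -> s i = 0) ->
      hoare w c (0, s, o) (0, set_at s m (f w (fun i => s (rho i))), o) (T B).

Definition computable f := valbound f /\ runs f.

Ltac st_ext := apply: functional_extensionality => ?; rewrite /set_at;
  repeat case: eqP => ? /=; subst; try congruence; try lia.

Lemma hoare_conv w c x y n x' y' n' :
  hoare w c x y n -> x = x' -> y = y' -> n <= n' -> hoare w c x' y' n'.
Proof. by move=> H <- <- L; apply: hoare_le L H. Qed.

Definition Zero a := Wh a (Dec a).
Definition Mov a b := Wh a (Seq (Dec a) (Inc b)).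

Lemma hoare_zero w s o a : hoare w (Zero a) (0, s, o) (0, set_at s a 0, o) (2 * s a + 1).
Proof.
pose S k : hstate := (0, set_at s a k, o).
have /hoare_conv : hoare w (Zero a) (S (s a)) (S 0) (s a * 2 + 1).
  apply: hoare_wh => k Hk; first by rewrite /= set_at_same.
  apply: hoare_conv (@hoare_dec _ _ _ _ _) _ _ _ => //.
  by rewrite set_at_set_at set_at_same.
by apply; rewrite // ?/S ?set_at_id // mulnC.
Qed.

Lemma hoare_mov w s o a b : a != b -> hoare w (Mov a b) (0, s, o)
  (0, set_at (set_at s b (s b + s a)) a 0, o) (3 * s a + 1).
Proof.
move=> /eqP ab; pose S k : hstate := (0, set_at (set_at s b (s b + s a - k)) a k, o).
have /hoare_conv : hoare w (Mov a b) (S (s a)) (S 0) (s a * 3 + 1).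
  apply: hoare_wh => k Hk; first by rewrite /= set_at_same.
  rewrite -[2]/(1 + 1); apply: hoare_seq (@hoare_dec _ _ _ _ _) _.
  apply: hoare_conv (@hoare_inc _ _ _ _ _) _ _ _ => //.
  by congr (_, _, _); st_ext.
by apply; rewrite // /S; [congr (_, _, _); st_ext | rewrite subn0 | lia].
Qed.

(** Moving a unary counter destroys it; the loop therefore fills two registers, and the second one
    restores the variable. *)
Lemma computable_var i : computable (fun w e => e i).
Proof.
split; first by exists id; split=> //; apply: pol_id.
move=> rho m Hrho; pose a := rho i; have am : a < m := Hrho i.
exists (Seq (Wh a (Seq (Dec a) (Seq (Inc m) (Inc m.+1)))) (Mov m.+1 a)).
exists (fun B => (B * 4 + 1) + (3 * B + 1)); split.
  by do ![exact: pol_id | exact: pol_const | apply: pol_add | apply: pol_mul].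
move=> w s o B Hw Hs H0; have Hsa := Hs a.
have Em := H0 m (leqnn m); have Em1 := H0 m.+1 (leqnSn m).
pose S k : hstate := (0, set_at (set_at (set_at s a k) m (s a - k)) m.+1 (s a - k), o).
have H1 : hoare w (Wh a (Seq (Dec a) (Seq (Inc m) (Inc m.+1)))) (S (s a)) (S 0) (s a * 4 + 1).
  apply: hoare_wh => k Hk; first by rewrite /= /set_at; do ?case: eqP => ? //; lia.
  rewrite -[3]/(1 + (1 + 1)); apply: hoare_seq (@hoare_dec _ _ _ _ _) _.
  apply: hoare_seq (@hoare_inc _ _ _ _ _) _.
  apply: hoare_conv (@hoare_inc _ _ _ _ _) _ _ _ => //.
  by congr (_, _, _); st_ext.
apply: (@hoare_le _ _ _ _ ((s a * 4 + 1) + (3 * s a + 1))); first by lia.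
apply: (@hoare_seq _ _ _ _ (S 0)).
  by apply: hoare_conv H1 _ _ _; rewrite // /S; congr (_, _, _); st_ext.
apply: hoare_conv (@hoare_mov _ _ _ _ _ _) _ _ _; rewrite // ?/S; first by apply/eqP; lia.
  by congr (_, _, _); rewrite /a; st_ext.
by rewrite /set_at eqxx subn0.
Qed.

Lemma computable_zero : computable (fun _ _ => 0).
Proof.
split; first by exists (fun=> 0); split=> //; apply: pol_const.
move=> rho m _; exists (Zero m), (fun=> 1); split; first exact: pol_const.
move=> w s o B _ _ H0; apply: hoare_conv (@hoare_zero _ _ _ _) _ _ _ => //.
by rewrite H0.
Qed.

Lemma computable_size : computable (fun w _ => size w).
Proof.
split; first by exists id; split=> //; apply: pol_id.
move=> rho m _; exists (Size m), (fun B => 5 * B + 5); split.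
  by do ![exact: pol_id | exact: pol_const | apply: pol_add | apply: pol_mul].
move=> w s o B Hw _ H0; apply: hoare_conv (@hoare_size w s o m (H0 m (leqnn m))) _ _ _ => //; lia.
Qed.

Lemma computable_post (g : seq bool -> nat -> nat) (P : nat -> cmd) f :
  (exists c, forall w n, g w n <= n + c) ->
  (exists c d, forall w s o r, hoare w (P r) (0, s, o)
     (0, set_at s r (g w (s r)), o) (c * s r + d)) ->
  computable f -> computable (fun w e => g w (f w e)).
Proof.
move=> [c Hc] [a [d HP]] [[V [pV HV]] Hf]; split.
  exists (fun B => V B + c); split; first exact: pol_add pV (pol_const c).
  by move=> w e B Hw He; apply: leq_trans (Hc w _) _; rewrite leq_add2r HV.
move=> rho m Hrho; have [p [T [pT Hp]]] := Hf _ _ Hrho.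
exists (Seq p (P m)), (fun B => T B + (a * V B + d)); split.
  by do ![exact: pol_const | apply: pol_add | apply: pol_mul].
move=> w s o B Hw Hs H0; apply: hoare_seq (Hp _ _ _ _ Hw Hs H0) _.
apply: hoare_conv (HP _ _ _ _) _ _ _ => //; first by rewrite set_at_set_at set_at_same.
by rewrite set_at_same leq_add2r leq_mul2l HV ?orbT.
Qed.

Lemma computable_succ f : computable f -> computable (fun w e => (f w e).+1).
Proof.
apply: (@computable_post (fun _ n => n.+1) Inc).
  by exists 1 => _ n; rewrite addn1.
by exists 0, 1 => w s o r; apply: hoare_inc.
Qed.

Lemma computable_pred f : computable f -> computable (fun w e => (f w e).-1).
Proof.
apply: (@computable_post (fun _ n => n.-1) Dec); first by exists 0 => _ n; lia.
by exists 0, 1 => w s o r; apply: hoare_dec.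
Qed.

Lemma computable_inp f : computable f -> computable (fun w e => inp w (f w e)).
Proof.
apply: (@computable_post inp Read); last first.
  by exists 5, 7 => w s o r; apply: hoare_read.
by exists 2 => w n; rewrite /inp; case: nth => [[[]|]|]; lia.
Qed.

Lemma push_reg s m rho x : (forall i, rho i < m) ->
  (fun i => set_at s m x (push m rho i)) = push x (fun i => s (rho i)).
Proof.
move=> H; apply: functional_extensionality => -[|i]; rewrite /set_at /= ?eqxx //.
by have := H i; case: eqP => // ->; rewrite ltnn.
Qed.

(** The value of [f] stays in register [m] while [g] runs with the placement [push m rho]; its
    result is then moved down from [m.+1]. *)
Lemma computable_let f g : computable f -> computable g ->
  computable (fun w e => g w (push (f w e) e)).
Proof.
move=> [[V [pV HV]] Hf] [[U [pU HU]] Hg].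
have bnd w e B : size w <= B -> (forall i, e i <= B) ->
    forall i, push (f w e) e i <= B + V B.
  move=> Hw He [|i] /=; first by have := HV w e B Hw He; lia.
  by have := He i; lia.
have pBV : pol (fun B => B + V B) by apply: pol_add pV; apply: pol_id.
split.
  exists (fun B => U (B + V B)); split; first exact: (pol_comp pU pBV).
  move=> w e B Hw He; apply: HU; [lia | exact: bnd].
move=> rho m Hrho; have [c [T [pT Hc]]] := Hf _ _ Hrho.
have [|c' [T' [pT' Hc']]] := Hg (push m rho) m.+1.
  by case=> [|i] //=; apply: leqW.
exists (Seq c (Seq c' (Seq (Zero m) (Mov m.+1 m)))).
exists (fun B => T B + (T' (B + V B) + ((2 * V B + 1) + (3 * U (B + V B) + 1)))).
split.
  do ![exact: pol_const | apply: pol_add | apply: pol_mul | assumption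
      | exact: (pol_comp pT' pBV) | exact: (pol_comp pU pBV)].
move=> w s o B Hw Hs H0; set e := fun i => s (rho i).
have He i : e i <= B by apply: Hs.
have HF := HV w e B Hw He; set F := f w e in HF *.
have HG : g w (push F e) <= U (B + V B) by apply: HU; [lia | exact: bnd].
set G := g w _ in HG *.
apply: hoare_seq (Hc _ _ _ _ Hw Hs H0) _; rewrite -/e -/F.
apply: hoare_seq.
  apply: (Hc' _ _ _ (B + V B)); first by lia.
    by move=> i; rewrite /set_at; case: eqP => _; [lia | have := Hs i; lia].
  by move=> i Hi; rewrite /set_at; case: eqP => [|_]; [lia | apply: H0; lia].
rewrite push_reg // -/e -/G.
have Em1 : s m.+1 = 0 by apply: H0.
apply: (@hoare_le _ _ _ _ ((2 * F + 1) + (3 * G + 1))); first by lia.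
apply: hoare_seq.
  apply: hoare_conv (@hoare_zero _ _ _ _) _ _ _; try by [].
  by rewrite /set_at eqxx; case: eqP; lia.
apply: hoare_conv (@hoare_mov _ _ _ _ _ _) _ _ _; rewrite //; first by apply/eqP; lia.
  by congr (_, _, _); st_ext.
by rewrite /set_at eqxx; case: eqP; lia.
Qed.

Section Iteration.
Variables (n z g : seq bool -> store -> nat).

Definition iter_val w e k := iteri k (fun i y => g w (push y (push i e))) (z w e).

(** Register [m] counts down, [m.+1] holds the number of the round and [m.+2] the current value. The
    bound on intermediate values is an assumption of its own because iterating a polynomially
    bounded [g] can produce exponential values. *)
Lemma computable_iter : computable n -> computable z -> computable g ->
  (exists V, pol V /\ forall w e B k, size w <= B -> (forall i, e i <= B) ->
     k <= n w e -> iter_val w e k <= V B) ->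
  computable (fun w e => iteri (n w e) (fun i y => g w (push y (push i e))) (z w e)).
Proof.
move=> [[N [pN HN]] Hn] [_ Hz] [_ Hg] [V [pV HV]]; split.
  by exists V; split=> // w e B Hw He; apply: HV.
move=> rho m Hrho; have [cn [Tn [pTn Hcn]]] := Hn _ _ Hrho.
have [|cz [Tz [pTz Hcz]]] := Hz rho m.+2; first by move=> i; have := Hrho i; lia.
have [|cg [Tg [pTg Hcg]]] := Hg (push m.+2 (push m.+1 rho)) m.+3.
  by case=> [|[|i]] /=; try lia; have := Hrho i; lia.
pose body := Seq (Dec m) (Seq cg (Seq (Zero m.+2) (Seq (Mov m.+3 m.+2) (Inc m.+1)))).
pose U B := B + (N B + V B).
have pU : pol U by apply: pol_add; [exact: pol_id | exact: pol_add].
pose tb B := 1 + (Tg (U B) + ((2 * V B + 1) + ((3 * V B + 1) + 1))).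
exists (Seq cn (Seq cz (Seq (Wh m body) (Seq (Zero m.+1) (Mov m.+2 m))))).
exists (fun B => Tn B + (Tz (U B) + ((N B * (tb B).+1 + 1) + ((2 * N B + 1) + (3 * V B + 1))))).
have ptb : pol (fun B => (tb B).+1).
  apply: (pol_le (U := fun B => 1 + tb B)); first by move=> B; lia.
  do ![exact: pol_const | apply: pol_add | apply: pol_mul | assumption
      | exact: (pol_comp pTg pU)].
split.
  do ![exact: pol_const | apply: pol_add | apply: pol_mul | assumption
      | exact: (pol_comp pTz pU)].
move=> w s o B Hw Hs H0; set e := fun i => s (rho i).
have He i : e i <= B by apply: Hs.
have HNe := HN w e B Hw He; have {}HV := HV w e B _ Hw He.
set k := n w e in HNe HV *.
pose Y := iter_val w e.
have E0 i : m <= i -> s i = 0 by apply: H0.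
have Em := E0 m (leqnn m).
have Em1 : s m.+1 = 0 by apply: E0; lia.
have Em2 : s m.+2 = 0 by apply: E0; lia.
have Em3 : s m.+3 = 0 by apply: E0; lia.
apply: hoare_seq (Hcn _ _ _ _ Hw Hs H0) _; rewrite -/e -/k.
have Ee x : (fun i => set_at s m x (rho i)) = e.
  apply: functional_extensionality => i; rewrite /set_at.
  by have := Hrho i; case: eqP => // ->; lia.
apply: hoare_seq.
  apply: (Hcz _ _ _ (U B)); first by rewrite /U; lia.
    by move=> i; rewrite /set_at /U; case: eqP => _; [lia | have := Hs i; lia].
  by move=> i Hi; rewrite /set_at; case: eqP => [|_]; [lia | apply: H0; lia].
rewrite Ee.
pose S0 j : store := set_at (set_at (set_at s m j) m.+1 (k - j)) m.+2 (Y (k - j)).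
pose S j : hstate := (0, S0 j, o).
have HY0 : V B >= Y k by apply: HV.
apply: (@hoare_le _ _ _ _ ((k * (tb B).+1 + 1) + ((2 * k + 1) + (3 * Y k + 1)))).
  by have := leq_mul2r (tb B).+1 k (N B); rewrite HNe orbT; lia.
apply: (@hoare_seq _ _ _ _ (S 0)); last first.
  apply: hoare_seq.
    apply: hoare_conv (@hoare_zero _ _ _ _) _ _ _; try by [].
    by rewrite /S0 /set_at subn0 eqxx; case: eqP; lia.
  apply: hoare_conv (@hoare_mov _ _ _ _ _ _) _ _ _; rewrite //; first by apply/eqP; lia.
    by congr (_, _, _); rewrite /S0 subn0; st_ext.
  by rewrite /S0 /set_at subn0 eqxx; case: eqP; lia.
have /hoare_conv : hoare w (Wh m body) (S k) (S 0) (k * (tb B).+1 + 1); last first.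
  by apply; rewrite // /S /S0 subnn; congr (_, _, _); st_ext.
apply: hoare_wh => j Hj; first by rewrite /= /S0 /set_at eqxx; do ?case: eqP => ? //; lia.
have [HYj HYj1] : Y (k - j.+1) <= V B /\ Y (k - j) <= V B by split; apply: HV; lia.
have EY : Y (k - j) = g w (push (Y (k - j.+1)) (push (k - j.+1) e)).
  by rewrite /Y (_ : k - j = (k - j.+1).+1) //; lia.
apply: hoare_seq (@hoare_dec _ _ _ _ _) _; set s1 := set_at _ _ _.
have Es1 : s1 = set_at (set_at (set_at s m j) m.+1 (k - j.+1)) m.+2 (Y (k - j.+1)).
  by rewrite /s1 /S0; st_ext.
apply: hoare_seq.
  apply: (Hcg _ _ _ (U B)); first by rewrite /U; lia.
    move=> i; rewrite Es1 /set_at /U; have := Hs i.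
    by repeat case: eqP => _; lia.
  move=> i Hi; rewrite Es1 /set_at.
  by repeat (case: eqP => [|_]; first by lia); apply: H0; lia.
have -> : (fun i => s1 (push m.+2 (push m.+1 rho) i)) =
    push (Y (k - j.+1)) (push (k - j.+1) e).
  rewrite Es1; apply: functional_extensionality => -[|[|i]]; rewrite /set_at /= ?eqxx //.
    by case: eqP => ? //; lia.
  by have := Hrho i; repeat (case: eqP => [|_]; first by lia).
rewrite -EY.
apply: hoare_seq.
  apply: hoare_conv (@hoare_zero _ _ _ _) _ _ _; try by [].
  by rewrite Es1 /set_at eqxx; case: eqP => [|_]; lia.
apply: hoare_seq.
  apply: hoare_conv (@hoare_mov _ _ _ _ _ _) _ _ _; try by []; first by apply/eqP; lia.
  by rewrite Es1 /set_at eqxx; case: eqP => [|_]; lia.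
apply: hoare_conv (@hoare_inc _ _ _ _ _) _ _ _ => //.
by congr (_, _, _); rewrite Es1 /S0; st_ext.
Qed.

End Iteration.

(** The placement [rho] is arbitrary, and several variables may share a register, so a renaming is
    absorbed into it. *)
Lemma computable_ren (r : nat -> nat) f : computable f ->
  computable (fun w e => f w (fun i => e (r i))).
Proof.
move=> [[V [pV HV]] Hf]; split.
  by exists V; split=> // w e B Hw He; apply: HV.
by move=> rho m Hrho; apply: (Hf (fun i => rho (r i))).
Qed.

(** For [n > 0] one has [n + 2 <= 3 * n]; for [n = 0] the summand [3 ^ d] is enough. *)
Lemma pol_poly_bound T : pol T -> exists c d, forall n, T n <= poly_bound c d n.
Proof.
move=> [d H]; exists (3 ^ d), d => n; apply: leq_trans (H n) _.
rewrite /poly_bound -expnMn; case: n => [|n].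
  by rewrite (leq_trans _ (leq_addl _ _)) //; case: d {H} => // d; rewrite leq_exp2r.
rewrite (leq_trans _ (leq_addr _ _)) //.
by case: d {H} => // d; rewrite leq_exp2r //; lia.
Qed.

Lemma below_init R : below R.+2 (Init R).
Proof.
suff H R' : R' <= R -> below R.+2 (Init R') by exact: H.
by elim: R' => [|R' IH] H //=; rewrite !ltnS H IH // ltnW.
Qed.

Definition env0 : store := fun=> 0.

Lemma run_program (c : cmd) (s' : seq bool -> store) (o' : seq bool -> seq bool) T :
  pol T ->
  (forall w, hoare w c (0, fun=> 0, [::]) (0, s' w, o' w) (T (size w))) ->
  exists (M : machine) (k d : nat), forall w,
    let fin := run M (poly_bound k d (size w)) w in
    [/\ halt (cstate fin), accept (cstate fin) = (0 < s' w 0) &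
        has_output fin (o' w)].
Proof.
move=> pT Hc; have [R R0 HR] : exists2 R, 0 < R & below R c.
  by have [K /(below_leq (leqnSn K)) HK] := belowP c; exists K.+1.
pose prog := Seq (Init R) c.
have Hb : below R.+2 prog by rewrite /= below_init (below_leq _ HR) //; lia.
have [k [d Hkd]] : exists k d, forall n, (5 * n + 6 + R) + T n + 1 <= poly_bound k d n.
  apply: pol_poly_bound.
  by do ![exact: pol_id | exact: pol_const | apply: pol_add | apply: pol_mul | assumption].
exists (mach prog R.+1), k, d => w.
have [v1 [n1 [X1 R1 L1]]] := hoare_init R w.
have [v2 [n2 [X2 R2 L2]]] := Hc w v1 R1.
have [||||Hh Ha Ht] := @run_mach prog R.+1 Hb w (init_tapes R w) (n1 + n2) v2
  (poly_bound k d (size w)).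
- by move=> i Hi; rewrite /init_tapes Hi.
- by [].
- exact: exec_seq X1 X2.
- by have := Hkd (size w); lia.
case: R2 => [[j Eo] _ Hreg]; split=> //; first by rewrite Ha (cnt_head (Hreg 0)).
rewrite /has_output (_ : ord0 = Ordinal (isT : 0 < R.+2)); last exact: val_inj.
(* The tape records one blank after the output and [has_output] appends another, which makes two,
   that is [m.+1] with [m = 1]. *)
rewrite Ht Eo; exists 1; case: (o' w) => //= b o.
by rewrite -!cats1 -catA.
Qed.

Lemma in_P_computable g : computable g -> in_P (fun w => 0 < g w env0).
Proof.
(* All variables are placed in register 0, which holds 0. The result appears in register 1 and is
   moved to register 0, where acceptance is read off. *)
move=> [[V [pV HV]] Hg]; have [//|c [T [pT Hc]]] := Hg (fun=> 0) 1.
have [||M [k [d H]]] := @run_program (Seq c (Mov 1 0))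
  (fun w => set_at (set_at (fun=> 0) 1 0) 0 (g w env0)) (fun=> [::])
  (fun n => T n + (3 * V n + 1)).
- by do ![exact: pol_const | apply: pol_add | apply: pol_mul | assumption].
- move=> w; apply: hoare_seq; first by apply: (Hc _ _ _ (size w)).
  have HVw : g w env0 <= V (size w) by apply: HV.
  apply: hoare_conv (@hoare_mov _ _ _ _ _ _) _ _ _; rewrite //.
    by congr (_, _, _); rewrite /env0; st_ext.
  by rewrite set_at_same /= -/env0; lia.
exists M, k, d => w; have [H1 H2 _] := H w; split=> //.
by rewrite H2 set_at_same.
Qed.

(** Register 1 counts down from the length, so the bits come out from last to first, as the output
    tape requires; it doubles as variable 0 of [g]. *)
Lemma polytime_computable (l g : seq bool -> store -> nat) :
  computable l -> computable g ->
  polytime_function (fun w => mkseq (fun i => 0 < g w (push i env0)) (l w env0)).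
Proof.
move=> [[V [pV HV]] Hl] [[U [pU HU]] Hg].
have [//|c [T [pT Hc]]] := Hl (fun=> 0) 1.
have [|c' [T' [pT' Hc']]] := Hg (push 1 (fun=> 0)) 2; first by case.
pose body := Seq (Dec 1) (Seq c' (Seq (Emit 2) (Zero 2))).
pose W n := n + V n.
have pW : pol W by apply: pol_add pV; apply: pol_id.
pose t n := 1 + (T' (W n) + (2 + (2 * U (W n) + 1))).
have [||M [k [d H]]] := @run_program (Seq c (Wh 1 body)) (fun w => fun=> 0)
  (fun w => mkseq (fun i => 0 < g w (push i env0)) (l w env0))
  (fun n => T n + (V n * (t n).+1 + 1)).
- apply: (pol_le (U := fun n => T n + (V n * (1 + t n) + 1))) => //.
  do ![exact: pol_const | apply: pol_add | apply: pol_mul | assumption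
      | exact: (pol_comp pT' pW) | exact: (pol_comp pU pW)].
- move=> w; apply: hoare_seq; first by apply: (Hc _ _ _ (size w)).
  have HL : l w env0 <= V (size w) by apply: HV.
  rewrite -/env0; set L := l w env0 in HL *; set f := fun i => _.
  pose S j : hstate := (0, set_at env0 1 j, map f (iota j (L - j))).
  have /hoare_conv : hoare w (Wh 1 body) (S L) (S 0) (L * (t (size w)).+1 + 1); last first.
    apply; rewrite /S ?subnn ?subn0 //.
      by congr (_, _, _); rewrite /env0; st_ext.
    by rewrite leq_add2r leq_mul2r HL orbT.
  apply: hoare_wh => j Hj; first by rewrite /= set_at_same.
  apply: hoare_seq (@hoare_dec _ _ _ _ _) _.
  rewrite set_at_set_at set_at_same /=.
  have E : (fun i => set_at env0 1 j (push 1 (fun=> 0) i)) = push j env0.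
    by apply: functional_extensionality => -[|i].
  have HW : forall i, push j env0 i <= W (size w) by case=> [|i]; rewrite /W /= /env0; lia.
  have HUj : g w (push j env0) <= U (W (size w)) by apply: HU => //; rewrite /W; lia.
  apply: hoare_seq.
    apply: (Hc' _ _ _ (W (size w))); first by rewrite /W; lia.
      by move=> i; rewrite /set_at /W /env0; case: eqP; lia.
    by move=> i; rewrite /set_at /env0; case: eqP => // ->.
  rewrite E; apply: hoare_seq (@hoare_emit _ _ _ _ _) _.
  apply: hoare_conv (@hoare_zero _ _ _ _) _ _ _; try by [].
    congr (_, _, _); first by rewrite /env0; st_ext.
    by rewrite set_at_same (_ : L - j = (L - j.+1).+1) //=; lia.
  by rewrite set_at_same; lia.
exists M, k, d => w; have [H1 _ H3] := H w; split=> //.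
Qed.

(** ** Closure properties *)

Lemma computable_ext f g : (forall w e, f w e = g w e) -> computable f -> computable g.
Proof.
move=> E; have -> // : f = g.
by do 2!(apply: functional_extensionality => ?).
Qed.

Lemma foldr_push l e : (fun i => foldr push e l (size l + i)) = e.
Proof. by elim: l => [|x l IH] //=; apply: IH. Qed.

Fixpoint computables (gs : seq (seq bool -> store -> nat)) : Prop :=
  if gs is g :: gs' then computable g /\ computables gs' else True.

Lemma computable_sub gs f : computable f -> computables gs ->
  computable (fun w e => f w (foldr push e [seq g w e | g <- gs])).
Proof.
elim: gs f => [|g gs IH] f Hf //= [Hg Hgs].
(* The values in [gs] already occupy the first [size gs] variables; [g] has to look past them to see
   the original environment. *)
pose f2 w E := f w (push (g w (fun i => E (size gs + i))) E).
have Hf2 : computable f2.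
  have Hg' := computable_ren (fun i => size gs + i) Hg.
  exact: (computable_let Hg' Hf).
apply: computable_ext (IH _ Hf2 Hgs) => w e; rewrite /f2.
by have := foldr_push [seq g w e | g <- gs] e; rewrite size_map => ->.
Qed.

Lemma computable1 (Q : seq bool -> nat -> nat) f :
  computable (fun w e => Q w (e 0)) -> computable f ->
  computable (fun w e => Q w (f w e)).
Proof. by move=> HQ Hf; apply: (@computable_sub [:: f] _ HQ). Qed.

Lemma computable2 (Q : seq bool -> nat -> nat -> nat) f g :
  computable (fun w e => Q w (e 0) (e 1)) -> computable f -> computable g ->
  computable (fun w e => Q w (f w e) (g w e)).
Proof. by move=> HQ Hf Hg; apply: (@computable_sub [:: f; g] _ HQ). Qed.

Lemma computable_const n : computable (fun _ _ => n).
Proof.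
by elim: n => [|n IH]; [exact: computable_zero | exact: computable_succ].
Qed.

Lemma computable_add f g : computable f -> computable g ->
  computable (fun w e => f w e + g w e).
Proof.
apply: (@computable2 (fun _ => addn)).
pose z (_ : seq bool) (e : store) := e 1; pose g' (_ : seq bool) (e : store) := (e 0).+1.
have E w e k : iter_val z g' w e k = k + e 1.
  by elim: k => //= k; rewrite /iter_val /= => ->.
apply: computable_ext (@computable_iter (fun _ e => e 0) z g' _ _ _ _).
- by move=> w e; apply: E.
- exact: computable_var.
- exact: computable_var.
- exact/computable_succ/computable_var.
exists (fun B => B + B); split; first by apply: pol_add; apply: pol_id.
by move=> w e B k Hw He Hk; rewrite E; have := He 0; have := He 1; lia.
Qed.

Lemma computable_mul f g : computable f -> computable g ->
  computable (fun w e => f w e * g w e).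
Proof.
apply: (@computable2 (fun _ => muln)).
pose z (_ : seq bool) (_ : store) := 0; pose g' (_ : seq bool) (e : store) := e 0 + e 3.
have E w e k : iter_val z g' w e k = k * e 1.
  by elim: k => //= k; rewrite /iter_val /= => ->; rewrite /g' /= mulSn addnC.
apply: computable_ext (@computable_iter (fun _ e => e 0) z g' _ _ _ _).
- by move=> w e; apply: E.
- exact: computable_var.
- exact: computable_const.
- by apply: computable_add; apply: computable_var.
exists (fun B => B * B); split; first by apply: pol_mul; apply: pol_id.
by move=> w e B k Hw He Hk; rewrite E leq_mul ?(leq_trans Hk).
Qed.

Lemma computable_subn f g : computable f -> computable g ->
  computable (fun w e => f w e - g w e).
Proof.
apply: (@computable2 (fun _ => subn)).
pose z (_ : seq bool) (e : store) := e 0; pose g' (_ : seq bool) (e : store) := (e 0).-1.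
have E w e k : iter_val z g' w e k = e 0 - k.
  by elim: k => [|k]; rewrite ?subn0 // /iter_val /= => ->; rewrite /g' /= subnS.
apply: computable_ext (@computable_iter (fun _ e => e 1) z g' _ _ _ _).
- by move=> w e; apply: E.
- exact: computable_var.
- exact: computable_var.
- exact/computable_pred/computable_var.
exists id; split; first exact: pol_id.
by move=> w e B k Hw He Hk; rewrite E; have := He 0; lia.
Qed.

Section Bool.
Variables P Q : seq bool -> store -> bool.
Hypothesis cP : computable (fun w e => P w e : nat).
Hypothesis cQ : computable (fun w e => Q w e : nat).

Lemma computable_neg : computable (fun w e => ~~ P w e : nat).
Proof.
apply: computable_ext (computable_subn (computable_const 1) cP) => w e /=.
by case: (P w e).
Qed.

Lemma computable_and : computable (fun w e => P w e && Q w e : nat).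
Proof.
by apply: computable_ext (computable_mul cP cQ) => w e /=; case: (P w e); case: (Q w e).
Qed.

Lemma computable_if f g : computable f -> computable g ->
  computable (fun w e => if P w e then f w e else g w e).
Proof.
move=> Hf Hg; apply: computable_ext (computable_add (computable_mul cP Hf)
  (computable_mul computable_neg Hg)) => w e.
by case: (P w e); rewrite /=; lia.
Qed.

End Bool.

Section BoolDerived.
Variables P Q : seq bool -> store -> bool.
Hypothesis cP : computable (fun w e => P w e : nat).
Hypothesis cQ : computable (fun w e => Q w e : nat).

Lemma computable_or : computable (fun w e => P w e || Q w e : nat).
Proof.
apply: computable_ext (computable_neg (computable_and (computable_neg cP) (computable_neg cQ))).
by move=> w e /=; case: (P w e); case: (Q w e).
Qed.

End BoolDerived.

Lemma computable_imp (P Q : seq bool -> store -> bool) :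
  computable (fun w e => P w e : nat) -> computable (fun w e => Q w e : nat) ->
  computable (fun w e => P w e ==> Q w e : nat).
Proof.
move=> /computable_neg cP cQ; apply: computable_ext (computable_or cP cQ).
by move=> w e /=; case: (P w e); case: (Q w e).
Qed.

Lemma computable_leq f g : computable f -> computable g ->
  computable (fun w e => f w e <= g w e : nat).
Proof.
move=> Hf Hg; apply: computable_ext (computable_subn (computable_const 1) (computable_subn Hf Hg)).
by move=> w e; rewrite /= /leq; case: (f w e - g w e).
Qed.

Lemma computable_eq f g : computable f -> computable g ->
  computable (fun w e => f w e == g w e : nat).
Proof.
move=> Hf Hg; apply: computable_ext (computable_and (computable_leq Hf Hg) (computable_leq Hg Hf)).
by move=> w e; rewrite eqn_leq.
Qed.

(* The ranges are plain numbers rather than ordinals so that the tactic [comp1]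
   below can match on them. *)
Definition csum (n : nat) (F : nat -> nat) := \sum_(i < n) F i.
Definition call (n : nat) (P : nat -> bool) := all P (iota 0 n).
Definition cfind (n : nat) (P : nat -> bool) := find P (iota 0 n).

Lemma computable_csum n (F : seq bool -> store -> nat -> nat) : computable n ->
  computable (fun w e => F w (fun i => e i.+1) (e 0)) ->
  computable (fun w e => csum (n w e) (F w e)).
Proof.
move=> Hn HF; pose g w e := e 0 + F w (fun i => e i.+2) (e 1).
have E w e k : iter_val (fun _ _ => 0) g w e k = csum k (F w e).
  elim: k => [|k]; first by rewrite /csum big_ord0.
  by rewrite /iter_val /csum /= => ->; rewrite big_ord_recr.
apply: computable_ext (@computable_iter n (fun _ _ => 0) g Hn _ _ _).
- by move=> w e; apply: E.
- exact: computable_const.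
- apply: computable_add (computable_var 0) _.
  exact: (computable_ren (fun i => i.+1) HF).
have [[N [pN HN]] _] := Hn; have [[V [pV HV]] _] := HF.
exists (fun B => N B * V (B + N B)); split.
  by apply: pol_mul => //; apply: pol_comp pV _; apply: pol_add pN; apply: pol_id.
move=> w e B k Hw He Hk; rewrite E /csum.
apply: (@leq_trans (\sum_(i < k) V (B + N B))).
  apply: leq_sum => i _; apply: (HV w (push i e)); first by lia.
  case=> [|j] /=; last by have := He j; lia.
  by have := HN w e B Hw He; have := ltn_ord i; lia.
by rewrite sum_nat_const card_ord leq_mul2r (leq_trans Hk) ?orbT ?HN.
Qed.

Lemma callP n (P : nat -> bool) : reflect (forall i, i < n -> P i) (call n P).
Proof.
apply: (iffP allP) => H i; first by move=> Hi; apply: H; rewrite mem_iota.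
by rewrite mem_iota => /H.
Qed.

Lemma computable_call n (P : seq bool -> store -> nat -> bool) : computable n ->
  computable (fun w e => P w (fun i => e i.+1) (e 0) : nat) ->
  computable (fun w e => call (n w e) (P w e) : nat).
Proof.
move=> Hn /computable_neg HP.
apply: computable_ext (computable_eq (computable_csum
   (F := fun w e i => ~~ P w e i : nat) Hn HP) (computable_const 0)) => w e.
congr nat_of_bool; apply/eqP/callP => [|H]; rewrite /csum.
  move=> /eqP; rewrite sum_nat_eq0 => /forallP H i Hi.
  by have := H (Ordinal Hi) => /=; case: (P w e i).
by rewrite big1 // => i _; rewrite H.
Qed.

(** The first hit is found at the number of indices up to which, inclusively, there is no hit. This
    reduces searching to summation. *)
Lemma cfind_sum n P : cfind n P = csum n (fun i => call i.+1 (fun j => ~~ P j)).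
Proof.
rewrite /cfind /csum; elim: n => [|n IH]; first by rewrite big_ord0.
have -> : iota 0 n.+1 = iota 0 n ++ [:: n] by rewrite -addn1 iotaD.
rewrite big_ord_recr -IH /= find_cat size_iota /= -[find _ _]/(cfind n P).
rewrite has_find size_iota /cfind; case: ltnP => H.
  case: callP => [/(_ _ (leqW H))|_]; last by rewrite addn0.
  have := H; rewrite -{2}(size_iota 0 n) -has_find => /(nth_find 0).
  by rewrite nth_iota // add0n => ->.
have Hn : ~~ has P (iota 0 n) by rewrite has_find size_iota -leqNgt.
have -> : find P (iota 0 n) = n by rewrite hasNfind ?size_iota.
congr (_ + _); case E: (P n).
  by case: callP => // /(_ n (leqnn _)); rewrite E.
case: callP => // -[] i; rewrite ltnS leq_eqVlt => /orP[/eqP->|Hi]; first by rewrite E.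
by apply: contra Hn => Pi; apply/hasP; exists i; rewrite ?mem_iota.
Qed.

Lemma computable_cfind n (P : seq bool -> store -> nat -> bool) : computable n ->
  computable (fun w e => P w (fun i => e i.+1) (e 0) : nat) ->
  computable (fun w e => cfind (n w e) (P w e)).
Proof.
move=> Hn HP; pose F w (e : store) (i : nat) := call i.+1 (fun j => ~~ P w e j) : nat.
apply: computable_ext (computable_csum (F := F) Hn _) => [w e|].
  by rewrite cfind_sum.
apply: (computable_call (n := fun w e => (e 0).+1) (P := fun w e j => ~~ P w (fun i => e i.+1) j)).
  exact/computable_succ/computable_var.
apply: computable_neg.
by apply: (computable_ren (fun i => if i is i'.+1 then i'.+2 else 0) HP).
Qed.

(** The quotient counts the positive multiples of the divisor that do not exceed the dividend; the
    factor [1 <= e 1] yields 0 for division by 0. *)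
Lemma computable_div f g : computable f -> computable g ->
  computable (fun w e => f w e %/ g w e).
Proof.
apply: (@computable2 (fun _ => divn)).
apply: computable_ext (computable_mul (computable_leq (computable_const 1) (computable_var 1))
  (computable_csum (n := fun w e => e 0) (F := fun w e i => i.+1 * e 1 <= e 0 : nat)
    (computable_var 0) _)); last first.
  apply: computable_leq (computable_var 1).
  by apply: computable_mul (computable_var 2); apply/computable_succ/computable_var.
move=> _ e; move: (e 0) (e 1) => m [|d]; first by rewrite divn0.
rewrite mul1n /csum; have : m %/ d.+1 <= m by apply: leq_div.
rewrite (eq_bigr (fun i : 'I_m => (i < m %/ d.+1) : nat)); last first.
  by move=> i _; rewrite leq_divRL.
move: (m %/ _) => q Hq; rewrite -{2}(minn_idPl Hq) {Hq}.
elim: m => [|m IH]; first by rewrite big_ord0 minn0.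
by rewrite big_ord_recr IH /=; lia.
Qed.

Lemma computable_mod f g : computable f -> computable g ->
  computable (fun w e => f w e %% g w e).
Proof.
move=> Hf Hg; apply: computable_ext (computable_subn Hf (computable_mul (computable_div Hf Hg) Hg)).
by move=> w e; rewrite {1}(divn_eq (f w e) (g w e)) addKn.
Qed.

Lemma computable_nth (t : seq nat) f : computable f ->
  computable (fun w e => nth 0 t (f w e)).
Proof.
apply: (@computable1 (fun _ => nth 0 t)).
elim: t => [|a t IH].
  by apply: computable_ext (computable_const 0) => w e; rewrite nth_nil.
apply: computable_ext (computable_if (computable_eq (computable_var 0) (computable_const 0))
  (computable_const a) (computable1 (Q := fun _ => nth 0 t) IH (computable_pred (computable_var 0)))).
by move=> w e; case: (e 0).
Qed.

Lemma computable_exp f k : computable f -> computable (fun w e => f w e ^ k).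
Proof.
move=> Hf; elim: k => [|k IH]; first exact: (computable_const 1).
by apply: computable_ext (computable_mul Hf IH) => w e; rewrite expnS.
Qed.

(** Capping each round supplies the bound on intermediate values that [computable_iter] asks for. *)
Lemma computable_capped n z g b : computable n -> computable z -> computable g ->
  computable b ->
  computable (fun w e => iteri (n w e)
    (fun i y => minn (g w (push y (push i e))) (b w e)) (z w e)).
Proof.
move=> Hn Hz Hg Hb; pose g' w e := minn (g w e) (b w (fun i => e i.+2)).
apply: (@computable_iter n z g') => //.
  have Hb' := computable_ren (fun i => i.+2) Hb.
  apply: computable_ext (computable_if (computable_leq Hg Hb') Hg Hb') => w e.
  by rewrite /g'; case: leqP.
have [[Z [pZ HZ]] _] := Hz; have [[V [pV HV]] _] := Hb.
exists (fun B => Z B + V B); split; first exact: pol_add.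
move=> w e B [|k] Hw He Hk; first exact: leq_trans (HZ w e B Hw He) (leq_addr _ _).
rewrite /iter_val /= /g'; apply: leq_trans (geq_minr _ _) _.
exact: leq_trans (HV w e B Hw He) (leq_addl _ _).
Qed.

Lemma computable_half_iter f g : computable f -> computable g ->
  computable (fun w e => iter (f w e) half (g w e)).
Proof.
apply: (@computable2 (fun _ a b => iter a half b)).
apply: computable_ext (@computable_capped (fun w e => e 0) (fun w e => e 1)
  (fun w e => e 0 %/ 2) (fun w e => e 1) _ _ _ _).
- move=> _ e; have le k : iter k half (e 1) <= e 1 by elim: k => //= k; lia.
  by elim: (e 0) => //= k ->; have := le k; lia.
- exact: computable_var.
- exact: computable_var.
- by apply: computable_div (computable_const 2); apply: computable_var.
- exact: computable_var.
Qed.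

(** A conditional with a name, so that [comp1] can match on it. *)
Definition cif (b : bool) (x y : nat) := if b then x else y.

Ltac comp1 := first [simple apply computable_const | lazymatch goal with
  | |- computable (fun w e => e ?i) => exact (computable_var i)
  | |- computable (fun w e => size w) => exact computable_size
  | |- computable (fun w e => inp w (@?f w e)) => refine (@computable_inp f _)
  | |- computable (fun w e => @?f w e + @?g w e) => refine (@computable_add f g _ _)
  | |- computable (fun w e => @?f w e * @?g w e) => refine (@computable_mul f g _ _)
  | |- computable (fun w e => @?f w e - @?g w e) => refine (@computable_subn f g _ _)
  | |- computable (fun w e => @?f w e %/ @?g w e) => refine (@computable_div f g _ _)
  | |- computable (fun w e => @?f w e %% @?g w e) => refine (@computable_mod f g _ _)
  | |- computable (fun w e => (@?f w e) ^ ?k) => refine (@computable_exp f k _)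
  | |- computable (fun w e => (@?f w e).+1) => refine (@computable_succ f _)
  | |- computable (fun w e => (@?f w e).-1) => refine (@computable_pred f _)
  | |- computable (fun w e => nth 0 ?t (@?f w e)) => refine (@computable_nth t f _)
  | |- computable (fun w e => iter (@?f w e) half (@?g w e)) => refine (@computable_half_iter f g _ _)
  | |- computable (fun w e => cif (@?P w e) (@?f w e) (@?g w e)) => refine (@computable_if P _ f g _ _)
  | |- computable (fun w e => csum (@?f w e) (@?g w e)) => refine (@computable_csum f g _ _)
  | |- computable (fun w e => cfind (@?f w e) (@?g w e)) => refine (@computable_cfind f g _ _)
  | |- computable (fun w e => nat_of_bool (call (@?f w e) (@?g w e))) => refine (@computable_call f g _ _)
  | |- computable (fun w e => nat_of_bool (@?f w e <= @?g w e)) => refine (@computable_leq f g _ _)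
  | |- computable (fun w e => nat_of_bool (@?f w e == @?g w e)) => refine (@computable_eq f g _ _)
  | |- computable (fun w e => nat_of_bool (~~ @?f w e)) => refine (@computable_neg f _)
  | |- computable (fun w e => nat_of_bool (@?f w e && @?g w e)) => refine (@computable_and f g _ _)
  | |- computable (fun w e => nat_of_bool (@?f w e || @?g w e)) => refine (@computable_or f g _ _)
  | |- computable (fun w e => nat_of_bool (@?f w e ==> @?g w e)) => refine (@computable_imp f g _ _)
  end]; cbv beta.
Ltac comp := repeat comp1.

(** * Induced embeddings *)

Definition embedding (F G : sgraph) (phi : F -> G) : Prop :=
  injective phi /\ forall x y, edge (phi x) (phi y) = edge x y.

(** This replaces the nested subset types of an induced subgraph of [delete V] by a map into [G],
    the form used from here on. *)
Lemma contains_deleteP (F G : sgraph) (V : {set G}) :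
  contains_induced F (delete V) <->
  exists phi : F -> G, embedding phi /\ forall x, phi x \notin V.
Proof.
split=> [[S [f [[g fK gK] Hf]]]|[phi [[inj He] HV]]].
  exists (fun x => val (val (g x))); split=> [|x]; last first.
    by have := valP (val (g x)); rewrite inE.
  split=> [x y /val_inj/val_inj/(can_inj gK)//|x y].
  by rewrite -[in RHS](gK x) -[y in RHS]gK Hf.
have HV' x : phi x \in ~: V by rewrite inE HV.
pose h x : delete V := exist _ (phi x) (HV' x).
have hinj : injective h by move=> x y /(congr1 val)/inj.
pose S := [set h x | x in F].
have HS x : h x \in S by apply: imset_f.
pose g x : induced S := exist _ (h x) (HS x).
have ginj : injective g by move=> x y /(congr1 val)/hinj.
have gsurj (y : induced S) : exists x, g x == y.
  by have /imsetP[x _ E] := valP y; exists x; rewrite -val_eqE /= E.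
exists S, (fun y => xchoose (gsurj y)).
have K y : g (xchoose (gsurj y)) = y by apply/eqP; apply: (xchooseP (gsurj y)).
split; last by move=> x y; rewrite -[in RHS](K x) -[y in RHS]K -He.
by exists g => // x; apply: ginj; rewrite K.
Qed.

Definition deletable (F G : sgraph) (k : nat) : Prop :=
  exists V : {set G}, #|V| <= k /\ ~ contains_induced F (delete V).

Lemma embedding_comp (F G K : sgraph) (f : F -> G) (g : G -> K) :
  embedding f -> embedding g -> embedding (g \o f).
Proof.
by move=> [If Ef] [Ig Eg]; split=> [x y /= /Ig/If//|x y]; rewrite /= Eg.
Qed.

Lemma embedding_cycle (F G : sgraph) (phi : F -> G) (c : seq G) :
  embedding phi -> {subset c <= codom phi} -> ucycle (@edge G) c ->
  exists2 c' : seq F, c = map phi c' & ucycle (@edge F) c'.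
Proof.
move=> [inj He] sub /andP[Hc Hu].
have [c' Ec] : exists c', c = map phi c'.
  elim: c sub {Hc Hu} => [|x c IH] sub; first by exists [::].
  have [|c' ->] := IH; first by move=> y Hy; apply: sub; rewrite inE Hy orbT.
  have /codomP[x' ->] := sub x (mem_head _ _).
  by exists (x' :: c').
exists c' => //; rewrite /ucycle; move: Hc Hu; rewrite Ec (map_inj_uniq inj) => Hc ->.
rewrite andbT; move: Hc; case: (c') => //= x p.
rewrite -map_rcons path_map => Hp.
by rewrite -(eq_path (e := relpre phi (@edge G))) // => y z; apply: He.
Qed.

Lemma embedding_chord (F G : sgraph) (phi : F -> G) (c : seq G) :
  embedding phi -> chordal F -> {subset c <= codom phi} ->
  ucycle (@edge G) c -> 3 < size c -> exists x y : G, chord c x y.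
Proof.
move=> Hphi HF sub Hc; have [c' E Hc'] := embedding_cycle Hphi sub Hc.
rewrite E size_map => /(HF _ Hc')[x [y [Hx Hy Hxy Hn1 Hn2]]].
have [inj He] := Hphi; exists (phi x), (phi y).
have /andP[_ Hu] := Hc'.
by split; rewrite ?map_f ?He ?(next_map inj) ?(inj_eq inj).
Qed.

Section Iso.
Variables (G H : sgraph) (f : G -> H).
Hypotheses (bij : bijective f) (Hf : forall x y, edge (f x) (f y) = edge x y).

Let femb : embedding f. Proof. by split=> //; apply: bij_inj. Qed.

Lemma chordal_iso : chordal G -> chordal H.
Proof.
move=> HG c Hc; apply: embedding_chord femb HG _ Hc => x _.
by have [g _ gK] := bij; rewrite -(gK x) codom_f.
Qed.

Lemma split_iso : split_graph G -> split_graph H.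
Proof.
have [g fK gK] := bij.
have Hg x y : edge (g x) (g y) = edge x y by rewrite -Hf !gK.
move=> [C [I [CI dis HC HI]]]; exists (g @^-1: C), (g @^-1: I); split.
- by rewrite -preimsetU CI preimsetT.
- by rewrite -preimsetI dis preimset0.
- move=> x y; rewrite !inE -Hg => Hx Hy xy; apply: HC => //.
  by rewrite (can_eq gK).
- by move=> x y; rewrite !inE -Hg; apply: HI.
Qed.

Lemma deletable_iso F k : deletable F G k -> deletable F H k.
Proof.
move=> [V [HV nF]]; exists (f @: V); split.
  exact: leq_trans (leq_imset_card _ _) HV.
move=> /contains_deleteP[phi [Hphi av]]; apply: nF; apply/contains_deleteP.
have [g fK gK] := bij; exists (g \o phi); split.
  apply: embedding_comp Hphi _; split; first exact: can_inj gK.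
  by move=> x y; rewrite -Hf !gK.
by move=> x; apply: contra (av x) => /= Hx; rewrite -(gK (phi x)) imset_f.
Qed.

End Iso.

(** * Connectivity *)

Lemma connected_spread (G : sgraph) (P : pred G) x y :
  connected G -> (forall u v, edge u v -> P u -> P v) -> P x -> P y.
Proof.
move=> /(_ x y)/connectP[p Hp ->] HP; elim: p x Hp => //= z p IH x.
by move=> /andP[xz Hp] /(HP _ _ xz); apply: IH.
Qed.

Lemma biconnected_spread (G : sgraph) (P : pred G) c x y :
  biconnected G -> (forall u v, u != c -> v != c -> edge u v -> P u -> P v) ->
  x != c -> y != c -> P x -> P y.
Proof.
move=> [_ _ /(_ c) ncut] HP xc yc.
pose D := delete [set c].
have Hconn : connected D.
  (* The absence of a cut vertex only gives the double negation of connectedness; on a finite graph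
     connectedness is decidable, which removes it. *)
  case E : [forall x : D, forall y : D, connect (@edge D) x y].
    by move=> u v; move: E => /forallP/(_ u)/forallP/(_ v).
  case: ncut => H; move/negP: E; apply.
  by apply/forallP => u; apply/forallP => v; apply: H.
have xD : x \in ~: [set c] by rewrite !inE.
have yD : y \in ~: [set c] by rewrite !inE.
apply: (@connected_spread D (fun u => P (val u)) (exist _ x xD) (exist _ y yD) Hconn).
move=> u v uv; apply: HP => //.
  by have := valP u; rewrite !inE.
by have := valP v; rewrite !inE.
Qed.

Lemma connected_neighbour (G : sgraph) (x : G) :
  connected G -> 2 <= #|G| -> exists y, edge x y.
Proof.
move=> HG /card_gt1P[u [v [_ _ uv]]].
case: (pickP (edge x)) => [y|nx]; first by exists y.
have H y : y == x.
  apply: (@connected_spread G (pred1 x) x y HG) => [s t st /eqP E|]; last exact: eqxx.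
  by have := nx t; rewrite -E st.
by move: uv; rewrite (eqP (H u)) (eqP (H v)) eqxx.
Qed.

(** * Attaching a copy of the forbidden graph to every pair *)

Lemma next_cat (T : eqType) (s1 s2 : seq T) x y :
  uniq (s1 ++ x :: y :: s2) -> next (s1 ++ x :: y :: s2) x = y.
Proof.
by move=> U; rewrite -(next_rot (size s1) U) rot_size_cat /= eqxx.
Qed.

Lemma split_first (T : eqType) (P : pred T) s : has P s ->
  exists s1 x s2, [/\ s = s1 ++ x :: s2, P x & ~~ has P s1].
Proof.
elim: s => //= x s IH; case: (boolP (P x)) => [Px _|nPx /= /IH].
  by exists [::], x, s.
move=> [s1 [y [s2 [-> Py n1]]]]; exists (x :: s1), y, s2; split=> //=.
by rewrite negb_or nPx.
Qed.

Lemma split_last (T : eqType) (P : pred T) s : has P s ->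
  exists s1 x s2, [/\ s = s1 ++ x :: s2, P x & ~~ has P s2].
Proof.
rewrite -has_rev => /split_first[s1 [x [s2 [E Px n1]]]].
exists (rev s2), x, (rev s1); split=> //; last by rewrite has_rev.
by rewrite -[s]revK E rev_cat rev_cons cat_rcons.
Qed.

Lemma chord_rot (G : sgraph) (c : seq G) n x y :
  uniq c -> chord (rot n c) x y -> chord c x y.
Proof.
move=> U [Hx Hy xy n1 n2]; move: Hx Hy; rewrite !mem_rot => Hx Hy.
by split; rewrite -?(next_rot n U).
Qed.

(* The cycle enters and leaves [S] through distinct vertices of [B]. *)
Lemma separator_chord (G : sgraph) (S B : pred G) (c : seq G) s t :
  (forall x y, edge x y -> S x -> S y || B y) -> (forall x, S x -> ~~ B x) ->
  {in B &, forall x y, x != y -> edge x y} ->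
  ucycle (@edge G) c -> s \in c -> S s -> t \in c -> ~~ S t -> ~~ B t ->
  exists x y, chord c x y.
Proof.
move=> HS SB HB Hc sc Ss tc nSt nBt; have Uc : uniq c by case/andP: Hc.
have [n p Ep] := rot_to tc.
suff [x [y Hxy]] : exists x y, chord (t :: p) x y.
  by exists x, y; apply: (@chord_rot _ _ n); rewrite ?Ep.
have: ucycle (@edge G) (t :: p) by rewrite -Ep rot_ucycle.
have sp : s \in p.
  have : s \in t :: p by rewrite -Ep mem_rot.
  by rewrite inE => /orP[/eqP E|//]; rewrite -E Ss in nSt.
(* Read from [t], the cycle has its first vertex of [S] at [x] and its last at [y]. The vertex [u]
   before [x] and the vertex [z] after [y] lie in [B] and form the chord. *)
have [p1 [x [p2 [Ep1 Sx n1]]]] : exists s1 x s2, [/\ p = s1 ++ x :: s2, S x & ~~ has S s1].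
  by apply: split_first; apply/hasP; exists s.
have [q1 [y [q2 [Eq Sy n2]]]] : exists s1 y s2, [/\ x :: p2 = s1 ++ y :: s2, S y & ~~ has S s2].
  by apply: split_last; rewrite /= Sx.
rewrite Ep1 Eq => /andP[Hcyc U].
have Hp : path (@edge G) t (p1 ++ q1 ++ y :: rcons q2 t).
  by move: Hcyc; rewrite /cycle !rcons_cat.
have neigh v w : edge v w || edge w v -> S w -> ~~ S v -> B v.
  rewrite [edge w v]edge_sym orbb edge_sym => vw Sw nSv.
  by have := HS _ _ vw Sw; rewrite (negbTE nSv).
have [p1' [u [Eu Bu]]] : exists p1' u, p1 = rcons p1' u /\ B u.
  have Hx : edge (last t p1) x.
    move: Hp; rewrite -cats1 -[y :: _]/((y :: q2) ++ [:: t]) [q1 ++ _]catA -Eq cat_path.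
    by case/andP=> _ /andP[].
  case/lastP: p1 n1 Hx {Ep1 Hp Hcyc U} => [|p1' u] n1 Hx.
    by move: nBt; rewrite (neigh t x) ?Hx.
  exists p1', u; split=> //; rewrite last_rcons in Hx; apply: (neigh u x); rewrite ?Hx //.
  by move: n1; rewrite has_rcons negb_or => /andP[].
have [z [q3 [Ez Bz]]] : exists z q3, q2 = z :: q3 /\ B z.
  move: Hp; rewrite !cat_path /= => /and4P[_ _ _].
  case: (q2) n2 => [|z q3] /= n2 /andP[Hz _].
    by move: nBt; rewrite (neigh t y) ?Hz ?orbT.
  exists z, q3; split=> //; apply: (neigh z y); rewrite ?Hz ?orbT //.
  by move: n2; rewrite negb_or => /andP[].
have nu : next (t :: p1 ++ q1 ++ y :: q2) u = x.
  by move: U; rewrite -Eq Eu cat_rcons -cat_cons; apply: next_cat.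
(* The successor of [z] is either [t], which is not in [B], or a vertex listed after [z]; the cycle
   being simple, neither is [u]. *)
have nz : next (t :: p1 ++ q1 ++ y :: q2) z != u.
  move: U; rewrite Eu Ez; case: (q3) => [|w q4] U.
    rewrite -(next_rot 1 U) rot1_cons -cats1 -!catA /=.
    have -> : rcons p1' u ++ q1 ++ [:: y; z; t] = (rcons p1' u ++ q1 ++ [:: y]) ++ [:: z; t].
      by rewrite -!catA.
    rewrite next_cat; first by apply: contraNneq nBt => ->.
    rewrite -!catA /= -[[:: y; z; t]]/([:: y; z] ++ [:: t]) !catA cats1 -rot1_cons rot_uniq.
    by rewrite -!catA.
  have E : t :: rcons p1' u ++ q1 ++ [:: y, z, w & q4] =
      (t :: rcons p1' u ++ q1 ++ [:: y]) ++ [:: z, w & q4] by rewrite /= -!catA.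
  move: U; rewrite E => U; rewrite next_cat //.
  move: U; rewrite cat_uniq => /and3P[_ /hasPn/(_ w) H _].
  apply: contraTneq (H _) => [->|]; last by rewrite !inE eqxx orbT.
  by rewrite negbK /= inE !mem_cat mem_rcons mem_head !orbT.
have uz : u != z.
  move: U; rewrite -cat_cons cat_uniq => /and3P[_ /hasPn/(_ z) H _].
  apply: contraTneq (H _) => [<-|]; last by rewrite Ez mem_cat !inE eqxx !orbT.
  by rewrite negbK inE Eu mem_rcons mem_head !orbT.
exists u, z; split; rewrite ?nu ?(eq_sym u) //.
- by rewrite inE mem_cat Eu mem_rcons mem_head !orbT.
- by rewrite Ez inE !mem_cat !inE eqxx !orbT.
- exact: HB.
- by apply: contraTneq Bz => ->; apply: SB.
Qed.

Section Gadget.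
Variables (F : sgraph) (a b : F) (N : nat) (H : rel 'I_N).
Hypotheses (Fab : edge a b) (Hirr : irreflexive H).

(* [inl i] are the vertices of a clique; [inr (i, j, f)] is the copy of [f]
   in the gadget of [(i, j)], whose copies of [a] and [b] are replaced by
   [inl i] and [inl j] (the unused copies are isolated). *)
Definition gvertex : finType := ('I_N + 'I_N * 'I_N * F)%type.

Definition inner (f : F) := (f != a) && (f != b).

(** [H] need not be symmetric: a copy belongs to an ordered pair, and [(i, j)] and [(j, i)] may both
    carry one. *)
Definition gedge (x y : gvertex) : bool :=
  match x, y with
  | inl u, inl v => u != v
  | inl u, inr (i, j, f) =>
      [&& H i j, inner f & (u == i) && edge a f || (u == j) && edge b f]
  | inr (i, j, f), inl u =>
      [&& H i j, inner f & (u == i) && edge a f || (u == j) && edge b f]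
  | inr (i, j, f), inr (i', j', f') =>
      [&& H i j, inner f, inner f', i == i', j == j' & edge f f']
  end.

Lemma gedge_sym : symmetric gedge.
Proof.
suff imp x y : gedge x y -> gedge y x by move=> x y; apply/idP/idP; apply: imp.
case: x y => [u|[[i j] f]] [v|[[i' j'] f']] //=; first by rewrite eq_sym.
case/and5P=> Hij If If' /eqP<- /andP[/eqP<- ff'].
by rewrite Hij If If' !eqxx edge_sym ff'.
Qed.

Lemma gedge_irr : irreflexive gedge.
Proof. by move=> [u|[[i j] f]] /=; rewrite ?eqxx // edge_irrefl !andbF. Qed.

Definition gadget : sgraph := SGraph gedge_sym gedge_irr.

Lemma neq_ab : a != b.
Proof. by apply: contraTneq Fab => ->; rewrite edge_irrefl. Qed.

Definition gcopy (i j : 'I_N) (f : F) : gadget :=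
  if f == a then inl i else if f == b then inl j else inr (i, j, f).

Lemma gcopy_embedding i j : H i j -> embedding (gcopy i j).
Proof.
move=> Hij; have ij : i != j by apply: contraTneq Hij => ->; rewrite Hirr.
have ba := neq_ab; rewrite eq_sym in ba.
split=> x y; rewrite /gcopy.
  case: (x =P a) => [->|xa]; case: (y =P a) => [->|ya] //.
  - by case: eqP => // _ []/eqP; rewrite (negbTE ij).
  - by case: eqP => // _ []/esym/eqP; rewrite (negbTE ij).
  by case: (x =P b) => [->|xb]; case: (y =P b) => [->|yb] // [].
have inn z : z != a -> z != b -> inner z by rewrite /inner => -> ->.
case: (altP (x =P a)) => [->|xa]; case: (altP (y =P a)) => [->|ya] /=.
- by rewrite edge_irrefl eqxx.
- case: (altP (y =P b)) => [->|yb] /=; first by rewrite ij Fab.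
  by rewrite Hij inn // eqxx (negbTE ij) orbF.
- case: (altP (x =P b)) => [->|xb] /=; first by rewrite eq_sym ij edge_sym Fab.
  by rewrite Hij inn // eqxx (negbTE ij) orbF edge_sym.
case: (altP (x =P b)) => [->|xb]; case: (altP (y =P b)) => [->|yb] /=.
- by rewrite edge_irrefl eqxx.
- by rewrite Hij inn // eqxx eq_sym (negbTE ij).
- by rewrite Hij inn // eqxx eq_sym (negbTE ij) [edge x b]edge_sym.
- by rewrite Hij !inn // !eqxx.
Qed.

Definition vertex_cover (k : nat) : Prop :=
  exists X : {set 'I_N}, #|X| <= k /\ forall i j, H i j -> (i \in X) || (j \in X).

(** A deleted interior vertex of the gadget of [(i, j)] is traded for [i]. If neither end is chosen
    then, the copy of [F] on [(i, j)] has lost no vertex. *)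
Lemma deletable_vertex_cover k : deletable F gadget k -> vertex_cover k.
Proof.
move=> [V [HV nF]].
pose h (x : gadget) : 'I_N := match x with inl i => i | inr (i, _, _) => i end.
exists (h @: V); split; first exact: leq_trans (leq_imset_card _ _) HV.
move=> i j Hij; apply: contraT; rewrite negb_or => /andP[iX jX].
case: nF; apply/contains_deleteP; exists (gcopy i j); split.
  exact: gcopy_embedding.
move=> x; rewrite /gcopy; case: eqP => [_|_].
  by apply: contra iX => Hi; apply/imsetP; exists (inl i).
case: eqP => [_|_]; first by apply: contra jX => Hj; apply/imsetP; exists (inl j).
by apply: contra iX => Hx; apply/imsetP; exists (inr (i, j, x)).
Qed.

Lemma gedge_inr i j f y : gedge (inr (i, j, f)) y ->
  [/\ H i j, inner f &
      [\/ y = inl i, y = inl j | exists2 f', inner f' & y = inr (i, j, f')]].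
Proof.
case: y => [u|[[i' j'] f']] /=; first by
  case/and3P=> -> -> /orP[]/andP[/eqP-> _]; split=> //; [apply: Or31|apply: Or32].
case/and5P=> -> -> Hf' /eqP<- /andP[/eqP<- _]; split=> //.
by apply: Or33; exists f'.
Qed.

Lemma vertex_cover_deletable k :
  biconnected F -> ~ complete F -> vertex_cover k -> deletable F gadget k.
Proof.
move=> HF ncF [X [HX cov]]; have [conn F2 _] := HF.
exists [set inl i | i in X]; split; first exact: leq_trans (leq_imset_card _ _) HX.
move=> /contains_deleteP[phi [[inj He] av]].
have avX i x : i \in X -> phi x <> inl i.
  by move=> Hi E; have := av x; rewrite E imset_f.
have [x0 [i [j [f0 E0]]]] : exists x i j f, phi x = inr (i, j, f).
  case: (pickP (fun x => if phi x is inr _ then true else false)) => [x|Hx].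
    by case E : (phi x) => [//|[[i j] f]] _; exists x, i, j, f.
  case: ncF => x y xy; rewrite -He /= /gedge.
  have := Hx x; have := Hx y; case Ex : (phi x) => [u|//]; case Ey : (phi y) => [v|//] _ _.
  by apply: contra xy => /eqP uv; apply/eqP/inj; rewrite Ex Ey uv.
have inn x i' j' f : phi x = inr (i', j', f) -> H i' j' /\ inner f.
  move=> E; have [y] := connected_neighbour x conn F2.
  by rewrite -He E => /gedge_inr[].
have [Hij _] := inn _ _ _ _ E0.
pose P x := if phi x is inr (i', j', _) then (i' == i) && (j' == j) else false.
have Px0 : P x0 by rewrite /P E0 !eqxx.
pose h x := if phi x is inr (_, _, f) then f else a.
(* [P] selects the vertices of [F] placed in the interior of the gadget of [(i, j)]; at most one
   vertex lying elsewhere already leads to a contradiction. *)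
suff Hall : exists c, forall x, P x || (x == c).
  have [c Hc] := Hall.
  have hP x : P x -> exists2 f, inner f & phi x = inr (i, j, f).
    rewrite /P; case E : (phi x) => [//|[[i' j'] f]] /andP[/eqP Ei /eqP Ej].
    by exists f; [have [] := inn _ _ _ _ E | rewrite Ei Ej].
  have hc x : ~~ P x -> x = c by move=> nP; have := Hc x; rewrite (negbTE nP) => /eqP.
  have hb x : h x != b.
    case: (boolP (P x)) => [/hP[f /andP[_ fb] E]|nP]; first by rewrite /h E.
    rewrite /h; case E : (phi x) => [u|[[i' j'] f]]; first exact: neq_ab.
    by have [_ /andP[]] := inn _ _ _ _ E.
  (* Interior vertices return to their originals, and the possible exception goes to [a]. An
     injective self-map of the finite [F] is onto, yet this one misses [b]. *)
  have hinj : injective (fun x => if P x then h x else a).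
    move=> x y; case: (boolP (P x)) => [/hP[f If Ex]|/hc->];
      case: (boolP (P y)) => [/hP[f' If' Ey]|/hc->] //.
    - by rewrite /h Ex Ey => E; apply: inj; rewrite Ex Ey E.
    - by rewrite /h Ex => E; move: If; rewrite E /inner eqxx.
    - by rewrite /h Ey => E; move: If'; rewrite -E /inner eqxx.
  have [g _ gK] := injF_bij hinj; have := gK b => /=; case: ifP => _ /eqP.
    by rewrite (negbTE (hb _)).
  by rewrite (negbTE neq_ab).
have step d u v : (forall x, phi x <> inl (if d then i else j)) ->
    edge u v -> P u -> P v \/ phi v = inl (if d then j else i).
  move=> nd; rewrite -He /P; case Eu : (phi u) => [//|[[i' j'] f]] uv /andP[/eqP Ei /eqP Ej].
  move: uv; rewrite Ei Ej => /gedge_inr[_ _ [E|E|[f' _ ->]]].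
  - by case: d nd => nd; [case: (nd v) | right].
  - by case: d nd => nd; [right | case: (nd v)].
  - by left; rewrite !eqxx.
have [d nd] : exists d : bool, forall x, phi x <> inl (if d then i else j).
  by case/orP: (cov _ _ Hij) => HX'; [exists true | exists false] => x; apply: avX.
(* If some [c] occupies the surviving end, the rest of [F] is connected and cannot leave the
   interior; otherwise all of [F] is inside and any vertex serves as [c]. *)
case: (pickP (fun c => phi c == inl (if d then j else i))) => [c /eqP Ec|nc].
  exists c => x; case: (altP (x =P c)) => [_|xc]; first by rewrite orbT.
  rewrite orbF; apply: (@biconnected_spread F P c x0 x HF) => // [u v uc vc uv Pu|].
    have [//|E] := step d u v nd uv Pu.
    by move/eqP: vc; case; apply: inj; rewrite E Ec.
  by apply: contraTneq Px0 => ->; rewrite /P Ec.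
exists x0 => x; rewrite (@connected_spread F P x0 x conn) // => u v uv Pu.
by have [//|E] := step d u v nd uv Pu; have := nc v; rewrite E eqxx.
Qed.

Lemma gadget_split (C I : {set F}) : split_partition C I -> C = [set a; b] ->
  split_graph gadget.
Proof.
move=> [CI dis HC HI] EC.
exists [set x : gadget | if x is inl _ then true else false],
       [set x : gadget | if x is inr _ then true else false]; split.
- by apply/setP => -[u|v]; rewrite !inE.
- by apply/setP => -[u|v]; rewrite !inE.
- by move=> [u|u] [v|v]; rewrite !inE.
move=> [u|[[i j] f]] [v|[[i' j'] f']]; rewrite !inE //= => _ _.
have inI g : inner g -> g \in I.
  move=> /andP[ga gb]; have : g \in C :|: I by rewrite CI inE.
  by rewrite EC !inE (negbTE ga) (negbTE gb).
apply/negP => /and5P[_ If If' _ /andP[_]]; apply/negP.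
by apply: HI; apply: inI.
Qed.

Lemma gadget_chordal : chordal F -> chordal gadget.
Proof.
move=> HF c Hc szc; have /andP[Hcyc U] := Hc.
case: (pickP (fun x => (x \in c) && if x is inr _ then true else false)) => [|Hl].
  move=> [u|[[i j] f]] /andP[xc] // _.
  have [Hij If _] := gedge_inr (next_cycle Hcyc xc).
  pose S (x : gadget) := if x is inr (i', j', _) then (i' == i) && (j' == j) else false.
  pose B (x : gadget) := (x == inl i) || (x == inl j).
  (* Either the cycle leaves the gadget, whose two ends then separate it, or it lies in a single
     copy of the chordal graph [F]. *)
  case: (pickP (fun t => [&& t \in c, ~~ S t & ~~ B t])) => [t /and3P[tc nSt nBt]|Hin].
    apply: (@separator_chord gadget S B c (inr (i, j, f)) t) => //.
    - move=> [//|[[i' j'] f']] y xy /= /andP[/eqP Ei /eqP Ej]; move: xy.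
      rewrite Ei Ej => /gedge_inr[_ _ [->|->|[f'' _ ->]]].
      + by rewrite /B eqxx orbT.
      + by rewrite /B eqxx !orbT.
      + by rewrite /S /= !eqxx.
    - by move=> [//|[[i' j'] f']] _.
    - move=> x y /orP[]/eqP-> /orP[]/eqP-> // xy.
    - by rewrite /S !eqxx.
  apply: (embedding_chord (gcopy_embedding Hij) HF _ Hc szc) => x xc'.
  have := Hin x; rewrite xc' /=; case: (boolP (B x)) => [/orP[]/eqP-> _|_].
  - by apply/codomP; exists a; rewrite /gcopy eqxx.
  - by apply/codomP; exists b; rewrite /gcopy eqxx eq_sym (negbTE neq_ab).
  rewrite andbT => /negbFE; case: x xc' => [//|[[i' j'] f']] xc' /andP[/eqP Ei /eqP Ej].
  have [_ /andP[/negbTE fa /negbTE fb] _] := gedge_inr (next_cycle Hcyc xc').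
  by apply/codomP; exists f'; rewrite /gcopy fa fb Ei Ej.
(* Without interior vertices the cycle lies in the clique; its first and third vertices form a
   chord. *)
case: c Hc szc Hcyc U Hl => [|x0 [|x1 [|x2 [|x3 c]]]] // Hc _ Hcyc U Hl.
have lft x : x \in [:: x0, x1, x2, x3 & c] -> exists u, x = inl u.
  by move=> xc; have := Hl x; rewrite xc; case: x {xc} => // u; exists u.
have [u0 E0] := lft x0 (mem_head _ _).
have [u2 E2] : exists u, x2 = inl u by apply: lft; rewrite !inE eqxx !orbT.
move: U; rewrite /= !inE !negb_or.
case/and4P=> [/and4P[n01 n02 n03 n0c] /and3P[n12 n13 _] /andP[n23 _] _].
exists x0, x2; split; rewrite ?inE ?eqxx ?orbT //.
- by rewrite E0 E2 /=; apply: contra n02 => /eqP uu; rewrite E0 E2 uu.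
- by rewrite /= eqxx eq_sym.
- by rewrite /= ![x2 == _]eq_sym (negbTE n02) (negbTE n12) eqxx.
Qed.

End Gadget.

(** * From satisfiability to vertex cover *)

Section Cnf.
Variables (m w : nat) (var : nat -> nat -> nat) (sgn : nat -> nat -> bool).
Hypothesis w0 : 0 < w.

Definition satisfiable : Prop :=
  exists A : nat -> bool, forall c, c < m ->
    exists2 l, l < w & A (var c l) = sgn c l.

(* Literal occurrence [l] of clause [c] is the vertex [c * w + l]. *)
Definition conflict (u v : nat) : bool :=
  (u != v) && (u %/ w == v %/ w) ||
  [&& var (u %/ w) (u %% w) == var (v %/ w) (v %% w),
      sgn (u %/ w) (u %% w) & ~~ sgn (v %/ w) (v %% w)].

Definition conflict_rel : rel 'I_(m * w) := fun u v => conflict u v.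

Lemma clause_lt (u : 'I_(m * w)) : u %/ w < m.
Proof. by rewrite ltn_divLR. Qed.

(** The complement of such a cover is an independent set of at least [m] occurrences. It has at most
    one in each clause, hence exactly one, and no two are opposite: these are the literals to be
    made true. *)
Lemma satisfiable_vertex_cover :
  satisfiable <-> vertex_cover conflict_rel (m * w - m).
Proof.
split=> [[A HA]|[X [HX cov]]].
  have Hl (c : 'I_m) : exists l : 'I_w, A (var c l) == sgn c l.
    by have [l Hl /eqP E] := HA c (ltn_ord c); exists (Ordinal Hl).
  pose l c := xchoose (Hl c).
  have lP (c : 'I_m) : A (var c (l c)) = sgn c (l c) by apply/eqP/(xchooseP (Hl c)).
  pose cl u := Ordinal (clause_lt u).
  exists [set u : 'I_(m * w) | u %% w != l (cl u)]; split.
    have lt (c : 'I_m) : c * w + l c < m * w.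
      by have := ltn_ord c; have := ltn_ord (l c); move: (l c : nat) => x; nia.
    pose h c := Ordinal (lt c).
    have hinj : injective h.
      move=> c c' /(congr1 val) /= /(congr1 (divn^~ w)).
      by rewrite !divnMDl // !divn_small ?ltn_ord // !addn0 => /val_inj.
    have := cardsC [set u : 'I_(m * w) | u %% w != l (cl u)].
    set X := [set _ | _]; rewrite card_ord => EX.
    suff : m <= #|~: X| by move: EX; move: #|X| #|~: X|; lia.
    rewrite -[m in m <= _]card_ord -(card_imset _ hinj).
    apply/subset_leq_card/subsetP => _ /imsetP[c _ ->].
    rewrite !inE negbK /= modnMDl modn_small ?ltn_ord //.
    apply/eqP; congr (nat_of_ord (l _)); apply: val_inj => /=.
    by rewrite divnMDl // divn_small ?ltn_ord ?addn0.
  move=> u v; rewrite !inE => Huv; rewrite -negb_and; apply: contraTN Huv.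
  move=> /andP[/eqP Eu /eqP Ev]; rewrite /conflict_rel /conflict negb_or negb_and negbK.
  apply/andP; split.
    case: eqP => //= ne; apply/eqP => Ecl; case: ne.
    rewrite (divn_eq u w) (divn_eq v w) Eu Ev Ecl; congr (_ + nat_of_ord (l _)).
    exact: val_inj.
  rewrite Eu Ev; have := lP (cl u); have := lP (cl v) => /= <- <-.
  by apply/and3P => -[/eqP -> ->].
pose I := ~: X.
have HI : m <= #|I|.
  have := cardsC X; rewrite card_ord -/I => E.
  by move: HX E; move: #|X| #|I|; nia.
have ind u v : u \in I -> v \in I -> ~~ conflict u v.
  rewrite !inE => Hu Hv; apply/negP => /cov.
  by rewrite (negbTE Hu) (negbTE Hv).
pose cl u := Ordinal (clause_lt u).
have clinj : {in I &, injective cl}.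
  move=> u v Hu Hv /(congr1 val) /= E; apply/val_inj/eqP.
  by have := ind u v Hu Hv; rewrite /conflict E eqxx andbT negb_or negbK => /andP[].
have HclT : cl @: I = setT.
  by apply/eqP; rewrite eqEcard subsetT cardsT card_ord card_in_imset.
(* Variables without a chosen positive occurrence are false, which also satisfies the chosen
   negative ones. *)
pose A v := [exists u in I, (var (u %/ w) (u %% w) == v) && sgn (u %/ w) (u %% w)].
exists A => c Hc; have : Ordinal Hc \in cl @: I by rewrite HclT.
case/imsetP=> u Hu /(congr1 val) /= Ec; exists (u %% w); first exact: ltn_pmod.
rewrite Ec; case E : (sgn _ _).
  by apply/existsP; exists u; rewrite Hu eqxx E.
apply/negbTE/existsP => -[v /and3P[Hv /eqP Ev sv]].
by have := ind v u Hv Hu; rewrite /conflict Ev sv E eqxx orbT.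
Qed.

End Cnf.

(** * Encodings *)

Lemma iota_shift a n : iota a n = [seq a + j | j <- iota 0 n].
Proof. by rewrite -iotaDl addn0. Qed.

Lemma mkseq_recl (T : Type) (f : nat -> T) n :
  mkseq f n.+1 = f 0 :: mkseq (fun i => f i.+1) n.
Proof. by rewrite /mkseq /= (iota_shift 1) -map_comp. Qed.

Lemma allpairs_mkseq (T : Type) (E : nat -> nat -> T) m n :
  [seq E i j | i <- iota 0 m, j <- iota 0 n] =
  mkseq (fun p => E (p %/ n) (p %% n)) (m * n).
Proof.
elim: m => [//|m IH]; rewrite -[in LHS]addn1 iotaD map_cat flatten_cat IH /= cats0.
rewrite mulSn [n + _]addnC /mkseq iotaD map_cat !add0n; congr (_ ++ _).
rewrite (iota_shift (m * n)) -map_comp; apply/eq_in_map => j.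
rewrite mem_iota => Hj /=; have n0 : 0 < n by lia.
by rewrite divnMDl // modnMDl divn_small ?modn_small ?addn0.
Qed.

Lemma matrix_mkseq n (e : rel 'I_n) (E : nat -> nat -> bool) :
  (forall i j : 'I_n, e i j = E i j) ->
  [seq e i j | i <- enum 'I_n, j <- enum 'I_n] =
  mkseq (fun p => E (p %/ n) (p %% n)) (n * n).
Proof.
move=> H; rewrite -allpairs_mkseq -!val_enum_ord.
rewrite [RHS]allpairs_mapl; congr flatten; apply: eq_map => i /=.
by rewrite -map_comp; apply: eq_map => j /=.
Qed.

Lemma nat_bits_rec k : 0 < k -> nat_bits k = odd k :: nat_bits k./2.
Proof.
have posK p : nat_bits (nat_of_pos p) = pos_bits p.
  by rewrite /nat_bits -[nat_of_pos p]/(nat_of_bin (BinNums.Npos p)) nat_of_binK.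
move=> k0; have [p ->] : exists p, k = nat_of_pos p.
  case E : (bin_of_nat k) => [|p]; last by exists p; rewrite -(bin_of_natK k) E.
  by move: k0; rewrite -(bin_of_natK k) E.
rewrite posK; case: p => [p|p|] //=; rewrite /= NatTrec.doubleE ?oddS odd_double.
  by rewrite uphalf_double -posK.
by rewrite doubleK -posK.
Qed.

Definition bits_val (u : seq bool) : nat := foldr (fun (b : bool) v => b + v.*2) 0 u.

Lemma nat_bitsK k : bits_val (nat_bits k) = k.
Proof.
elim/ltn_ind: k => -[|k] IH //; rewrite nat_bits_rec //= -/(bits_val _) IH.
  by rewrite -[RHS](odd_double_half k.+1).
by have := odd_double_half k.+1; lia.
Qed.

Lemma bits_valK u : last false u -> nat_bits (bits_val u) = u.
Proof.
have pos v : last false v -> 0 < bits_val v.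
  elim: v => //= b [|b' v] IH; first by case: b.
  by move=> /= /IH; rewrite /=; case: b => //=; lia.
elim: u => //= b [|b' u] IH; first by case: b.
move=> H; have Hp := pos (b' :: u) H; have {}IH := IH H.
rewrite nat_bits_rec; last by rewrite -/(bits_val (b' :: u)); lia.
rewrite oddD odd_double addbF oddb; congr (_ :: _).
by rewrite half_bit_double.
Qed.

Lemma last_nat_bits k : last false (nat_bits k) = (0 < k).
Proof.
elim/ltn_ind: k => -[|[|k]] IH //; rewrite nat_bits_rec //=.
have Hh : 0 < (k.+2)./2 < k.+2 by lia.
case: (nat_bits _) (IH _ (proj2 (andP Hh))) => [|b s] /=; first by lia.
by move=> ->; lia.
Qed.

(** The number of binary digits, as a sum so that it is an instance of [csum]. *)
Definition nbits (k : nat) : nat := \sum_(j < k) (0 < iter j half k).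

Lemma nat_bits_mkseq k : nat_bits k = mkseq (fun j => odd (iter j half k)) (nbits k).
Proof.
have iter0 j : iter j half 0 = 0 by elim: j => //= j ->.
(* The range [K] is separated from [k] because the induction halves [k]. *)
suff H K : k <= K -> nat_bits k =
    mkseq (fun j => odd (iter j half k)) (\sum_(j < K) (0 < iter j half k)) by exact: H.
elim/ltn_ind: k K => -[|k] IH K Hk.
  by rewrite big1 // => j _; rewrite iter0.
case: K Hk => // K Hk; rewrite big_ord_recl add1n mkseq_recl nat_bits_rec //.
rewrite (IH _ _ K); [|lia|lia]; congr (_ :: _); rewrite /mkseq.
have -> : \sum_(i < K) (0 < iter (lift ord0 i) half k.+1) =
    \sum_(j < K) (0 < iter j half k.+1./2).
  by apply: eq_bigr => j _; rewrite -iterSr.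
by apply: eq_map => j; rewrite -iterSr.
Qed.

(** The reduction emits its output bit by bit and therefore needs the encoding as a formula in the
    position. *)
Lemma encode_nth n (e : rel 'I_n) (E : nat -> nat -> bool) k :
  (forall i j : 'I_n, e i j = E i j) -> encode e k = mkseq (fun p =>
    if p < n then true else if p == n then false else
    if p < n.+1 + n * n then E ((p - n.+1) %/ n) ((p - n.+1) %% n)
    else odd (iter (p - (n.+1 + n * n)) half k)) (n.+1 + n * n + nbits k).
Proof.
move=> H; rewrite /encode (matrix_mkseq H) nat_bits_mkseq.
have Ei b : iota 0 (n.+1 + n * n + b) =
    iota 0 n ++ n :: iota n.+1 (n * n) ++ iota (n.+1 + n * n) b.
  by rewrite 2!iotaD -[in iota 0 n.+1]addn1 iotaD -!catA.
rewrite /mkseq Ei map_cat /= map_cat; congr (_ ++ _).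
  apply: (@eq_from_nth _ true) => [|i]; rewrite ?size_map ?size_iota ?size_nseq //.
  by move=> Hi; rewrite nth_nseq Hi (nth_map 0) ?size_iota // nth_iota ?Hi.
rewrite ltnn eqxx; congr (_ :: _); congr (_ ++ _).
  rewrite (iota_shift n.+1) -map_comp; apply/eq_in_map => j.
  rewrite mem_iota /= => Hj; have [-> -> ->] : [/\ (n.+1 + j < n) = false,
    (n.+1 + j == n) = false & n.+1 + j < n.+1 + n * n] by split; lia.
  by rewrite addKn.
rewrite (iota_shift (n.+1 + n * n)) -map_comp; apply: eq_map => j /=.
have [-> -> ->] : [/\ (n.+1 + n * n + j < n) = false,
  (n.+1 + n * n + j == n) = false &
  (n.+1 + n * n + j < n.+1 + n * n) = false] by split; lia.
by rewrite addKn.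
Qed.

(** Until [n = n'] is known the two relations have different types; they are compared through
    functions on [nat]. *)
Lemma encode_inj n (e : rel 'I_n) k n' (e' : rel 'I_n') k' (E E' : nat -> nat -> bool) :
  (forall i j : 'I_n, e i j = E i j) -> (forall i j : 'I_n', e' i j = E' i j) ->
  encode e k = encode e' k' ->
  [/\ n = n', forall i j, i < n -> j < n -> E i j = E' i j & k = k'].
Proof.
move=> He He'; rewrite /encode => EE.
have key x y (s t : seq bool) : nseq x true ++ false :: s = nseq y true ++ false :: t -> x = y.
  by elim: x y => [|x IH] [|y] //= [] /IH ->.
have En := key _ _ _ _ EE; subst n'; move/eqP: EE; rewrite eqseq_cat // => /andP[_].
rewrite eqseq_cons /= (matrix_mkseq He) (matrix_mkseq He').
rewrite eqseq_cat ?size_mkseq // => /andP[/eqP EM /eqP Ek]; split=> //.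
  move=> i j Hi Hj; have Hij : i * n + j < n * n by nia.
  have := congr1 (nth false ^~ (i * n + j)) EM; rewrite !nth_mkseq //.
  by rewrite divnMDl ?modnMDl ?divn_small ?modn_small ?addn0 //; lia.
by rewrite -(nat_bitsK k) Ek nat_bitsK.
Qed.

(** * Numbering the vertices of the glued graph *)

Section Numbering.
Variables (F : sgraph) (a b : F) (N : nat) (conf : nat -> nat -> bool).
Hypothesis N0 : 0 < N.

Let g := #|F|.
Let Fn (p : nat) : F := nth a (enum F) p.
Let H : rel 'I_N := fun i j => conf i j.

Definition gsize : nat := N + N * N * g.

(** The graph [F] does not depend on the input, so its structure enters the computation as constant
    tables. *)
Definition inn_tab : seq nat := mkseq (fun p => inner a b (Fn p) : nat) g.
Definition edge_tab : seq nat :=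
  mkseq (fun r => edge (Fn (r %/ g)) (Fn (r %% g)) : nat) (g * g).
Definition left_tab : seq nat := mkseq (fun p => edge a (Fn p) : nat) g.
Definition right_tab : seq nat := mkseq (fun p => edge b (Fn p) : nat) g.

(** The clique comes first; vertex [p] of the gadget of [(i, j)] has the number
    [N + ((i * N + j) * g + p)], and these are its coordinates. *)
Definition gi (v : nat) := (v - N) %/ g %/ N.
Definition gj (v : nat) := (v - N) %/ g %% N.
Definition gf (v : nat) := (v - N) %% g.

Definition attached (u v : nat) : bool :=
  conf (gi v) (gj v) && ((nth 0 inn_tab (gf v) == 1) &&
   ((u == gi v) && (nth 0 left_tab (gf v) == 1) ||
    (u == gj v) && (nth 0 right_tab (gf v) == 1))).

(** [gedge] on numbers, written with operations that have computability rules. *)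
Definition adjacent (u v : nat) : bool :=
  (u < N) && ((v < N) && ~~ (u == v) || (N <= v) && attached u v) ||
  (N <= u) && ((v < N) && attached v u ||
     (N <= v) && (conf (gi u) (gj u) && ((nth 0 inn_tab (gf u) == 1) &&
       ((nth 0 inn_tab (gf v) == 1) && ((gi u == gi v) && ((gj u == gj v) &&
         (nth 0 edge_tab (gf u * g + gf v) == 1))))))).

Let i0 : 'I_N := Ordinal N0.

Definition gdec (u : nat) : gadget a b H :=
  if u < N then inl (insubd i0 u)
  else inr (insubd i0 (gi u), insubd i0 (gj u), Fn (gf u)).

Let g0 : 0 < g. Proof. by apply/card_gt0P; exists a. Qed.

Lemma gsplit u : N <= u -> u < gsize ->
  [/\ gi u < N, gj u < N, gf u < g & u = N + ((gi u * N + gj u) * g + gf u)].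
Proof.
move=> Hu; rewrite /gsize /gi /gj /gf => Hu'.
have Hq : (u - N) %/ g < N * N by rewrite ltn_divLR //; lia.
by rewrite ltn_divLR // !ltn_mod N0 g0 Hq -!divn_eq; split=> //; lia.
Qed.

Lemma Fn_inj p q : p < g -> q < g -> Fn p = Fn q -> p = q.
Proof.
rewrite /g cardE => Hp Hq /eqP; rewrite nth_uniq ?enum_uniq // => /eqP//.
Qed.

Lemma gdec_bij : bijective (fun u : 'I_gsize => gdec u).
Proof.
apply: inj_card_bij => [u v|]; last first.
  by rewrite card_sum !card_prod !card_ord.
have val_i p : p < N -> val (insubd i0 p) = p by move=> Hp; rewrite val_insubd Hp.
rewrite /gdec; case: ltnP => Hu; case: ltnP => Hv //= [].
  by move/(congr1 val); rewrite !val_i // => /val_inj.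
have [ui uj uf Eu] := gsplit Hu (ltn_ord u).
have [vi vj vf Ev] := gsplit Hv (ltn_ord v).
move=> /(congr1 val) Ei /(congr1 val) Ej /(Fn_inj uf vf) Ef.
by apply: val_inj; rewrite /= Eu Ev Ef; move: Ei Ej; rewrite !val_i // => -> ->.
Qed.

Lemma gdec_edge (u v : 'I_gsize) : edge (gdec u) (gdec v) = adjacent u v.
Proof.
have val_i p : p < N -> insubd i0 p = p :> nat by move=> Hp; rewrite val_insubd Hp.
have eq_i p q : p < N -> q < N -> (insubd i0 p == insubd i0 q) = (p == q).
  by move=> Hp Hq; rewrite -val_eqE /= !val_i.
have tab (f : nat -> bool) k p : p < k ->
    (nth 0 (mkseq (fun p => f p : nat) k) p == 1) = f p.
  by move=> Hp; rewrite nth_mkseq // eqb1.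
have att (x y : 'I_gsize) : x < N -> N <= y ->
    [&& H (insubd i0 (gi y)) (insubd i0 (gj y)), inner a b (Fn (gf y)) &
     (insubd i0 (x : nat) == insubd i0 (gi y)) && edge a (Fn (gf y))
     || (insubd i0 (x : nat) == insubd i0 (gj y)) && edge b (Fn (gf y))] = attached x y.
  move=> Hx Hy; have [yi yj yf _] := gsplit Hy (ltn_ord y).
  by rewrite /attached /H !val_i // !eq_i // !tab.
rewrite /gdec /adjacent; case: (ltnP u N) => Hu; case: (ltnP v N) => Hv /=;
  rewrite ?orbF.
- by rewrite eq_i.
- exact: att.
- exact: att.
have [ui uj uf _] := gsplit Hu (ltn_ord u).
have [vi vj vf _] := gsplit Hv (ltn_ord v).
rewrite /H !val_i // !eq_i // !tab //; last by rewrite -/(gf u) -/(gf v); nia.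
by rewrite divnMDl // modnMDl divn_small // modn_small // addn0.
Qed.

Lemma adjacent_sym : symmetric (fun u v : 'I_gsize => adjacent u v).
Proof. by move=> u v; rewrite -!gdec_edge edge_sym. Qed.

Lemma adjacent_irr : irreflexive (fun u v : 'I_gsize => adjacent u v).
Proof. by move=> u; rewrite -gdec_edge edge_irrefl. Qed.

Definition numbered : sgraph := SGraph adjacent_sym adjacent_irr.

End Numbering.

Definition iso_closed (cls : sgraph -> Prop) : Prop := forall (G H : sgraph) (f : G -> H),
  bijective f -> (forall x y, edge (f x) (f y) = edge x y) -> cls G -> cls H.

(** Membership only provides some graph with this code; since the encoding is injective, it has the
    same edges. *)
Lemma vertex_deletion_encode (F : sgraph) cls n (E : nat -> nat -> bool)
  (Es : symmetric (fun i j : 'I_n => E i j)) (Ei : irreflexive (fun i j : 'I_n => E i j)) k :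
  iso_closed cls -> 0 < k -> let G := SGraph Es Ei in
  cls G -> (vertex_deletion F cls (encode (fun i j : 'I_n => E i j) k) <-> deletable F G k).
Proof.
move=> Hcls k0 G HG; split=> [[n' [e' [es' [ei' [k' [Eenc Hc' k0' Hdel]]]]]]|Hdel].
  pose E' (i j : nat) := if insub i is Some i' then
    if insub j is Some j' then e' i' j' else false else false.
  have HE' (i j : 'I_n') : e' i j = E' i j by rewrite /E' !valK.
  have [En EE Ek] := encode_inj (E := E) (fun _ _ => erefl) HE' Eenc.
  subst n' k'; apply: (@deletable_iso (SGraph es' ei') G id) Hdel; first by exists id.
  by move=> x y /=; rewrite EE ?HE'.
by exists n, (fun i j : 'I_n => E i j), Es, Ei, k.
Qed.

(** * The reduction as a computable function *)

Section Reduction.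
Variables (F : sgraph) (a b : F) (cls : sgraph -> Prop).
Variables (m : seq bool -> nat) (w : nat).
Variables (var : seq bool -> nat -> nat -> nat) (sgn : seq bool -> nat -> nat -> bool).
Hypotheses (Fab : edge a b) (HF : biconnected F) (ncF : ~ complete F).
Hypotheses (w2 : 1 < w) (m0 : forall x, 0 < m x).
Hypothesis cm : computable (fun x _ => m x).
Hypothesis cvar : computable (fun x e => var x (e 0) (e 1)).
Hypothesis csgn : computable (fun x e => sgn x (e 0) (e 1) : nat).
Hypothesis cls_iso : iso_closed cls.
Hypothesis cls_gadget : forall N (H : rel 'I_N), irreflexive H -> cls (gadget a b H).

Let N x := m x * w.
Let conf x := conflict w (var x) (sgn x).
Let k x := N x - m x.

Let adj x := adjacent a b (N x) (conf x).
Let n x := gsize F (N x).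

Let bit x p : bool :=
  (p < n x) || (n x < p) &&
    ((p < (n x).+1 + n x * n x) && adj x ((p - (n x).+1) %/ n x) ((p - (n x).+1) %% n x) ||
     ~~ (p < (n x).+1 + n x * n x) &&
       (iter (p - ((n x).+1 + n x * n x)) half (k x) %% 2 == 1)).

Let len x := (n x).+1 + n x * n x + csum (k x) (fun j => 0 < iter j half (k x)).

Ltac comp_fun := first
  [ comp1
  | simple apply cm
  | refine (@computable2 var _ _ cvar _ _)
  | refine (@computable2 (fun x u v => sgn x u v : nat) _ _ csgn _ _) ]; cbv beta.

Let cN : computable (fun x _ => N x).
Proof. by rewrite /N; repeat comp_fun. Qed.

Let ck : computable (fun x _ => k x).
Proof. by rewrite /k /N; repeat comp_fun. Qed.

Let cn : computable (fun x _ => n x).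
Proof. by rewrite /n /gsize /N; repeat comp_fun. Qed.

Let cconf : computable (fun x e => conf x (e 0) (e 1) : nat).
Proof. by rewrite /conf /conflict; repeat comp_fun. Qed.

Ltac comp_fun2 := first
  [ simple apply cN | simple apply cn | simple apply ck
  | refine (@computable2 (fun x u v => conf x u v : nat) _ _ cconf _ _)
  | comp1 ]; cbv beta.

Let catt : computable (fun x e => attached a b (N x) (conf x) (e 0) (e 1) : nat).
Proof. by rewrite /attached /gi /gj /gf; repeat comp_fun2. Qed.

Let cadj : computable (fun x e => adj x (e 0) (e 1) : nat).
Proof.
rewrite /adj /adjacent /gi /gj /gf; repeat first [
  refine (@computable2 (fun x u v => attached a b (N x) (conf x) u v : nat) _ _ catt _ _) | comp_fun2].
Qed.

Let cbit : computable (fun x e => bit x (e 0) : nat).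
Proof.
rewrite /bit; repeat first [
  refine (@computable2 (fun x u v => adj x u v : nat) _ _ cadj _ _) | comp_fun2].
Qed.

Let clen : computable (fun x _ => len x).
Proof. by rewrite /len; repeat comp_fun2. Qed.

Lemma reduces_satisfiable L :
  (forall x, L x <-> satisfiable (m x) w (var x) (sgn x)) ->
  reduces L (vertex_deletion F cls).
Proof.
move=> HL; exists (fun x => mkseq (bit x) (len x)); split.
  have := polytime_computable clen cbit.
  congr polytime_function; apply: functional_extensionality => x.
  by apply: eq_map => i /=; case: bit.
move=> x; have N0 : 0 < N x by rewrite /N muln_gt0 m0; lia.
(* Instances need a positive bound: [k] equals [m * (w - 1)], and clauses have more than one
   literal. *)
have k0 : 0 < k x by rewrite /k /N; have := m0 x; nia.
have -> : mkseq (bit x) (len x) = encode (fun i j : 'I_(n x) => adj x i j) (k x).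
  rewrite (encode_nth (E := adj x)) //; apply: eq_map => p; rewrite /bit.
  case: (ltngtP p (n x)) => //= Hp; case: ltnP => //= _; first by rewrite orbF.
  by rewrite modn2 eqb1.
pose H : rel 'I_(N x) := fun i j => conf x i j.
have irrH : irreflexive H by move=> i; rewrite /H /conf /conflict eqxx /= andbN andbF.
set G := numbered a b (conf x) N0.
pose dec (u : G) : gadget a b H := gdec a b (conf x) N0 u.
have dec_bij : bijective dec := gdec_bij a b (conf x) N0.
have dec_edge (u v : G) : edge (dec u) (dec v) = edge u v by apply: gdec_edge.
have [enc decK encK] := dec_bij.
have enc_bij : bijective enc by exists dec.
have enc_edge (u v : gadget a b H) : edge (enc u) (enc v) = edge u v.
  by rewrite -dec_edge !encK.
rewrite (@vertex_deletion_encode F cls (n x) (adj x)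
  (@adjacent_sym F a b (N x) (conf x) N0)
  (@adjacent_irr F a b (N x) (conf x) N0) (k x) cls_iso k0); last first.
  exact: cls_iso enc_bij enc_edge (cls_gadget irrH).
rewrite HL satisfiable_vertex_cover; last by lia.
split=> [/(vertex_cover_deletable Fab HF ncF)|Hd].
  exact: (deletable_iso enc_bij enc_edge).
apply: (@deletable_vertex_cover F a b (N x) H) => //.
exact: (deletable_iso dec_bij dec_edge Hd).
Qed.
End Reduction.

(** * Computations as satisfying assignments *)

Lemma nth_pair_enc (T : Type) (f : bool -> T) (u : T) x y j :
  nth u (map f (pair_enc x y)) j =
  if j < 2 * size x then f (nth false x (j %/ 2)) else
  if j == 2 * size x then f false else
  if j == (2 * size x).+1 then f true else nth u (map f y) (j - (2 * size x).+2).
Proof.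
elim: x j => [|b x IH] j.
  by case: j => [|[|j]] //=; rewrite !subSS subn0.
have -> : pair_enc (b :: x) y = b :: b :: pair_enc x y by [].
have -> : size (b :: x) = (size x).+1 by [].
rewrite (_ : 2 * (size x).+1 = (2 * size x).+2); last by lia.
case: j => [|[|j]] //=; rewrite IH !ltnS !eqSS !subSS.
by rewrite (_ : j.+2 %/ 2 = (j %/ 2).+1) //; lia.
Qed.

Lemma size_pair_enc x y : size (pair_enc x y) = 2 * size x + 2 + size y.
Proof. elim: x => //= b x IH; rewrite [size _]IH; lia. Qed.

Section Cells.
Variables (M : machine) (C : nat).

(* The contents of a tape, read off with the head at position [C]. *)
Definition cell (t : tape (symb M)) (z : nat) : symb M :=
  if z < C then nth (blank M) (tleft t) (C.-1 - z)
  else nth (blank M) (Defs.thead t :: tright t) (z - C).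

(** The tape shifts under a head fixed at [C]: the written symbol ends up just left of [C] after a
    move to the right, and just right of [C] after a move to the left. *)
Lemma cell_act a mv t z : 0 < z -> cell (tape_act (a, mv) t) z =
  match mv with
  | Stay => if z == C then a else cell t z
  | MoveL => if z == C.+1 then a else cell t z.-1
  | MoveR => if z.+1 == C then a else cell t z.+1
  end.
Proof.
case: z => // z _; case: t => l h r; case: mv; rewrite /cell.
- have -> : tape_act (a, MoveL) (Tape l h r) = Tape (behead l) (head (blank M) l) (a :: r).
    by case: l.
  cbn [tleft tright Defs.thead]; rewrite [z.+1.-1]/= eqSS nth_behead.
  case: (ltngtP z.+1 C) => Hz.
  + rewrite (_ : (z == C) = false); last by lia.
    by rewrite (_ : (C.-1 - z.+1).+1 = C.-1 - z) //; lia.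
  + case: eqP => [->|ne]; first by rewrite subSnn.
    rewrite (_ : z.+1 - C = (z - C.+1).+2); last by lia.
    by rewrite (_ : z - C = (z - C.+1).+1) //; lia.
  + rewrite -Hz subnn (_ : (z == z.+1) = false); last by lia.
    by rewrite /= subnn nth0.
- have -> : tape_act (a, MoveR) (Tape l h r) = Tape (a :: l) (head (blank M) r) (behead r).
    by case: r.
  cbn [tleft tright Defs.thead].
  case: (ltngtP z.+2 C) => Hz.
  + by rewrite (_ : C.-1 - z.+1 = (C.-1 - z.+2).+1) //; lia.
  + rewrite (_ : z.+2 - C = (z.+1 - C).+1); last by lia.
    by case: (z.+1 - C) => [|n] /=; rewrite ?nth0 ?nth_behead.
  + by rewrite (_ : C.-1 - z.+1 = 0) //; lia.
- cbn [tape_act tleft tright Defs.thead]; case: (ltngtP z.+1 C) => Hz //.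
    by rewrite (_ : z.+1 - C = (z.+1 - C.+1).+1) //; lia.
  by rewrite Hz subnn.
Qed.

Lemma cell_init s z : cell (tape_of s) z =
  if z < C then blank M else nth (blank M) s (z - C).
Proof.
rewrite /cell; case: s => [|a s] /=; rewrite !nth_nil //.
by case: ltnP => // _; case: (z - C) => //= n; rewrite !nth_nil.
Qed.

Definition column : finType := (state M * {ffun 'I_(work M).+1 -> symb M})%type.

Definition col (cf : config M) (z : nat) : column :=
  (cstate cf, [ffun i => cell (ctapes cf i) z]).

(* [zc] tells the position of the cell relative to the head: 0, 1, 2 for left
   neighbour, head, right neighbour, and 3 otherwise. *)
Definition next_col (zc : nat) (l c r h : column) : column :=
  if halt h.1 then c else
  let: (q, am) := trans h.1 h.2 in
  (q, [ffun i => match (am i).2 with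
       | Stay => if zc == 1 then (am i).1 else c.2 i
       | MoveL => if zc == 2 then (am i).1 else l.2 i
       | MoveR => if zc == 0 then (am i).1 else r.2 i
       end]).

Definition zclass (z : nat) : nat :=
  cif (z.+1 == C) 0 (cif (z == C) 1 (cif (z == C.+1) 2 3)).

Lemma col_step cf z : 0 < z ->
  col (step cf) z = next_col (zclass z) (col cf z.-1) (col cf z) (col cf z.+1) (col cf C).
Proof.
move=> z0; rewrite /step /next_col /=; case: (halt _) => //.
have -> : [ffun i => cell (ctapes cf i) C] = [ffun i => Defs.thead (ctapes cf i)].
  by apply/ffunP => i; rewrite !ffunE /cell ltnn subnn.
case: (trans _ _) => q am; rewrite /col /=; congr pair; apply/ffunP => i.
rewrite !ffunE; case: (am i) => a mv; rewrite cell_act //=.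
have zc : ((zclass z == 0) = (z.+1 == C)) /\ ((zclass z == 1) = (z == C)) /\
    ((zclass z == 2) = (z == C.+1)).
  rewrite /zclass /cif.
  by case: (z.+1 =P C); case: (z =P C); case: (z =P C.+1) => /= *; lia.
have [-> [-> ->]] := zc.
by case: mv.
Qed.

Definition start_col (s : symb M) : column :=
  (start M, [ffun i => if i == ord0 then s else blank M]).

Lemma col_init w z : col (init M w) z =
  start_col (if z < C then blank M else nth (blank M) (map (@bit M) w) (z - C)).
Proof.
rewrite /col /start_col /=; congr pair; apply/ffunP => i; rewrite !ffunE.
case: eqP => _; first exact: cell_init.
by rewrite (cell_init [::]) nth_nil if_same.
Qed.

End Cells.

Lemma poly_bound_mono c d m n : m <= n -> poly_bound c d m <= poly_bound c d n.
Proof.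
move=> le; rewrite /poly_bound leq_add2r leq_mul2l.
by case: d => [|d]; rewrite ?leqnn ?orbT // leq_exp2r // le orbT.
Qed.

Lemma run_halted M w t t' : t <= t' -> halt (cstate (run M t w)) ->
  run M t' w = run M t w.
Proof.
move=> /subnK <-; rewrite /run iterD; move: (t' - t) => k Hh.
by elim: k => //= k ->; rewrite /step Hh.
Qed.

Lemma zclass_lt C z : zclass C z < 4.
Proof. by rewrite /zclass /cif; do ?case: ifP. Qed.

(** * The clauses that describe a run of the verifier *)

Section Tableau.
Variables (M : machine) (qc qd tc td : nat).

(** [L] is the length of the part of [pair_enc x y] before [y], and [W] bounds the whole length.
    Ignorance about the cells beyond the border spreads by one cell per step, so the margins in [C]
    and [P] keep it away from the head cell for [T] steps. *)
Let q (x : seq bool) := poly_bound qc qd (size x).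
Let L (x : seq bool) := 2 * size x + 2.
Let W x := L x + q x.
Let T x := poly_bound tc td (W x).
Let C x := (T x).+1.
Let P x := C x + W x + T x + 2.

Let dom := column M.
Let d := #|dom|.
Let col0 : dom := start_col (blank M).
Definition code (a : dom) : nat := index a (enum dom).
Definition uncode (k : nat) : dom := nth col0 (enum dom) k.

Lemma codeK : cancel code uncode.
Proof. by move=> a; rewrite /uncode nth_index ?mem_enum. Qed.

Lemma code_lt a : code a < d.
Proof. by rewrite /d cardE index_mem mem_enum. Qed.

Let d0 : 0 < d. Proof. by apply: leq_ltn_trans (code_lt col0). Qed.

Let e4 := d * d * d * d.

Let bc (b : bool) := code (start_col (bit M b)).
Let bB := code (start_col (blank M)).

(* Clause [c] stands for a kind [ck], a cell [cz] and four columns.  Kinds below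
   [T x] are the steps at that time, kind [T x] sets up the initial columns, kind
   [T x + 1] makes the blanks behind the certificate contiguous and kind [T x + 2]
   forbids rejection.  Superfluous clauses are tautologies on variable 0. *)
Let ck x c := c %/ e4 %/ P x.
Let cz x c := c %/ e4 %% P x.
Let cs c := c %% e4.
Let s0 c := cs c %% d.
Let s1 c := cs c %/ d %% d.
Let s2 c := cs c %/ d %/ d %% d.
Let s3 c := cs c %/ d %/ d %/ d.

(** The machine is fixed, so its local rule is a constant table over the class of a cell and the
    codes of four columns. *)
Definition next_tab : seq nat := mkseq (fun r =>
  let s := r %% e4 in
  code (next_col (r %/ e4) (uncode (s %% d)) (uncode (s %/ d %% d))
    (uncode (s %/ d %/ d %% d)) (uncode (s %/ d %/ d %/ d)))) (4 * e4).

Definition reject_tab : seq nat := mkseq (fun k => ~~ accept (uncode k).1 : nat) d.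

(* The variable saying that at time [t] cell [z] carries column [a]. *)
Let vid x t z a := (t * P x + z) * d + a.

Let inner_cell x z := (0 < z) && (z.+1 < P x).
Let free_cell x z := (C x + L x <= z) && (z.+1 < C x + W x).

Definition cl_num x := ((T x).+3 * P x) * e4.

(** For an inner cell the clause is an implication: literals 0 to 3 negate the columns of the left
    neighbour, the cell, the right neighbour and the head, and literal 4 asserts the successor
    column. *)
Definition trans_var x c l :=
  cif (inner_cell x (cz x c))
    (cif (l == 0) (vid x (ck x c) (cz x c).-1 (s0 c))
    (cif (l == 1) (vid x (ck x c) (cz x c) (s1 c))
    (cif (l == 2) (vid x (ck x c) (cz x c).+1 (s2 c))
    (cif (l == 3) (vid x (ck x c) (C x) (s3 c))
       (vid x (ck x c).+1 (cz x c)
          (nth 0 next_tab (zclass (C x) (cz x c) * e4 + cs c)))))))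
    0.

Definition input_code x j :=
  cif (j < 2 * size x) (cif (inp x (j %/ 2) == 2) (bc true) (bc false))
    (cif (j == 2 * size x) (bc false) (bc true)).

(** On cells reserved for the certificate the clause offers the two bits and the blank; on all other
    cells its literals coincide. *)
Definition init_var x c l :=
  vid x 0 (cz x c)
    (cif ((cz x c < C x) || (C x + W x <= cz x c)) bB
    (cif (cz x c < C x + L x) (input_code x (cz x c - C x))
    (cif (l == 0) (bc false) (cif (l == 1) (bc true) bB)))).

Definition blank_var x c l :=
  cif (free_cell x (cz x c))
    (vid x 0 (cif (l == 0) (cz x c) (cz x c).+1) bB) 0.

Definition accept_var x c :=
  cif (nth 0 reject_tab (s0 c) == 1) (vid x (T x) (C x) (s0 c)) 0.

Definition cl_var x c l :=
  cif (ck x c < T x) (trans_var x c l)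
  (cif (ck x c == T x) (init_var x c l)
  (cif (ck x c == (T x).+1) (blank_var x c l) (accept_var x c))).

Definition cl_sgn x c l : bool :=
  (ck x c < T x) && (~~ (l < 4) || ~~ inner_cell x (cz x c) && (l == 0)) ||
  (ck x c == T x) ||
  ((ck x c == (T x).+1) && (0 < l)) ||
  ((T x).+1 < ck x c) && (~~ (nth 0 reject_tab (s0 c) == 1) && (l == 0)).

Lemma computable_cl_num : computable (fun x _ => cl_num x).
Proof. by rewrite /cl_num /P /C /T /W /L /q /poly_bound; comp. Qed.

Lemma computable_cl_var : computable (fun x e => cl_var x (e 0) (e 1)).
Proof.
rewrite /cl_var /trans_var /init_var /blank_var /accept_var /input_code
  /inner_cell /free_cell /vid /zclass /ck /cz /s0 /s1 /s2 /s3 /cs /P /C /T /W /L /q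
  /poly_bound.
by comp.
Qed.

Lemma computable_cl_sgn : computable (fun x e => cl_sgn x (e 0) (e 1) : nat).
Proof.
rewrite /cl_sgn /inner_cell /ck /cz /s0 /cs /P /C /T /W /L /q /poly_bound.
by comp.
Qed.

Lemma cl_num_gt0 x : 0 < cl_num x.
Proof. by rewrite /cl_num /e4 !muln_gt0 d0 /P; lia. Qed.

Section Input.
Variable x : seq bool.

Let cl k z a b c h := (k * P x + z) * e4 + (((h * d + c) * d + b) * d + a).

Lemma quad_lt a b c h : a < d -> b < d -> c < d -> h < d ->
  ((h * d + c) * d + b) * d + a < e4.
Proof.
have mul_lt u v n : u < n -> v < d -> u * d + v < n * d by nia.
by move=> Ha Hb Hc Hh; do 3 apply: (mul_lt) => //.
Qed.

Lemma quadE a b c h : a < d -> b < d -> c < d ->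
  let s := ((h * d + c) * d + b) * d + a in
  [/\ s %% d = a, s %/ d %% d = b, s %/ d %/ d %% d = c & s %/ d %/ d %/ d = h].
Proof.
have divE u v : v < d -> (u * d + v) %/ d = u.
  by move=> Hv; rewrite divnMDl // divn_small // addn0.
have modE u v : v < d -> (u * d + v) %% d = v by move=> Hv; rewrite modnMDl modn_small.
by move=> Ha Hb Hc s; rewrite /s !divE // !modE.
Qed.

Lemma clP k z a b c h : k < (T x).+3 -> z < P x ->
  a < d -> b < d -> c < d -> h < d -> let i := cl k z a b c h in
  [/\ i < cl_num x, ck x i = k /\ cz x i = z & [/\ s0 i = a, s1 i = b, s2 i = c & s3 i = h]].
Proof.
move=> Hk Hz Ha Hb Hc Hh i.
have Hs := quad_lt Ha Hb Hc Hh.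
have e0 : 0 < e4 by rewrite /e4 !muln_gt0 d0.
have P0 : 0 < P x by rewrite /P; lia.
have Ekz : i %/ e4 = k * P x + z by rewrite /i /cl divnMDl // divn_small // addn0.
have Es : cs i = ((h * d + c) * d + b) * d + a by rewrite /cs /i /cl modnMDl modn_small.
split; first by rewrite /cl_num /i /cl; nia.
  by rewrite /ck /cz Ekz divnMDl // modnMDl divn_small // modn_small ?addn0.
by rewrite /s0 /s1 /s2 /s3 Es; apply: quadE.
Qed.

Lemma next_tabE zc a b c h : zc < 4 -> a < d -> b < d -> c < d -> h < d ->
  nth 0 next_tab (zc * e4 + (((h * d + c) * d + b) * d + a)) =
  code (next_col zc (uncode a) (uncode b) (uncode c) (uncode h)).
Proof.
move=> Hz Ha Hb Hc Hh; have Hs := quad_lt Ha Hb Hc Hh.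
rewrite /next_tab nth_mkseq; last by nia.
have e0 : 0 < e4 by rewrite /e4 !muln_gt0 d0.
rewrite divnMDl // modnMDl (divn_small Hs) (modn_small Hs) addn0.
by have [-> -> -> ->] := quadE h Ha Hb Hc.
Qed.

Lemma cl_decode i : i < cl_num x ->
  [/\ ck x i < (T x).+3, cz x i < P x, s0 i < d /\ s1 i < d, s2 i < d /\ s3 i < d &
      cs i = ((s3 i * d + s2 i) * d + s1 i) * d + s0 i].
Proof.
move=> Hi; have P0 : 0 < P x by rewrite /P; lia.
have e0 : 0 < e4 by rewrite /e4 !muln_gt0 d0.
split; rewrite ?ltn_mod ?d0 //.
- by rewrite /ck !ltn_divLR // mulnAC -/(cl_num x) mulnAC.
- split=> //; rewrite /s3 !ltn_divLR //; exact: ltn_pmod.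
- by rewrite /s0 /s1 /s2 /s3 -!divn_eq.
Qed.

Lemma input_codeE y j : j < L x -> input_code x j =
  code (start_col (nth (blank M) (map (@bit M) (pair_enc x y)) j)).
Proof.
rewrite /L => Hj; rewrite nth_pair_enc /input_code /cif.
case: ltnP => H1.
  have Hj2 : j %/ 2 < size x by lia.
  by rewrite /inp (nth_map false) //= eqSS eqb1; case: (nth _ _ _).
case: eqP => // H2; rewrite ifT //; lia.
Qed.

Let bitX y j : L x <= j -> nth (blank M) (map (@bit M) (pair_enc x y)) j =
  nth (blank M) (map (@bit M) y) (j - L x).
Proof.
rewrite /L => Hj; rewrite nth_pair_enc.
by do ![rewrite ifF; last by lia]; congr nth; lia.
Qed.

Section Run.
Variable y : seq bool.
Hypothesis Hy : size y <= q x.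

Let cf t := run M t (pair_enc x y).
Let X t z := col (C x) (cf t) z.

Let X0 z : X 0 z = start_col (if z < C x then blank M
   else nth (blank M) (map (@bit M) (pair_enc x y)) (z - C x)).
Proof. exact: col_init. Qed.

Let XS t z : 0 < z ->
  X t.+1 z = next_col (zclass (C x) z) (X t z.-1) (X t z) (X t z.+1) (X t (C x)).
Proof. by move=> z0; rewrite /X /cf /run iterS col_step. Qed.

Lemma run_satisfies : accept (cstate (cf (T x))) ->
  satisfiable (cl_num x) 5 (cl_var x) (cl_sgn x).
Proof.
move=> Hacc.
pose A v := code (X (v %/ d %/ P x) (v %/ d %% P x)) == v %% d.
have P0 : 0 < P x by rewrite /P; lia.
have AE t z a : z < P x -> a < d -> A (vid x t z a) = (code (X t z) == a).
  move=> Hz Ha; rewrite /A /vid.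
  by rewrite !divnMDl // (divn_small Ha) addn0 divnMDl // !modnMDl (divn_small Hz)
     (modn_small Ha) (modn_small Hz) addn0.
have CP : C x < P x by rewrite /P; lia.
exists A => i /cl_decode[Hk Hz [Ha Hb] [Hc Hh] Es].
rewrite /cl_var /cl_sgn; case: (ltngtP (ck x i) (T x)) => HkT.
- have -> : (ck x i == (T x).+1) = false by lia.
  have -> : ((T x).+1 < ck x i) = false by lia.
  rewrite /cif /trans_var; case Hin: (inner_cell x (cz x i)); rewrite /cif /=; last first.
    by case EA : (A 0); [exists 0 | exists 1].
  have /andP[z0 zP] := Hin; have Ht := XS (ck x i) z0.
  case E0 : (code (X (ck x i) (cz x i).-1) == s0 i); last first.
    by exists 0; rewrite //= AE //; lia.
  case E1 : (code (X (ck x i) (cz x i)) == s1 i); last first.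
    by exists 1; rewrite //= AE.
  case E2 : (code (X (ck x i) (cz x i).+1) == s2 i); last first.
    by exists 2; rewrite //= AE.
  case E3 : (code (X (ck x i) (C x)) == s3 i); last first.
    by exists 3; rewrite //= AE.
  exists 4 => //=; rewrite Es next_tabE ?zclass_lt // AE ?code_lt //.
  move: E0 E1 E2 E3 => /eqP<- /eqP<- /eqP<- /eqP<-; rewrite !codeK Ht.
  exact: eqxx.
- have -> : (ck x i == (T x).+1) = (ck x i == (T x).+1) && true by rewrite andbT.
  case: (ltngtP (ck x i) (T x).+1) => HkT1; rewrite /cif /=; first by lia.
    rewrite /accept_var /reject_tab nth_mkseq // eqb1.
    case: (boolP (accept (uncode (s0 i)).1)) => Ha'; rewrite /cif /=.
      by case EA : (A 0); [exists 0 | exists 1].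
    exists 0; rewrite //= AE //; apply/negP => /eqP EX.
    by move: Ha'; rewrite -EX codeK Hacc.
  rewrite /blank_var; case Hf: (free_cell x (cz x i)); rewrite /cif /=; last first.
    by case EA : (A 0); [exists 1 | exists 0].
  have /andP[zC zW] := Hf.
  case E0 : (code (X 0 (cz x i)) == bB); last by exists 0; rewrite //= AE // code_lt.
  exists 1; rewrite //= AE ?code_lt //; last by move: zW; rewrite /P; lia.
  rewrite X0 ifF; last by lia.
  (* No bit is represented by the blank, so a blank cell lies behind the end of [y]. *)
  have Hj : size y <= cz x i - C x - L x.
    move: E0; rewrite X0 ifF; last by lia.
    rewrite bitX; last by lia.
    move=> /eqP/(can_inj codeK)/(congr1 (fun a : dom => a.2 ord0)); rewrite !ffunE eqxx.
    case: leqP => // Hj; rewrite (nth_map false) // => E.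
    have := @bit_blank M (nth false y (cz x i - C x - L x)).
    by rewrite E eqxx.
  rewrite bitX; last by lia.
  by rewrite nth_default ?size_map ?eqxx //; lia.
- rewrite /cif /= /init_var.
  case Hb0 : ((cz x i < C x) || (C x + W x <= cz x i)); rewrite /cif /=.
    exists 0; rewrite ?orbT //= AE ?code_lt // X0; apply/eqP; congr (code (start_col _)).
    case: ifP => // H1; rewrite nth_default // size_map size_pair_enc.
    by move: Hb0; rewrite H1 /= /W /L; lia.
  have HC : (cz x i < C x) = false by lia.
  case: ltnP => HL.
    exists 0; rewrite ?orbT //= (@input_codeE y); last by lia.
    by rewrite AE ?code_lt // X0 HC eqxx.
  have HX : X 0 (cz x i) = start_col (nth (blank M) (map (@bit M) y) (cz x i - C x - L x)).
    by rewrite X0 HC bitX //; lia.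
  case: (ltnP (cz x i - C x - L x) (size y)) => Hj.
    case Eb : (nth false y (cz x i - C x - L x)); [exists 1|exists 0];
      by rewrite ?orbT //= AE ?code_lt // HX (nth_map false) // Eb eqxx.
  by exists 2; rewrite ?orbT //= AE ?code_lt // HX nth_default ?size_map // eqxx.
Qed.

End Run.

(** The assignment may be true on more than one column of a cell. A certificate is read off from it,
    and the variables describing the resulting run are then shown to be among the true ones. *)
Lemma satisfies_run : satisfiable (cl_num x) 5 (cl_var x) (cl_sgn x) ->
  exists y, size y <= q x /\ accept (cstate (run M (T x) (pair_enc x y))).
Proof.
move=> [A HA].
have P0 : 0 < P x by rewrite /P; lia.
have CP : C x < P x by rewrite /P; lia.
have cBd : bB < d by apply: code_lt.
pose y0 j := A (vid x 0 (C x + L x + j) (bc false)).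
pose y1 j := A (vid x 0 (C x + L x + j) (bc true)).
(* The certificate ends at the first cell carrying neither bit: this cell must be blank, and blanks
   propagate to the right. If both bits are offered, [y1] decides. *)
pose len := cfind (q x) (fun j => ~~ (y0 j || y1 j)).
pose y := mkseq y1 len.
have Hlen : len <= q x by rewrite -[q x](size_iota 0) find_size.
exists y; rewrite size_mkseq; split=> //.
pose X t z := col (C x) (run M t (pair_enc x y)) z.
have X0 z : X 0 z = start_col (if z < C x then blank M
   else nth (blank M) (map (@bit M) (pair_enc x y)) (z - C x)) by apply: col_init.
have init_cl z : z < P x -> exists2 l, l < 5 &
    A (vid x 0 z (cif ((z < C x) || (C x + W x <= z)) bB
    (cif (z < C x + L x) (input_code x (z - C x))
    (cif (l == 0) (bc false) (cif (l == 1) (bc true) bB))))).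
  move=> Hz; have [|Hi [Ek Ez] _] := @clP (T x) z 0 0 0 0 _ Hz d0 d0 d0 d0; first by lia.
  have [l Hl] := HA _ Hi; rewrite /cl_var /cl_sgn /init_var Ek Ez ltnn eqxx orbT /= => E.
  by exists l => //; rewrite E.
have blank_step z : free_cell x z -> A (vid x 0 z bB) -> A (vid x 0 z.+1 bB).
  move=> Hf Hz; have /andP[_ Hz'] := Hf.
  have [||Hi [Ek Ez] _] := @clP (T x).+1 z 0 0 0 0 _ _ d0 d0 d0 d0; first by lia.
    by move: Hz'; rewrite /P; lia.
  have [l Hl] := HA _ Hi; rewrite /cl_var /cl_sgn /blank_var Ek Ez Hf.
  have -> : ((T x).+1 < T x) = false by lia.
  have -> : ((T x).+1 == T x) = false by lia.
  rewrite eqxx ltnn /= orbF /cif; case: eqP => [->|/eqP]; first by rewrite Hz.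
  by case: l {Hl} => // l _ ->.
have free_cl j : j < q x -> [|| y0 j, y1 j | A (vid x 0 (C x + L x + j) bB)].
  move=> Hj; have [|l Hl] := init_cl (C x + L x + j); first by rewrite /P /W; lia.
  have -> : (C x + L x + j < C x) = false by lia.
  have -> : (C x + W x <= C x + L x + j) = false by rewrite /W; lia.
  have -> : (C x + L x + j < C x + L x) = false by lia.
  rewrite /cif /=; case: eqP => _; first by move=> ?; rewrite /y0; apply/orP; left.
  by case: eqP => _ ?; rewrite /y1 /y0; apply/or3P; [apply: Or32 | apply: Or33].
have tailB j : len <= j < q x -> A (vid x 0 (C x + L x + j) bB).
  elim: j => [|j IH] /andP[Hj Hq].
    have := free_cl _ Hq; have E : len = 0 by lia.
    have /(nth_find 0) : has (fun j => ~~ (y0 j || y1 j)) (iota 0 (q x)).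
      by rewrite has_find size_iota -/(cfind _ _) -/len E.
    by rewrite -/(cfind _ _) -/len E nth_iota // negb_or => /andP[/negbTE-> /negbTE->].
  case: (ltnP j len) => Hjl; last first.
    have -> : C x + L x + j.+1 = (C x + L x + j).+1 by lia.
    apply: blank_step; first by rewrite /free_cell /W; lia.
    by apply: IH; lia.
  have E : len = j.+1 by lia.
  have := free_cl _ Hq.
  have /(nth_find 0) : has (fun j => ~~ (y0 j || y1 j)) (iota 0 (q x)).
    by rewrite has_find size_iota -/(cfind _ _) -/len E.
  by rewrite -/(cfind _ _) -/len E nth_iota // add0n negb_or => /andP[/negbTE-> /negbTE->].
have HX0 z : z < P x -> A (vid x 0 z (code (X 0 z))).
  move=> Hz; have [l Hl] := init_cl z Hz; rewrite X0.
  case: (ltnP z (C x)) => HzC /=; first by [].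
  case: (leqP (C x + W x) z) => HzW /=.
    rewrite nth_default // size_map size_pair_enc size_mkseq.
    by move: HzW; rewrite /W /L; lia.
  case: ltnP => HzL /=.
    by rewrite (@input_codeE y); [|lia].
  move=> _; rewrite bitX; last by lia.
  set j := z - C x - L x; have Ez : z = C x + L x + j by rewrite /j; lia.
  have Hjq : j < q x by move: HzW; rewrite /W /j; lia.
  case: (ltnP j len) => Hj; last first.
    rewrite nth_default; last by rewrite size_map size_mkseq.
    rewrite Ez; apply: tailB.
    by rewrite Hj.
  rewrite (nth_map false) ?size_mkseq // nth_mkseq //.
  have : y0 j || y1 j.
    have := before_find 0 (s := iota 0 (q x)) (a := fun j => ~~ (y0 j || y1 j)) (i := j) Hj.
    by rewrite nth_iota // add0n => /negbFE.
  by rewrite Ez; case: (boolP (y1 j)) => // _; rewrite orbF.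
(* Clauses at border cells are void, so at time [t] nothing is claimed about the outermost [t] cells
   on either side; the head cell is still covered at time [T x]. *)
have HX t z : t <= T x -> t <= z -> z < P x - t -> A (vid x t z (code (X t z))).
  elim: t z => [|t IH] z Ht H1 H2; first by apply: HX0; lia.
  have TC : T x < C x by [].
  have CPT : C x < P x - T x by rewrite /P; lia.
  have [||Hi [Ek Ez] [Ea Eb Ec Eh]] := @clP t z (code (X t z.-1)) (code (X t z))
     (code (X t z.+1)) (code (X t (C x))) _ _ (code_lt _) (code_lt _) (code_lt _) (code_lt _).
  - by lia.
  - by lia.
  have [l Hl] := HA _ Hi; rewrite /cl_var /cl_sgn Ek.
  have [-> -> -> ->] : [/\ t < T x, (t == T x) = false, (t == (T x).+1) = false &
    ((T x).+1 < t) = false] by split; lia.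
  rewrite {1}/cif /trans_var Ek Ez Ea Eb Ec Eh.
  have -> : inner_cell x z by rewrite /inner_cell; lia.
  rewrite {1}/cif /= !orbF.
  case: l Hl => [|[|[|[|[|l]]]]] // _; rewrite /cif /= ?IH //; try lia.
  have [_ _ _ _ Es] := cl_decode Hi.
  rewrite Es Ea Eb Ec Eh next_tabE ?code_lt ?zclass_lt // !codeK => H.
  have -> : X t.+1 z = next_col (zclass (C x) z) (X t z.-1) (X t z) (X t z.+1) (X t (C x)).
    by rewrite /X /run iterS col_step //; lia.
  by rewrite H.
have HXT : A (vid x (T x) (C x) (code (X (T x) (C x)))).
  by apply: HX; rewrite // /P /C; lia.
(* The clause against rejection for the column actually reached; its cell 0 is a dummy. *)
have [||Hi [Ek Ez] [Ea _ _ _]] := @clP (T x).+2 0 (code (X (T x) (C x))) 0 0 0 _ _ (code_lt _) d0 d0 d0.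
- by [].
- by [].
have [l Hl] := HA _ Hi; rewrite /cl_var /cl_sgn Ek.
have [-> -> -> ->] : [/\ ((T x).+2 < T x) = false, ((T x).+2 == T x) = false,
  ((T x).+2 == (T x).+1) = false & (T x).+1 < (T x).+2] by split; lia.
rewrite /cif /accept_var Ea /reject_tab nth_mkseq ?code_lt // codeK eqb1.
case: (boolP (accept _)) => // _; rewrite /cif /=.
by rewrite HXT.
Qed.

End Input.

Lemma satisfiable_tableau (V : language) :
  (forall w, let fin := run M (poly_bound tc td (size w)) w in
     halt (cstate fin) /\ (accept (cstate fin) <-> V w)) ->
  forall x, (exists y, size y <= poly_bound qc qd (size x) /\ V (pair_enc x y)) <->
    satisfiable (cl_num x) 5 (cl_var x) (cl_sgn x).
Proof.
move=> HM x.
have E y : size y <= q x -> accept (cstate (run M (T x) (pair_enc x y))) <-> V (pair_enc x y).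
  move=> Hy; have [Hh <-] := HM (pair_enc x y).
  (* [T x] allows for the longest certificate; a halted configuration does not change during the
     surplus time. *)
  rewrite (run_halted _ Hh) //; apply: poly_bound_mono.
  by rewrite size_pair_enc /W /L leq_add2l.
split=> [[y [Hy /(E y Hy)]]|/satisfies_run[y [Hy]]]; first exact: run_satisfies.
by move=> /(E y Hy); exists y.
Qed.

End Tableau.

(** * Membership in NP *)

Lemma cfind_eq s (P : nat -> bool) n : n < s -> P n -> (forall i, i < n -> ~~ P i) ->
  cfind s P = n.
Proof.
move=> Hn Pn Hlt; rewrite /cfind; have H : has P (iota 0 s).
  by apply/hasP; exists n; rewrite ?mem_iota.
have Hf := nth_find 0 H; move: H; rewrite has_find size_iota => Hs.
rewrite nth_iota // add0n in Hf.
case: (ltngtP (find P (iota 0 s)) n) => // Hc.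
  by have := Hlt _ Hc; rewrite Hf.
by have := before_find 0 Hc; rewrite nth_iota // add0n Pn.
Qed.

Lemma cfind_lt s (P : nat -> bool) : cfind s P < s ->
  P (cfind s P) /\ forall i, i < cfind s P -> ~~ P i.
Proof.
move=> Hs; have H : has P (iota 0 s) by rewrite has_find size_iota.
split; first by have := nth_find 0 H; rewrite nth_iota.
move=> i Hi; have := before_find 0 Hi; rewrite nth_iota ?add0n; first by move=> ->.
by apply: leq_trans Hi _; apply: ltnW.
Qed.

(** * Decoding the input *)

Section Decode.
Variables (s : nat) (X : nat -> bool).

Definition dec_n : nat := cfind s (fun i => ~~ X i).
Definition dec_edge (i j : nat) : bool := X (dec_n.+1 + (i * dec_n + j)).
Definition dec_len : nat := s - (dec_n.+1 + dec_n * dec_n).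
Definition dec_bit (i : nat) : bool := X (dec_n.+1 + dec_n * dec_n + i).
(** Horner's scheme from the most significant bit; capping every round gives the same as capping
    once at the end. *)
Definition dec_cap : nat := iteri dec_len
  (fun i y => minn (2 * y + dec_bit (dec_len - i.+1)) dec_n) 0.

(** Requiring the last bit to be 1 makes the binary notation canonical and the number positive. *)
Definition well_formed : bool :=
  (dec_n < s) && ((dec_n.+1 + dec_n * dec_n < s) && (dec_bit (dec_len.-1) &&
    call dec_n (fun i => ~~ dec_edge i i &&
      call dec_n (fun j => dec_edge i j ==> dec_edge j i)))).

End Decode.

Lemma dec_capE s X : dec_cap s X =
  minn (bits_val (mkseq (dec_bit s X) (dec_len s X))) (dec_n s X).
Proof.
rewrite /dec_cap; set r := dec_len s X; set b := dec_bit s X; set n := dec_n s X.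
suff H k : k <= r -> iteri k (fun i y => minn (2 * y + b (r - i.+1)) n) 0 =
    minn (bits_val [seq b i | i <- iota (r - k) k]) n.
  by rewrite H // subnn.
elim: k => [|k IH] Hk; first by rewrite min0n.
rewrite /= IH; last by lia.
rewrite /= (_ : (r - k.+1).+1 = r - k); last by lia.
move: (bits_val _) => v; case: (b _) => /=; lia.
Qed.

Section Correct.
Variable x : seq bool.
Let s := size x.
Let X := nth false x.

Lemma well_formed_encode n (e : rel 'I_n) k (Es : symmetric e) (Ei : irreflexive e) :
  0 < k -> x = encode e k ->
  [/\ well_formed s X, dec_n s X = n, forall i j : 'I_n, dec_edge s X i j = e i j &
      bits_val (mkseq (dec_bit s X) (dec_len s X)) = k].
Proof.
move=> k0 Ex.
pose E (i j : nat) :=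
  if insub i is Some i' then if insub j is Some j' then e i' j' else false else false.
have HE (i j : 'I_n) : e i j = E i j by rewrite /E !valK.
have Hx := encode_nth k HE; rewrite -Ex in Hx.
have Hs : s = n.+1 + n * n + nbits k by rewrite /s Hx size_mkseq.
have HX p : p < s -> X p =
    if p < n then true else if p == n then false else
    if p < n.+1 + n * n then E ((p - n.+1) %/ n) ((p - n.+1) %% n)
    else odd (iter (p - (n.+1 + n * n)) half k).
  by move=> Hp; rewrite /X Hx nth_mkseq // -Hs.
have Hn : dec_n s X = n.
  apply: cfind_eq => [||i Hi]; first by lia.
    by rewrite HX ?ltnn ?eqxx //; lia.
  by rewrite HX ?Hi //; lia.
have Hnb : nbits k = size (nat_bits k) by rewrite nat_bits_mkseq size_mkseq.
have Hlen : dec_len s X = nbits k by rewrite /dec_len Hn Hs; lia.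
have Hbits : mkseq (dec_bit s X) (dec_len s X) = nat_bits k.
  rewrite Hlen nat_bits_mkseq; apply/eq_in_map => i; rewrite mem_iota => Hi.
  rewrite /dec_bit Hn HX; last by lia.
  have [-> -> ->] : [/\ (n.+1 + n * n + i < n) = false, (n.+1 + n * n + i == n) = false &
    (n.+1 + n * n + i < n.+1 + n * n) = false] by split; lia.
  by rewrite addKn.
have Hedge (i j : 'I_n) : dec_edge s X i j = e i j.
  rewrite /dec_edge Hn HX; last by have := ltn_ord i; have := ltn_ord j; nia.
  have Hij : i * n + j < n * n by have := ltn_ord i; have := ltn_ord j; nia.
  have [-> -> ->] : [/\ (n.+1 + (i * n + j) < n) = false, (n.+1 + (i * n + j) == n) = false &
    n.+1 + (i * n + j) < n.+1 + n * n] by split; lia.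
  have n0 : 0 < n by have := ltn_ord i; lia.
  by rewrite addKn divnMDl // modnMDl divn_small // modn_small // addn0 HE.
split=> //; last by rewrite Hbits nat_bitsK.
have nb0 : 0 < nbits k.
  by have := last_nat_bits k; rewrite Hnb k0; case: (nat_bits k).
rewrite /well_formed Hn; apply/and4P; split; [by lia|by lia| |].
  have := last_nat_bits k; rewrite -Hbits k0 -nth_last size_mkseq nth_mkseq //.
  by rewrite Hlen; lia.
apply/callP => i Hi; apply/andP; split.
  by rewrite (Hedge (Ordinal Hi) (Ordinal Hi)) Ei.
apply/callP => j Hj; apply/implyP.
by rewrite (Hedge (Ordinal Hi) (Ordinal Hj)) (Hedge (Ordinal Hj) (Ordinal Hi)) Es.
Qed.

Lemma well_formed_decode : well_formed s X ->
  let n := dec_n s X in let e : rel 'I_n := fun i j => dec_edge s X i j in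
  let k := bits_val (mkseq (dec_bit s X) (dec_len s X)) in
  [/\ symmetric e, irreflexive e, 0 < k & x = encode e k].
Proof.
move=> /and4P[H1 H2 H3 /callP H4] n e k; rewrite -/n in H1 H2 H4.
have Hsym i j : i < n -> j < n -> dec_edge s X i j -> dec_edge s X j i.
  by move=> Hi Hj; have /andP[_ /callP/(_ j Hj)/implyP] := H4 i Hi.
have len0 : 0 < dec_len s X by rewrite /dec_len -/n subn_gt0.
have Hlast : last false (mkseq (dec_bit s X) (dec_len s X)).
  by rewrite -nth_last size_mkseq nth_mkseq //; lia.
have Hk : nat_bits k = mkseq (dec_bit s X) (dec_len s X) by rewrite bits_valK.
split.
- by move=> i j; apply/idP/idP; apply: Hsym.
- by move=> i; have /andP[/negbTE] := H4 i (ltn_ord i).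
- by rewrite -last_nat_bits Hk.
rewrite (encode_nth (E := dec_edge s X)) //.
have Hnb : nbits k = dec_len s X.
  by rewrite -(size_mkseq (dec_bit s X) (dec_len s X)) -Hk nat_bits_mkseq size_mkseq.
have Es : s = n.+1 + n * n + nbits k by rewrite Hnb /dec_len -/n; lia.
rewrite -Es; apply: (@eq_from_nth _ false) => [|p Hp]; first by rewrite size_mkseq.
rewrite nth_mkseq // -/(X p); have [Pn Hlt] := cfind_lt H1.
case: (ltngtP p n) => Hpn.
- by have := Hlt p Hpn; rewrite negbK.
- case: ltnP => Hp2.
    rewrite /dec_edge -/n -divn_eq; congr X; lia.
  have Hj : p - (n.+1 + n * n) < nbits k by lia.
  have := congr1 (nth false ^~ (p - (n.+1 + n * n))) Hk.
  rewrite nat_bits_mkseq nth_mkseq // nth_mkseq -?Hnb // => ->.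
  by rewrite /dec_bit -/n; congr X; lia.
- by rewrite Hpn; apply: negbTE Pn.
Qed.

End Correct.

(** * The verifier *)

Section Verifier.
Variable F : sgraph.
Let h := #|F|.

(* [e p] is the image of the [p]-th vertex of [F]. *)
Definition is_copy (E : nat -> nat -> bool) (Y : nat -> bool) (e : store) : bool :=
  all (fun p => ~~ Y (e p) && all (fun r => ((p != r) ==> ~~ (e p == e r)) &&
    (E (e p) (e r) == nth false (nth [::] [seq [seq edge f g | g <- enum F] | f <- enum F] p) r))
    (iota 0 h)) (iota 0 h).

(** Each of the [r] nested loops binds one variable; after [#|F|] of them the environment is a
    candidate placement of [F]. *)
Fixpoint no_copy (n : nat) E Y (r : nat) (e : store) : bool :=
  if r is r'.+1 then call n (fun v => no_copy n E Y r' (push v e)) else ~~ is_copy E Y e.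

Lemma no_copyP n E Y r e : reflect
  (forall l, size l = r -> all (fun v => v < n) l -> ~~ is_copy E Y (foldr push e l))
  (no_copy n E Y r e).
Proof.
elim: r e => [|r IH] e /=.
  by apply: (iffP idP) => [H [|//] _ _|/(_ [::] erefl isT)].
apply: (iffP (callP _ _)) => [H l|H v Hv].
  case/lastP: l => // l v; rewrite size_rcons => -[Hl].
  rewrite all_rcons foldr_rcons => /andP[Hv Hall].
  by have /IH/(_ l Hl Hall) := H v Hv.
apply/IH => l Hl Hall; have := H (rcons l v).
by rewrite size_rcons Hl all_rcons Hv Hall foldr_rcons; apply.
Qed.

Lemma foldr_push_nth e l p : p < size l -> foldr push e l p = nth 0 l p.
Proof. by elim: l p => // v l IH [|p] //= /IH. Qed.

Lemma no_copy_free n (E : nat -> nat -> bool) (Y : nat -> bool)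
  (Es : symmetric (fun i j : 'I_n => E i j)) (Ei : irreflexive (fun i j : 'I_n => E i j)) :
  let G := SGraph Es Ei in
  no_copy n E Y h env0 <->
  ~ contains_induced F (delete [set i : G | Y (i : 'I_n)]).
Proof.
move=> G; have szF : size (enum F) = h by rewrite /h cardE.
have tabE p r (f0 : F) : p < h -> r < h ->
    nth false (nth [::] [seq [seq edge f g | g <- enum F] | f <- enum F] p) r =
    edge (nth f0 (enum F) p) (nth f0 (enum F) r).
  by move=> Hp Hr; rewrite (nth_map f0) ?szF //= (nth_map f0) ?szF.
split=> [/no_copyP H /contains_deleteP[phi [[inj He] av]]|H].
  pose l := [seq (phi f : 'I_n) : nat | f <- enum F].
  have szl : size l = h by rewrite size_map szF.
  have := H l szl.
  have -> : all (fun v => v < n) l.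
    by apply/allP => _ /mapP[f _ ->]; apply: ltn_ord.
  move=> /(_ isT)/negP; apply; apply/allP => p; rewrite mem_iota /= => Hp.
  have f0 : F by case: (enum F) szF Hp => [|f0 _] //; rewrite /h => <-.
  have El r : r < h -> foldr push env0 l r = (phi (nth f0 (enum F) r) : 'I_n).
    by move=> Hr; rewrite foldr_push_nth ?szl // (nth_map f0) ?szF.
  apply/andP; split; first by have := av (nth f0 (enum F) p); rewrite inE El.
  apply/allP => r; rewrite mem_iota /= => Hr; rewrite !El // (tabE _ _ f0) // -He eqxx andbT.
  apply/implyP; apply: contra => /eqP/val_inj/inj/eqP.
  by rewrite nth_uniq ?enum_uniq ?szF.
apply/no_copyP => l Hl Hall; apply/negP => /allP Hc; apply: H; apply/contains_deleteP.
have lt (f : F) : nth 0 l (index f (enum F)) < n.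
  by apply: (allP Hall); rewrite mem_nth // Hl -szF index_mem mem_enum.
have idx (f : F) : index f (enum F) < h by rewrite -szF index_mem mem_enum.
pose phi f : G := Ordinal (lt f).
have Hpr (f g : F) : ~~ Y (phi f : 'I_n) /\
   (((f != g) ==> (phi f != phi g)) && (E (phi f : 'I_n) (phi g : 'I_n) == edge f g)).
  have Hf : index f (enum F) \in iota 0 h by rewrite mem_iota /= idx.
  have Hg : index g (enum F) \in iota 0 h by rewrite mem_iota /= idx.
  have /andP[H1 /allP/(_ _ Hg)] := Hc _ Hf.
  rewrite !foldr_push_nth ?Hl // in H1 *.
  rewrite (tabE _ _ f) // !nth_index ?mem_enum // => H2; split=> //.
  move: H2; rewrite -val_eqE /=; congr ((~~ _ ==> _) && _).
  by apply/eqP/eqP => [E1|->//]; rewrite -(nth_index f (mem_enum F f)) E1 nth_index ?mem_enum.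
exists phi; split; last by move=> f; rewrite inE; have [] := Hpr f f.
split=> [f g E1|f g]; last by have [_ /andP[_ /eqP]] := Hpr f g.
have [_ /andP[/implyP Hn _]] := Hpr f g; apply/eqP/contraT => /Hn.
by rewrite E1 eqxx.
Qed.

Variable chk : nat -> (nat -> nat -> bool) -> (nat -> bool) -> bool.

(** The first [n] bits of [Y] mark the deleted vertices; the certificate for the class follows
    them. *)
Definition verify (s : nat) (X Y : nat -> bool) : bool :=
  well_formed s X && ((csum (dec_n s X) (fun i => Y i) <= dec_cap s X) &&
    (no_copy (dec_n s X) (dec_edge s X) Y h env0 &&
     chk (dec_n s X) (dec_edge s X) (fun i => Y (dec_n s X + i)))).

Variable cls : sgraph -> Prop.
Hypothesis cls_iso : iso_closed cls.

(** Vanishing from [n ^ 4] on lets a finite string, read by [nth false], represent [Y]. *)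
Hypothesis chkP : forall n (E : nat -> nat -> bool)
  (Es : symmetric (fun i j : 'I_n => E i j)) (Ei : irreflexive (fun i j : 'I_n => E i j)),
  cls (SGraph Es Ei) <-> exists2 Y, forall j, n ^ 4 <= j -> ~~ Y j & chk n E Y.

Hypothesis chk_ext : forall n E Y Y', (forall j, j < n ^ 4 -> Y j = Y' j) ->
  chk n E Y = chk n E Y'.

Lemma csum_card n (Y : nat -> bool) : csum n (fun i => Y i) = #|[set i : 'I_n | Y i]|.
Proof.
rewrite /csum cardsE -sum1_card [RHS]big_mkcond.
by apply: eq_bigr => i _; rewrite unfold_in; case: (Y i).
Qed.

Lemma verifyP x : vertex_deletion F cls x <->
  exists y, size y <= poly_bound 2 4 (size x) /\ verify (size x) (nth false x) (nth false y).
Proof.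
split=> [[n [e [Es [Ei [k [Ex HG k0 [V [HV nF]]]]]]]]|[y [_ /and4P[Hwf Hcnt Hfree Hchk]]]].
  have [Hwf Hn He Hk] := well_formed_encode Es Ei k0 Ex.
  pose E := dec_edge (size x) (nth false x).
  have Es' : symmetric (fun i j : 'I_n => E i j) by move=> i j; rewrite /E !He Es.
  have Ei' : irreflexive (fun i j : 'I_n => E i j) by move=> i; rewrite /E He Ei.
  have HG' : cls (SGraph Es' Ei').
    apply: (@cls_iso (SGraph Es Ei) (SGraph Es' Ei') id _ _ HG); first by exists id.
    by move=> i j /=; rewrite /E He.
  have [Y0 HY0 Hchk] := (chkP Es' Ei').1 HG'.
  pose inV (i : nat) := if insub i is Some i' then (i' : 'I_n) \in V else false.
  pose Y j := if j < n then inV j else Y0 (j - n).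
  have HY j : nth false (mkseq Y (n + n ^ 4)) j = Y j.
    case: (ltnP j (n + n ^ 4)) => Hj; first by rewrite nth_mkseq.
    rewrite nth_default ?size_mkseq // /Y ifF; last by lia.
    by apply/esym/negbTE/HY0; lia.
  have Hns : n <= size x.
    by rewrite -Hn; apply: ltnW; case/and4P: Hwf.
  exists (mkseq Y (n + n ^ 4)); split.
    rewrite size_mkseq /poly_bound.
    have H4 : n ^ 4 <= size x ^ 4 by rewrite leq_exp2r.
    have H1 : size x <= size x ^ 4.
      by case: (size x) => // s; rewrite -{1}[s.+1]expn1 leq_pexp2l.
    by move: H4 H1; move: (n ^ 4) (size x ^ 4) => u v; lia.
  have -> : nth false (mkseq Y (n + n ^ 4)) = Y.
    exact: functional_extensionality.
  have EV : [set i : 'I_n | Y i] = V.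
    by apply/setP => i; rewrite inE /Y ltn_ord /inV valK.
  rewrite /verify Hwf Hn csum_card EV /=; apply/and3P; split.
  - rewrite dec_capE Hk Hn leq_min HV /=.
    by rewrite -[X in _ <= X]card_ord max_card.
  - apply/(no_copy_free Y Es' Ei'); rewrite EV => /contains_deleteP[phi [[inj Hphi] av]].
    apply: nF; apply/contains_deleteP; exists phi; split=> //; split=> // u v.
    by rewrite -Hphi /= /E He.
  - rewrite (@chk_ext _ _ _ Y0) // => j _; rewrite /Y ifF ?addKn //; lia.
have [Es Ei k0 Ex] := well_formed_decode Hwf.
have HG : cls (SGraph Es Ei).
  apply/chkP; exists (fun j => (j < dec_n (size x) (nth false x) ^ 4) &&
     nth false y (dec_n (size x) (nth false x) + j)).
    by move=> j Hj; rewrite ltnNge Hj.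
  by rewrite (@chk_ext _ _ _ (fun i => nth false y (dec_n (size x) (nth false x) + i))) // => j ->.
eexists _, _, Es, Ei, _; split; [exact: Ex | exact: HG | exact: k0 |].
exists [set i : 'I_(dec_n (size x) (nth false x)) | nth false y i]; split.
  by rewrite -csum_card; move: Hcnt; rewrite dec_capE leq_min => /andP[].
exact: (no_copy_free _ Es Ei).1 Hfree.
Qed.

Hypothesis chk_computable : forall (n : seq bool -> nat) (E : seq bool -> nat -> nat -> bool)
  (Y : seq bool -> nat -> bool),
  computable (fun w _ => n w) -> computable (fun w e => E w (e 0) (e 1) : nat) ->
  computable (fun w e => Y w (e 0) : nat) ->
  computable (fun w _ => chk (n w) (E w) (Y w) : nat).

(** The bits of [x] are doubled, so the separator is the first aligned pair of unequal symbols and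
    its index is the length of [x]. *)
Let xs w := cfind (size w) (fun i => ~~ (inp w (2 * i) == inp w (2 * i).+1)).
Let bitx w i := (i < xs w) && (inp w (2 * i) == 2).
Let bity w j := inp w ((2 * xs w).+2 + j) == 2.

Lemma inp_pair_enc x y j : inp (pair_enc x y) j =
  if j < 2 * size x then (nth false x (j %/ 2)).+1 else
  if j == 2 * size x then 1 else if j == (2 * size x).+1 then 2 else
  inp y (j - (2 * size x).+2).
Proof. by rewrite /inp nth_pair_enc; do ?case: ifP. Qed.

Lemma inp_nth y j : (inp y j == 2) = nth false y j.
Proof.
rewrite /inp; case: (ltnP j (size y)) => Hj; last by rewrite !nth_default ?size_map.
by rewrite (nth_map false) //=; case: nth.
Qed.

Lemma xs_pair x y : xs (pair_enc x y) = size x.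
Proof.
apply: cfind_eq => [||i Hi].
- by rewrite size_pair_enc; lia.
- rewrite !inp_pair_enc ltnn eqxx.
  have [-> ->] : ((2 * size x).+1 < 2 * size x) = false /\
    ((2 * size x).+1 == 2 * size x) = false by split; lia.
  by rewrite eqxx.
rewrite !inp_pair_enc negbK mulKn //.
have -> : (2 * i).+1 %/ 2 = i by rewrite -addn1 mulnC divnMDl // addn0.
have [-> ->] : 2 * i < 2 * size x /\ (2 * i).+1 < 2 * size x by split; lia.
exact: eqxx.
Qed.

Lemma bitx_pair x y : bitx (pair_enc x y) = nth false x.
Proof.
apply: functional_extensionality => i; rewrite /bitx xs_pair inp_pair_enc.
case: (ltnP i (size x)) => Hi; last by rewrite [RHS]nth_default.
have -> : 2 * i < 2 * size x by lia.
by rewrite mulKn // eqSS eqb1.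
Qed.

Lemma bity_pair x y : bity (pair_enc x y) = nth false y.
Proof.
apply: functional_extensionality => j; rewrite /bity xs_pair inp_pair_enc.
have [-> -> ->] : [/\ ((2 * size x).+2 + j < 2 * size x) = false,
  ((2 * size x).+2 + j == 2 * size x) = false &
  ((2 * size x).+2 + j == (2 * size x).+1) = false] by split; lia.
by rewrite addKn inp_nth.
Qed.

Let cxs : computable (fun w _ => xs w).
Proof. by rewrite /xs; comp. Qed.

Ltac comp_xs := first [simple apply cxs | comp1].

Let cbitx : computable (fun w e => bitx w (e 0) : nat).
Proof. by rewrite /bitx; repeat comp_xs. Qed.

Let cbity : computable (fun w e => bity w (e 0) : nat).
Proof. by rewrite /bity; repeat comp_xs. Qed.

Let dn w := dec_n (xs w) (bitx w).

Ltac comp_bit := first [simple apply cxs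
  | refine (@computable1 (fun w i => bitx w i : nat) _ cbitx _)
  | refine (@computable1 (fun w i => bity w i : nat) _ cbity _) | comp1]; cbv beta.

Let cdn : computable (fun w _ => dn w).
Proof. by rewrite /dn /dec_n; repeat comp_bit. Qed.

Ltac comp_dn := first [simple apply cdn | comp_bit].

Let cedge : computable (fun w e => dec_edge (xs w) (bitx w) (e 0) (e 1) : nat).
Proof. by rewrite /dec_edge -/(dn _); repeat comp_dn. Qed.

Let clen : computable (fun w _ => dec_len (xs w) (bitx w)).
Proof. by rewrite /dec_len -/(dn _); repeat comp_dn. Qed.

Let cbit : computable (fun w e => dec_bit (xs w) (bitx w) (e 0) : nat).
Proof. by rewrite /dec_bit -/(dn _); repeat comp_dn. Qed.

Ltac comp_dec := first [simple apply cdn | simple apply clen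
  | refine (@computable2 (fun w i j => dec_edge (xs w) (bitx w) i j : nat) _ _ cedge _ _)
  | refine (@computable1 (fun w i => dec_bit (xs w) (bitx w) i : nat) _ cbit _)
  | comp_bit]; cbv beta.

Let ccap : computable (fun w _ => dec_cap (xs w) (bitx w)).
Proof.
apply: (@computable_capped (fun w _ => dec_len (xs w) (bitx w)) (fun _ _ => 0)
  (fun w e => 2 * e 0 + dec_bit (xs w) (bitx w) (dec_len (xs w) (bitx w) - (e 1).+1))
  (fun w _ => dn w)); by repeat comp_dec.
Qed.

Let cwf : computable (fun w _ => well_formed (xs w) (bitx w) : nat).
Proof. by rewrite /well_formed -/(dn _); repeat comp_dec. Qed.

Lemma computable_all (l : seq nat) (P : nat -> seq bool -> store -> bool) :
  (forall p, computable (fun w e => P p w e : nat)) ->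
  computable (fun w e => all (fun p => P p w e) l : nat).
Proof.
move=> HP; elim: l => [|p l IH] /=; first exact: computable_const.
exact: computable_and.
Qed.

Let cfree r : computable (fun w e =>
  no_copy (dn w) (dec_edge (xs w) (bitx w)) (bity w) r e : nat).
Proof.
elim: r => [|r IH] /=.
  apply: computable_neg; rewrite /is_copy; apply: computable_all => p.
  apply: computable_and; first by repeat comp_dec.
  apply: computable_all => r; apply: computable_and; first by repeat comp_dec.
  have cpr : computable (fun w e => dec_edge (xs w) (bitx w) (e p) (e r) : nat).
    by repeat comp_dec.
  case: (nth false _ _); last by apply: computable_ext (computable_neg cpr) => w e; case: dec_edge.
  by apply: computable_ext cpr => w e; case: dec_edge.
apply: computable_call; first exact: cdn.
apply: computable_ext IH => w e; congr (no_copy _ _ _ _ _ : nat).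
by apply: functional_extensionality; case.
Qed.

Lemma in_NP_vertex_deletion : in_NP (vertex_deletion F cls).
Proof.
pose g w (_ : store) := verify (xs w) (bitx w) (bity w) : nat.
exists (fun w => 0 < g w env0), 2, 4; split.
  apply: in_P_computable; rewrite /g /verify -/(dn _).
  apply: computable_and; first exact: cwf.
  apply: computable_and; first by repeat first [simple apply ccap | comp_dec].
  apply: computable_and.
    (* Renaming all variables to one that is bound to 0 turns the environment into [env0]. *)
    exact: (computable_let computable_zero (computable_ren (fun=> 0) (cfree h))).
  apply: (@chk_computable dn (fun w => dec_edge (xs w) (bitx w)) (fun w i => bity w (dn w + i))).
  - exact: cdn.
  - exact: cedge.
  - by repeat comp_dec.
move=> x; rewrite verifyP; split=> -[y [Hy Hv]]; exists y; split=> //.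
  by rewrite /g xs_pair bitx_pair bity_pair Hv.
by move: Hv; rewrite /g xs_pair bitx_pair bity_pair; case: verify.
Qed.

End Verifier.

(** * Certificates for chordal and split graphs *)

Lemma next_last (T : eqType) (x : T) p : uniq (x :: p) -> next (x :: p) (last x p) = x.
Proof.
case/lastP: p => [|p y] U; first by rewrite /= eqxx.
rewrite last_rcons -(next_rot 1 U) rot1_cons -cats1 cat_rcons next_cat //.
by move: U; rewrite -(rot_uniq 1) rot1_cons -cats1 cat_rcons.
Qed.

Lemma mem_cat_cons (T : eqType) (x : T) s : x \in s -> exists s1 s2, s = s1 ++ x :: s2.
Proof. by case/splitPr=> s1 s2; exists s1, s2. Qed.

Lemma path_shortcut (T : Type) (e : rel T) x p s1 a q b r :
  x :: p = s1 ++ a :: q ++ b :: r -> path e x p -> e a b ->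
  exists p', [/\ path e x p', last x p' = last x p & size p' + size q = size p].
Proof.
case: s1 => [|x' s1] /= [-> ->].
  rewrite cat_path /= => /and3P[_ _ Hr] ab; exists (b :: r).
  by rewrite /= ab Hr last_cat size_cat /=; split=> //; lia.
rewrite cat_path /= cat_path /= => /and5P[H1 H2 _ _ Hr] ab; exists (s1 ++ a :: b :: r).
rewrite cat_path /= H1 H2 ab Hr !last_cat /= last_cat !size_cat /= size_cat /=.
by split=> //; lia.
Qed.

Section Bypass.
Variable G : sgraph.

(* A graph is chordal iff these steps never lead from [u] to [w] when [u, v, w]
   is an induced path. *)
Definition bypass (v w : G) : rel G :=
  fun s t => edge s t && ((t == w) || ~~ edge v t && (t != v)).

Lemma bypass_path v w z s t : path (bypass v w) z s -> t \in s ->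
  (t == w) || ~~ edge v t && (t != v).
Proof.
elim: s z => //= y s IH z /andP[/andP[_ Hy] Hs].
by rewrite inE => /orP[/eqP->|/(IH _ Hs)].
Qed.

(** A shortest bypass path from [u] to [w] closes through [v] to a cycle of length at least four.
    Its steps exclude chords at [v], and any other chord would shorten the path. *)
Lemma chordal_bypass v u w : chordal G -> edge v u -> edge v w -> u != w -> ~~ edge u w ->
  ~~ connect (bypass v w) u w.
Proof.
move=> HG vu vw uw nuw; apply/connectP => -[p].
elim/ltn_ind: {p}(size p) {-2}p (erefl (size p)) => k IH p Ep Hp Hw.
move: Hw IH; rewrite -Ep => {k Ep}; case/shortenP: Hp => p' Hp' Up' sub Hw IH.
have szp : size p' <= size p by apply: uniq_leq_size => //; case/andP: Up'.
have HQ t : t \in p' -> (t == w) || ~~ edge v t && (t != v) by apply: bypass_path Hp'.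
have vw' : w != v by apply: contraTneq vw => ->; rewrite edge_irrefl.
have vp : v \notin p' by apply/negP => /HQ; rewrite eq_sym (negbTE vw') eqxx andbF.
have vu' : v != u by apply: contraTneq vu => ->; rewrite edge_irrefl.
have Uc : uniq (v :: u :: p') by rewrite /= inE negb_or vu' vp.
have Hc : ucycle (@edge G) (v :: u :: p').
  rewrite /ucycle Uc andbT /= vu /= rcons_path -Hw edge_sym vw andbT.
  by apply: sub_path Hp' => s t /andP[].
have sz : 3 < size (v :: u :: p').
  case: (p') Hw Hp' => [/= E|y [|? ?]] //=; first by rewrite E eqxx in uw.
  by move=> <- /andP[/andP[]]; rewrite (negbTE nuw).
have [a [b Hab]] := HG _ Hc sz.
have nv c d : chord (v :: u :: p') c d -> c != v.
  move=> [_ Hd cd n1 n2]; apply/negP => /eqP Ec; rewrite Ec in cd n1 n2.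
  move: Hd; rewrite !inE => /or3P[/eqP E|/eqP E|Hd].
  - by rewrite E edge_irrefl in cd.
  - by rewrite /= eqxx E eqxx in n1.
  - case/orP: (HQ d Hd) => [/eqP E|]; last by rewrite cd.
    by move: n2; rewrite E Hw -[last u p']/(last v (u :: p')) next_last ?eqxx.
have short c d s1 s2 : chord (v :: u :: p') c d -> u :: p' = s1 ++ c :: s2 -> d \in s2 -> False.
  move=> [_ _ cd n1 _] + /mem_cat_cons[q [r Es2]]; rewrite Es2 => E {Es2}.
  have Hd : d \in p'.
    move: E; case: s1 => [|? s1] [_ ->]; rewrite !mem_cat !inE ?mem_cat ?inE eqxx !orbT //.
  have bcd : bypass v w c d by rewrite /bypass cd HQ.
  have [p2 [Hp2 Hl2 Hs2]] := path_shortcut E Hp' bcd.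
  case: q E Hs2 => [|y q] E Hs2.
    by move: n1 Uc; rewrite -[v :: u :: p']cat1s E catA => + U; rewrite next_cat ?eqxx.
  apply: (IH (size p2) _ p2 erefl Hp2); last by rewrite Hl2.
  by apply: leq_trans szp; rewrite -Hs2 /= addnS ltnS leq_addr.
have Hba : chord (v :: u :: p') b a by case: Hab => ? ? ? ? ?; split=> //; rewrite edge_sym.
have na := nv _ _ Hab; have nb := nv _ _ Hba.
have [Ha Hb ab _ _] := Hab; rewrite in_cons (negbTE na) /= in Ha.
rewrite in_cons (negbTE nb) /= in Hb.
have [s1 [s2 E]] := mem_cat_cons Ha.
move: Hb; rewrite E mem_cat inE => /or3P[Hb|/eqP Eb|Hb].
- have [q [r Es1]] := mem_cat_cons Hb.
  apply: (short b a q (r ++ a :: s2)) => //; first by rewrite E Es1 -catA.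
  by rewrite mem_cat mem_head orbT.
- by rewrite Eb edge_irrefl in ab.
- exact: short Hab E Hb.
Qed.

(** On a cycle [v, u, ..., w] either [u] and [w] are adjacent, or [v] has a third neighbour, or the
    rest is a bypass path from [u] to [w], along which the closed set [R v u w] cannot be left. Any
    closed sets will do, since a certificate need not be the reachability relation. *)
Lemma bypass_chordal (R : G -> G -> G -> G -> bool) :
  (forall v u w, edge v u -> edge v w -> u != w -> ~~ edge u w ->
    [/\ R v u w u, ~~ R v u w w &
        forall s t, R v u w s -> bypass v w s t -> R v u w t]) ->
  chordal G.
Proof.
move=> HR [|v [|u p]] // /andP[Hc U] sz; set w := last u p.
have /and3P[vu Hp wv] : [&& edge v u, path (@edge G) u p & edge w v].
  by move: Hc; rewrite /= rcons_path.
have p0 : p != [::] by case: (p) sz.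
have wp : w \in p by rewrite /w; case: (p) p0 => // y q _; exact: (mem_last y q).
have nw : next (v :: u :: p) w = v by apply: (next_last U).
have /and3P[] : [&& v \notin u :: p, u \notin p & uniq p] by [].
rewrite inE negb_or => /andP[vu' vp] up Up.
have uw : u != w by apply: contraNneq up => ->.
case: (boolP (edge u w)) => [Euw|nuw].
  exists u, w; split; rewrite ?nw ?inE ?eqxx ?wp ?orbT //; last by rewrite eq_sym.
  case: (p) p0 sz U Up @w {Hc Hp wv wp nw vp up uw Euw} => // y q _ sz U Up w.
  rewrite -[v :: _]cat1s next_cat // /w.
  case: q sz Up {U w} => // z q _ /andP[Hy _].
  by apply: contraNneq Hy => /= Ey; rewrite -{1}Ey; exact: (mem_last z q).
case: (boolP (has (fun t => (t != w) && edge v t) p)) => [/hasP[t tp /andP[tw vt]]|Hn].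
  exists v, t; split; rewrite ?inE ?eqxx ?tp ?orbT //.
    by rewrite /= eqxx; apply: contraNneq up => <-.
  have [q1 [[|y q2] E]] := mem_cat_cons tp.
    by move: tw; rewrite /w E last_cat eqxx.
  move: U vp; rewrite E -[v :: u :: _]/([:: v; u] ++ _) catA => U.
  rewrite next_cat //; apply: contraNneq => ->.
  by rewrite mem_cat !inE eqxx !orbT.
rewrite edge_sym in wv; have [Ru nRw Rc] := HR v u w vu wv uw nuw.
case/negP: nRw; rewrite -/w {1}/w.
have Hall t : t \in p -> (t == w) || ~~ edge v t && (t != v).
  move=> tp; move/hasPn/(_ t tp): Hn; rewrite negb_and negbK => /orP[->//|->].
  by rewrite (_ : t != v) ?orbT //; apply: contraNneq vp => <-.
have closed q z : R v u w z -> path (@edge G) z q ->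
    {in q, forall t, (t == w) || ~~ edge v t && (t != v)} -> R v u w (last z q).
  elim: q z => //= y q IH z Rz /andP[zy Hq] HQ; apply: IH => //.
    by apply: Rc Rz _; rewrite /bypass zy HQ ?mem_head.
  by move=> t tq; apply: HQ; rewrite inE tq orbT.
exact: closed.
Qed.

End Bypass.

Definition quad (n v u w t : nat) : nat := ((v * n + u) * n + w) * n + t.

Lemma quad_bound n v u w t : v < n -> u < n -> w < n -> t < n -> quad n v u w t < n ^ 4.
Proof.
have step x y m : x < m -> y < n -> x * n + y < m * n by nia.
move=> Hv Hu Hw Ht; have -> : n ^ 4 = n * n * n * n by rewrite !expnS expn0 muln1 !mulnA.
by do 3 apply: (step) => //.
Qed.

Lemma quad_inj n v u w t v' u' w' t' : u < n -> w < n -> t < n -> u' < n -> w' < n -> t' < n ->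
  quad n v u w t = quad n v' u' w' t' -> [/\ v = v', u = u', w = w' & t = t'].
Proof.
have inj x y x' y' : y < n -> y' < n -> x * n + y = x' * n + y' -> x = x' /\ y = y'.
  move=> Hy Hy' E; have n0 : 0 < n by lia.
  split; first by have := congr1 (divn^~ n) E; rewrite /= !divnMDl // !divn_small // !addn0.
  by have := congr1 (modn^~ n) E; rewrite /= !modnMDl !modn_small.
move=> Hu Hw Ht Hu' Hw' Ht' /(inj _ _ _ _ Ht Ht')[+ ->].
by move=> /(inj _ _ _ _ Hw Hw')[+ ->] => /(inj _ _ _ _ Hu Hu')[-> ->].
Qed.

(* The certificate [Y (quad n v u w t)] is a set of vertices [t] that contains
   [u] but not [w] and that is closed under the steps avoiding [v]. *)
Definition chk_chordal (n : nat) (E : nat -> nat -> bool) (Y : nat -> bool) : bool :=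
  call n (fun v => call n (fun u => call n (fun w =>
    (E v u && (E v w && (~~ (u == w) && ~~ E u w))) ==>
    (Y (quad n v u w u) && (~~ Y (quad n v u w w) &&
     call n (fun s => call n (fun t =>
       (Y (quad n v u w s) && (E s t && ((t == w) || (~~ E v t && ~~ (t == v))))) ==>
       Y (quad n v u w t)))))))).

(** [Y] is the indicator of the clique side. *)
Definition chk_split (n : nat) (E : nat -> nat -> bool) (Y : nat -> bool) : bool :=
  call n (fun u => call n (fun v =>
    ((Y u && (Y v && ~~ (u == v))) ==> E u v) && ((~~ Y u && ~~ Y v) ==> ~~ E u v))).

Lemma eq_call n (P Q : nat -> bool) : (forall i, i < n -> P i = Q i) -> call n P = call n Q.
Proof. by move=> H; apply: eq_in_all => i; rewrite mem_iota => /H. Qed.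

Lemma chk_chordal_ext n E Y Y' : (forall j, j < n ^ 4 -> Y j = Y' j) ->
  chk_chordal n E Y = chk_chordal n E Y'.
Proof.
move=> H; apply: eq_call => v Hv; apply: eq_call => u Hu; apply: eq_call => w Hw.
rewrite !H ?quad_bound //; congr (_ ==> (_ && (_ && _))).
apply: eq_call => s Hs; apply: eq_call => t Ht.
by rewrite !H ?quad_bound.
Qed.

Lemma chk_split_ext n E Y Y' : (forall j, j < n ^ 4 -> Y j = Y' j) ->
  chk_split n E Y = chk_split n E Y'.
Proof.
move=> H; apply: eq_call => u Hu; apply: eq_call => v Hv.
have le i : i < n -> i < n ^ 4.
  by move=> Hi; apply: leq_trans Hi _; case: n {H Hu Hv} => // n; rewrite -{1}[n.+1]expn1 leq_pexp2l.
by rewrite !H ?le.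
Qed.

Section Checks.
Variables (n : nat) (E : nat -> nat -> bool).
Hypotheses (Es : symmetric (fun i j : 'I_n => E i j)) (Ei : irreflexive (fun i j : 'I_n => E i j)).
Let G := SGraph Es Ei.

Lemma chk_chordalP :
  chordal G <-> exists2 Y, forall j, n ^ 4 <= j -> ~~ Y j & chk_chordal n E Y.
Proof.
split=> [HG|[Y _ Hchk]].
  (* The canonical certificate: what can be reached from [u] by bypass steps. *)
  pose Y j := [exists v : 'I_n, [exists u : 'I_n, [exists w : 'I_n, [exists t : 'I_n,
    (j == quad n v u w t) && connect (bypass (G := G) v w) u t]]]].
  have YE (v u w t : 'I_n) : Y (quad n v u w t) = connect (bypass (G := G) v w) u t.
    apply/existsP/idP => [[v' /existsP[u' /existsP[w' /existsP[t' /andP[/eqP Eq Hc]]]]]|Hc].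
      have [Ev Eu Ew Et] := quad_inj (ltn_ord u) (ltn_ord w) (ltn_ord t) (ltn_ord u')
         (ltn_ord w') (ltn_ord t') Eq.
      by rewrite (val_inj Ev) (val_inj Eu) (val_inj Ew) (val_inj Et).
    exists v; apply/existsP; exists u; apply/existsP; exists w; apply/existsP; exists t.
    by rewrite eqxx.
  exists Y => [j Hj|].
    apply/existsP => -[v' /existsP[u' /existsP[w' /existsP[t' /andP[/eqP Eq _]]]]].
    by move: Hj; rewrite Eq leqNgt quad_bound.
  apply/callP => v Hv; apply/callP => u Hu; apply/callP => w Hw; apply/implyP.
  move=> /and4P[vu vw uw nuw].
  rewrite (YE (Ordinal Hv) (Ordinal Hu) (Ordinal Hw) (Ordinal Hu)).
  rewrite (YE (Ordinal Hv) (Ordinal Hu) (Ordinal Hw) (Ordinal Hw)) connect0 /=.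
  rewrite (@chordal_bypass G (Ordinal Hv) (Ordinal Hu) (Ordinal Hw)) //=.
  apply/callP => s Hs; apply/callP => t Ht; apply/implyP.
  rewrite (YE (Ordinal Hv) (Ordinal Hu) (Ordinal Hw) (Ordinal Hs)).
  rewrite (YE (Ordinal Hv) (Ordinal Hu) (Ordinal Hw) (Ordinal Ht)) => /andP[Hc Hst].
  by apply: connect_trans Hc _; apply: connect1.
apply: (@bypass_chordal G (fun v u w t : 'I_n => Y (quad n v u w t))) => v u w vu vw uw nuw.
move/callP/(_ v (ltn_ord v))/callP/(_ u (ltn_ord u))/callP/(_ w (ltn_ord w))/implyP: Hchk.
have -> : E v u && (E v w && (~~ (u == w :> nat) && ~~ E u w)).
  by apply/and4P; split.
move=> /(_ isT)/and3P[H1 H2 /callP H3]; split=> // s t Hs Hst.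
by move/callP/(_ t (ltn_ord t))/implyP: (H3 s (ltn_ord s)); apply; rewrite Hs.
Qed.

Lemma chk_splitP :
  split_graph G <-> exists2 Y, forall j, n ^ 4 <= j -> ~~ Y j & chk_split n E Y.
Proof.
split=> [[C [I [CI dis HC HI]]]|[Y _ Hchk]].
  pose Y j := if insub j is Some i then (i : 'I_n) \in C else false.
  have YE (i : 'I_n) : Y i = (i \in C) by rewrite /Y valK.
  exists Y => [j Hj|].
    rewrite /Y insubF //; apply/negbTE; rewrite -leqNgt; apply: leq_trans Hj.
    by case: (n) => // k; rewrite -{1}[k.+1]expn1 leq_pexp2l.
  apply/callP => u Hu; apply/callP => v Hv.
  rewrite (YE (Ordinal Hu)) (YE (Ordinal Hv)); apply/andP; split; apply/implyP.
    by move=> /and3P[uC vC uv]; apply: (HC (Ordinal Hu) (Ordinal Hv)).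
  have inI (i : 'I_n) : i \notin C -> i \in I.
    move=> iC; have : i \in C :|: I by rewrite CI inE.
    by rewrite inE (negbTE iC).
  by move=> /andP[/inI uI /inI vI]; apply: (HI (Ordinal Hu) (Ordinal Hv)).
have Huv (u v : 'I_n) : ((Y u && (Y v && ~~ (u == v :> nat))) ==> E u v) /\
    ((~~ Y u && ~~ Y v) ==> ~~ E u v).
  by apply/andP; move/callP/(_ u (ltn_ord u))/callP/(_ v (ltn_ord v)): Hchk.
exists [set i : G | Y (i : 'I_n)], [set i : G | ~~ Y (i : 'I_n)]; split.
- by apply/setP => i; rewrite !inE orbN.
- by apply/setP => i; rewrite !inE andbN.
- move=> u v; rewrite !inE => Hu Hv uv; have [/implyP H _] := Huv u v.
  by apply: H; rewrite Hu Hv.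
- move=> u v; rewrite !inE => Hu Hv; have [_ /implyP H] := Huv u v.
  by apply: H; rewrite Hu Hv.
Qed.

End Checks.

Section ChecksComputable.
Variables (n : seq bool -> nat) (E : seq bool -> nat -> nat -> bool) (Y : seq bool -> nat -> bool).
Hypothesis cn : computable (fun w _ => n w).
Hypothesis cE : computable (fun w e => E w (e 0) (e 1) : nat).
Hypothesis cY : computable (fun w e => Y w (e 0) : nat).

Ltac comp_chk := first [simple apply cn
  | refine (@computable2 (fun w i j => E w i j : nat) _ _ cE _ _)
  | refine (@computable1 (fun w i => Y w i : nat) _ cY _) | comp1]; cbv beta.

Lemma computable_chk_chordal : computable (fun w _ => chk_chordal (n w) (E w) (Y w) : nat).
Proof. by rewrite /chk_chordal /quad; repeat comp_chk. Qed.

Lemma computable_chk_split : computable (fun w _ => chk_split (n w) (E w) (Y w) : nat).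
Proof. by rewrite /chk_split; repeat comp_chk. Qed.

End ChecksComputable.

(** * Hardness for a graph class and the theorem *)

Lemma NP_hard_vertex_deletion (F : sgraph) (a b : F) (cls : sgraph -> Prop) :
  edge a b -> biconnected F -> ~ complete F -> iso_closed cls ->
  (forall N (H : rel 'I_N), irreflexive H -> cls (gadget a b H)) ->
  NP_hard (vertex_deletion F cls).
Proof.
move=> Fab HF ncF cls_iso cls_gadget L [V [qc [qd [[M [tc [td HM]]] HL]]]].
(* Clauses have width 5: the four premises and the conclusion of a transition. *)
apply: (@reduces_satisfiable F a b cls (cl_num M qc qd tc td) 5
  (cl_var M qc qd tc td) (cl_sgn M qc qd tc td)) => //.
- exact: cl_num_gt0.
- exact: computable_cl_num.
- exact: computable_cl_var.
- exact: computable_cl_sgn.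
by move=> x; rewrite HL; apply: satisfiable_tableau.
Qed.

Theorem theorem10 (F : sgraph)
  (F_biconnected : biconnected F) (F_chordal : chordal F)
  (F_not_complete : ~ complete F) :
  NP_complete (vertex_deletion F chordal) /\
  ((exists C I : {set F},
      [/\ complete_split_partition C I, #|C| = 2 & 2 <= #|I|]) ->
   NP_complete (vertex_deletion F split_graph)).
Proof.
have ch_iso : iso_closed chordal by move=> G H f; apply: chordal_iso.
have sp_iso : iso_closed split_graph by move=> G H f; apply: split_iso.
split=> [|[C [I [[CI _] C2 _]]]]; split.
- exact: in_NP_vertex_deletion ch_iso chk_chordalP chk_chordal_ext computable_chk_chordal.
- have [conn F2 _] := F_biconnected.
  have /card_gt0P[a _] : 0 < #|F| by apply: leq_trans F2.
  have [b Fab] := connected_neighbour a conn F2.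
  apply: (NP_hard_vertex_deletion Fab) => // N H Hirr; exact: gadget_chordal.
- exact: in_NP_vertex_deletion sp_iso chk_splitP chk_split_ext computable_chk_split.
(* The glued edge has to be [C] itself, so that all interior vertices come from the independent
   side. *)
- have /eqP/cards2P[a [b [ab EC]]] := C2; have [_ _ HC _] := CI.
  have Fab : edge a b by apply: HC; rewrite // EC !inE eqxx ?orbT.
  apply: (NP_hard_vertex_deletion Fab) => // N H Hirr; exact: gadget_split CI EC.
Qed.
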